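(* Let $L\subset TM\oplus T^*M$ be a Dirac structure on a manifold $M$. Every $m\in M$ has an embedded neighborhood $\phi:S\times N\hookrightarrow M$, $(s,n)\mapsto m$ (i.e. there are manifolds $S$, $N$, points $s\in S$, $n\in N$, and an open embedding $\phi$ with $\phi(s,n)=m$) such that $$\phi^*L=e^{\omega}\bigl(TS\times\mathrm{Graph}(\Pi)\bigr),$$ where $\Pi$ is a Poisson bivector on $N$ and $\omega$ is a closed 2-form on $S\times N$ that vanishes at $(s,n)$.
   Context: A Dirac structure on $M$ is a smooth vector subbundle $L\subset TM\oplus T^*M$ that is maximally isotropic for $\langle X+\alpha,Y+\beta\rangle_+=\tfrac12(i_X\beta+i_Y\alpha)$ and closed under the Dorfman bracket $[X+\alpha,Y+\beta]=[X,Y]+\mathcal{L}_X\beta-i_Yd\alpha$. For an open embedding $\phi$, $\phi^*L$ is the Dirac structure $\{X+\phi^*\beta\mid d\phi(X)+\beta\in L\}$. The product of Dirac structures $L$ on $M$ and $L'$ on $M'$ is $L\times L'=\{(X,X')\oplus(\alpha,\alpha')\mid X+\alpha\in L,\ X'+\alpha'\in L'\}\subset T(M\times M')\oplus T^*(M\times M')$. $TS$ denotes the Dirac structure $\{X+0\}\subset TS\oplus T^*S$ on $S$; $\mathrm{Graph}(\Pi)=\{i_\alpha\Pi+\alpha\mid\alpha\in T^*N\}$. The gauge transformation of $L$ by a closed 2-form $\omega$ is $e^\omega L=\{X+\alpha+i_X\omega\mid X+\alpha\in L\}$. Zero-dimensional factors are allowed. *)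

(* Defs.v *)
From HB Require Import structures.
From mathcomp Require Import all_boot all_order all_algebra.
From mathcomp Require Import all_classical all_reals all_analysis.

Set Implicit Arguments.
Unset Strict Implicit.
Unset Printing Implicit Defensive.

Import Order.TTheory GRing.Theory Num.Theory.
Import numFieldNormedType.Exports.

Local Open Scope classical_set_scope.
Local Open Scope ring_scope.

(* [smooth_on A f] is only meant for [A] open. *)
Fixpoint Ck_on (R : realType) (V W : normedModType R) (k : nat) (A : set V)
    (f : V -> W) : Prop :=
  match k with
  | 0 => {in A, continuous f}
  | k'.+1 => (forall x, A x -> differentiable f x) /\
             (forall v, Ck_on k' A ('D_v f))
  end.

Definition smooth_on (R : realType) (V W : normedModType R) (A : set V)
    (f : V -> W) : Prop :=
  forall k, Ck_on k A f.

(* A chart of [T] with values in R^n: [toE] is meaningful on [dom] only, and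
   [ofE] on [toE @` dom] only. *)
Record chart (R : realType) (T : Type) (n : nat) := Chart {
  dom : set T;
  toE : T -> 'rV[R]_n;
  ofE : 'rV[R]_n -> T }.

Definition chart_valid (R : realType) (T : topologicalType) (n : nat)
    (c : chart R T n) : Prop :=
  [/\ open (dom c),
      open (toE c @` dom c),
      forall p, dom c p -> ofE c (toE c p) = p,
      {in dom c, continuous (toE c)} &
      {in toE c @` dom c, continuous (ofE c)}].

Record charted (R : realType) (n : nat) := Charted {
  carrier :> topologicalType;
  atlas : set (chart R carrier n);
  chart_at : carrier -> chart R carrier n }.

Arguments atlas {R n} M : rename.
Arguments chart_at {R n M} p : rename.

Definition smooth_manifold (R : realType) (n : nat) (M : charted R n) : Prop :=
  [/\ hausdorff_space M,
      @second_countable M,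
      forall c, atlas M c -> chart_valid c,
      forall p : M, atlas M (chart_at p) /\ dom (chart_at p) p &
      forall c c' : chart R M n, atlas M c -> atlas M c' ->
        smooth_on (toE c @` (dom c `&` dom c')) (toE c' \o ofE c)].

Definition prod_chart (R : realType) (S N : Type) (k l : nat)
    (c : chart R S k) (c' : chart R N l) : chart R (S * N)%type (k + l) :=
  Chart (dom c `*` dom c')
        (fun x => row_mx (toE c x.1) (toE c' x.2))
        (fun v => (ofE c (lsubmx v), ofE c' (rsubmx v))).

Definition prod_charted (R : realType) (k l : nat) (S : charted R k)
    (N : charted R l) : charted R (k + l) :=
  @Charted R (k + l) (S * N)%type
    [set d | exists c c', [/\ atlas S c, atlas N c' & d = prod_chart c c']]
    (fun x => prod_chart (chart_at x.1) (chart_at x.2)).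

(* The tangent space T_pM is R^n read in the chart [chart_at p], and T*_pM is
   R^n in the dual coordinates: a covector [a] sends [u] to [(u *m a^T) 0 0].
   A bilinear form on T_pM (or on T*_pM) with matrix [B] sends [(u, v)] to
   [(u *m B *m v^T) 0 0], so that its contraction with [u] is [u *m B].
   Jacobians act on row vectors from the right. *)
Definition TT (R : realType) (n : nat) : Type := ('rV[R]_n * 'rV[R]_n)%type.

Section Tensors.
Variables (R : realType) (n : nat) (M : charted R n).
Implicit Types (c : chart R M n) (p : M).

Definition to_chart c p : 'M[R]_n :=
  jacobian (toE c \o ofE (chart_at p)) (toE (chart_at p) p).

Definition of_chart c p : 'M[R]_n :=
  jacobian (toE (chart_at p) \o ofE c) (toE c p).

Definition loc_vector c (X : M -> 'rV[R]_n) : 'rV[R]_n -> 'rV[R]_n :=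
  fun x => let p := ofE c x in X p *m to_chart c p.

Definition loc_covector c (a : M -> 'rV[R]_n) : 'rV[R]_n -> 'rV[R]_n :=
  fun x => let p := ofE c x in a p *m (of_chart c p)^T.

Definition loc_form2 c (w : M -> 'M[R]_n) : 'rV[R]_n -> 'M[R]_n :=
  fun x => let p := ofE c x in of_chart c p *m w p *m (of_chart c p)^T.

Definition loc_bivector c (P : M -> 'M[R]_n) : 'rV[R]_n -> 'M[R]_n :=
  fun x => let p := ofE c x in (to_chart c p)^T *m P p *m to_chart c p.

Definition smooth_section (U : set M) (e : M -> TT R n) : Prop :=
  forall c, atlas M c ->
    smooth_on (toE c @` (dom c `&` U)) (loc_vector c (fun p => (e p).1)) /\
    smooth_on (toE c @` (dom c `&` U)) (loc_covector c (fun p => (e p).2)).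

Definition form2 (w : M -> 'M[R]_n) : Prop :=
  (forall p, (w p)^T = - w p) /\
  (forall c, atlas M c -> smooth_on (toE c @` dom c) (loc_form2 c w)).

Definition bivector (P : M -> 'M[R]_n) : Prop :=
  (forall p, (P p)^T = - P p) /\
  (forall c, atlas M c -> smooth_on (toE c @` dom c) (loc_bivector c P)).

Definition ext_deriv2 (w : M -> 'M[R]_n) p (u v z : 'rV[R]_n) : R :=
  let c := chart_at p in
  let x := toE c p in
  let W := loc_form2 c w in
  (u *m 'D_z W x *m v^T + v *m 'D_u W x *m z^T + z *m 'D_v W x *m u^T) 0 0.

Definition closed_form2 (w : M -> 'M[R]_n) : Prop :=
  form2 w /\ forall p u v z, ext_deriv2 w p u v z = 0.

(* In coordinates, [Pi, Pi]^{ijk} is, up to a nonzero constant factor, the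
   cyclic sum over (i, j, k) of \sum_l Pi^{il} d_l Pi^{jk}; here it is
   contracted with the covectors a, b, g. *)
Definition schouten_square (P : M -> 'M[R]_n) p (a b g : 'rV[R]_n) : R :=
  let c := chart_at p in
  let x := toE c p in
  let Q := loc_bivector c P in
  (b *m 'D_(a *m Q x) Q x *m g^T + g *m 'D_(b *m Q x) Q x *m a^T
   + a *m 'D_(g *m Q x) Q x *m b^T) 0 0.

Definition poisson (P : M -> 'M[R]_n) : Prop :=
  bivector P /\ forall p a b g, schouten_square P p a b g = 0.

End Tensors.

Section Coordinates.
Variables (R : realType) (n : nat).
Implicit Types X Y a : 'rV[R]_n -> 'rV[R]_n.

Definition lie_bracket X Y x : 'rV[R]_n := 'D_(X x) Y x - 'D_(Y x) X x.

(* (L_X a)(v) = X(a(v)) - a([X, v]) = (D_X a)(v) + a(D_v X), v constant *)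
Definition lie_covector X a x : 'rV[R]_n :=
  'D_(X x) a x + a x *m (jacobian X x)^T.

(* da(Y, v) = (D_Y a)(v) - (D_v a)(Y), v constant *)
Definition contract_d Y a x : 'rV[R]_n :=
  'D_(Y x) a x - Y x *m (jacobian a x)^T.

End Coordinates.

Section Dirac.
Variables (R : realType) (n : nat) (M : charted R n).

Definition dorfman (e f : M -> TT R n) (p : M) : TT R n :=
  let c := chart_at p in
  let x := toE c p in
  let X := loc_vector c (fun q => (e q).1) in
  let a := loc_covector c (fun q => (e q).2) in
  let Y := loc_vector c (fun q => (f q).1) in
  let b := loc_covector c (fun q => (f q).2) in
  (lie_bracket X Y x, lie_covector X b x - contract_d Y a x).

Definition pairing (w z : TT R n) : R :=
  2^-1 * ((w.1 *m z.2^T) 0 0 + (z.1 *m w.2^T) 0 0).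

Definition isotropic (A : set (TT R n)) : Prop :=
  forall w z, A w -> A z -> pairing w z = 0.

Definition max_isotropic (A : set (TT R n)) : Prop :=
  isotropic A /\
  forall V : {vspace ('rV[R]_n * 'rV[R]_n)%type},
    isotropic [set` V] -> A `<=` [set` V] -> A = [set` V].

Definition smooth_subbundle (L : M -> set (TT R n)) : Prop :=
  exists r : nat, forall p : M,
    exists (U : set M) (e : 'I_r -> M -> ('rV[R]_n * 'rV[R]_n)%type),
      [/\ open U, U p, forall i, smooth_section U (e i) &
          forall q, U q ->
            free [seq e i q | i : 'I_r] /\
            L q = [set` <<[seq e i q | i : 'I_r]>>%VS]].

(* Sections of [L] are taken over arbitrary open subsets of [M]. *)
Definition involutive (L : M -> set (TT R n)) : Prop :=
  forall (U : set M) (e f : M -> TT R n),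
    open U -> smooth_section U e -> smooth_section U f ->
    (forall q, U q -> L q (e q)) -> (forall q, U q -> L q (f q)) ->
    forall q, U q -> L q (dorfman e f q).

Definition dirac_structure (L : M -> set (TT R n)) : Prop :=
  [/\ smooth_subbundle L, forall p, max_isotropic (L p) & involutive L].

Definition tangent_dirac (p : M) : set (TT R n) := [set w | w.2 = 0].

Definition graph_bivector (P : M -> 'M[R]_n) (p : M) : set (TT R n) :=
  [set (a *m P p, a) | a in [set: 'rV[R]_n]].

Definition gauge (w : M -> 'M[R]_n) (L : M -> set (TT R n)) (p : M) :
    set (TT R n) :=
  [set (z.1, z.2 + z.1 *m w p) | z in L p].

End Dirac.

Definition prod_dirac (R : realType) (k l : nat) (S : charted R k)
    (N : charted R l) (L : S -> set (TT R k)) (L' : N -> set (TT R l))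
    (x : prod_charted S N) : set (TT R (k + l)) :=
  [set w | exists z z', [/\ L x.1 z, L' x.2 z' &
                            w = (row_mx z.1 z'.1, row_mx z.2 z'.2)]].

Section Maps.
Variables (R : realType) (k n : nat) (M' : charted R k) (M : charted R n).
Implicit Types phi : M' -> M.

Definition smooth_map phi : Prop :=
  continuous phi /\
  forall (c : chart R M' k) (d : chart R M n), atlas M' c -> atlas M d ->
    smooth_on (toE c @` (dom c `&` phi @^-1` dom d)) (toE d \o phi \o ofE c).

Definition tangent_map phi (p : M') : 'M[R]_(k, n) :=
  jacobian (toE (chart_at (phi p)) \o phi \o ofE (chart_at p))
           (toE (chart_at p) p).

(* i.e. a diffeomorphism onto an open subset *)
Definition open_embedding phi : Prop :=
  [/\ smooth_map phi, injective phi,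
      forall U : set M', open U -> open (phi @` U) &
      forall p, row_free (tangent_map phi p) && row_full (tangent_map phi p)].

Definition pullback_dirac phi (L : M -> set (TT R n)) (p : M') :
    set (TT R k) :=
  [set w | exists X b, L (phi p) (X *m tangent_map phi p, b) /\
                       w = (X, b *m (tangent_map phi p)^T)].

End Maps.

(* Main.v *)
Require Import Defs.
From HB Require Import structures.
From mathcomp Require Import all_boot all_order all_algebra.
From mathcomp Require Import all_classical all_reals all_analysis.
From mathcomp Require Import ring lra.

(** In coordinates centred at [m] and adapted to [L_m], write [s] for the
    directions of [L_m] tangent to [M] and [y] for the remaining ones.  A frame
    [X_i + a_i] of [L], normalised at the origin, defines for each [p = (s, y)]
    the section [sum_i s_i (X_i + a_i)].  A Picard iteration on integrals over
    the rays [t |-> (t s, y)] yields new coordinates [Phi] in which the vector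
    part of this section is the radial field [E = sum_i s_i d/ds_i]; its
    covector part is then [i_E omega] for a closed two-form [omega] obtained by
    the radial Poincare homotopy, so [E + 0] is a section of [e^(-omega) L].
    Involutivity applied to [E] turns the blocks of a normalised frame of
    [e^(-omega) L] into solutions of [E A = -2 A], [E B = -B] and [E P = 0];
    smoothness at [s = 0] forces [A = B = 0] and [P = P(y)], i.e. the frame is
    that of [TS x Graph P], and involutivity for the rows of [P] is the Jacobi
    identity.  Since [Phi] is a small Lipschitz perturbation of the identity, it
    is a diffeomorphism onto an open set. *)

Set Implicit Arguments.
Unset Strict Implicit.
Unset Printing Implicit Defensive.

Import Order.TTheory GRing.Theory Num.Theory.
Import numFieldNormedType.Exports.

Local Open Scope classical_set_scope.
Local Open Scope ring_scope.

(** * Functions of class C^k *)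

(** The intersection of [L] with the tangent bundle may change rank near [m], so there is no
    distribution to straighten. Only the radial section is straightened. It vanishes on the slice
    [s = 0], which makes its equation singular there; ray integrals remove the singularity, at the
    price that smoothness of the fixed point has to be proved through the derivatives of all the
    iterates. Each differentiated iteration is linear with the same contraction factor, so one
    radius serves all orders.

    Involutivity enters as the vanishing of one function, [tor], which is trilinear on isotropic
    frames, natural under coordinate changes and insensitive to closed gauge terms; each move of the
    proof preserves it.

    Tangent spaces are read in [chart_at p], which may jump with [p]. All calculus therefore takes
    place in the single chart at [m], and involutivity, stated at each point in that point's own
    chart, is transported there.

    Maximality is used at [m], where it makes a mixed block of the frame invertible. Invertibility
    is an open condition, and near [m] it implies that the adapted rows still span [L]. *)

Section Differentiability.
Context {R : realType} {V : normedModType R}.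

Lemma differentiable_expand (W : normedModType R) (f : V -> W)
    (df : {linear V -> W}) x :
  continuous df ->
  (forall e, 0 < e ->
     \forall h \near (0 : V), `|f (h + x) - f x - df h| <= e * `|h|) ->
  differentiable f x /\ 'd f x = df :> (V -> W).
Proof.
move=> cdf fe.
have fo : f \o shift x = cst (f x) + df +o_ 0 id.
  apply/eqaddoP => e e0; have := fe _ e0; apply: filterS => h /=.
  by rewrite !fctE /= opprD addrA.
have dE := diff_unique cdf fo; split=> //.
by apply/diff_locallyP; rewrite dE.
Qed.

Lemma near_eq_differentiable (W : normedModType R) (f g : V -> W) x :
  (\forall y \near x, f y = g y) -> differentiable f x -> differentiable g x.
Proof.
move=> fg fx; have [cd fo] := (diff_locallyP x f).1 fx.
suff [] : differentiable g x /\ 'd g x = 'd f x :> (V -> W) by [].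
apply: (differentiable_expand cd) => e e0.
have /eqaddoP/(_ _ e0) := fo.
have gx : g x = f x by rewrite (nbhs_singleton fg).
have : \forall h \near (0 : V), f (h + x) = g (h + x).
  have := fg; rewrite (near_shift 0) => fg0; apply: filterS fg0 => h /=.
  by rewrite subr0.
apply: filterS2 => h /= fgh; rewrite !fctE /= opprD addrA.
by rewrite /shift /= fgh gx.
Qed.

Lemma differentiable_mxP m n (F : V -> 'M[R]_(m, n)) x :
  differentiable F x <-> forall i j, differentiable (fun y => F y i j) x.
Proof.
split=> [dF i j|dF].
  exact: (differentiable_comp dF (differentiable_coord _ i j)).
have -> : F = \sum_(i < m) \sum_(j < n) (fun y => F y i j *: delta_mx i j).
  apply/funext => y; rewrite fct_sumE [LHS]matrix_sum_delta.
  by apply: eq_bigr => i _; rewrite fct_sumE.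
apply: differentiable_sum => i; apply: differentiable_sum => j.
exact: differentiableZl.
Qed.

Lemma derive_entry m n (F : V -> 'M[R]_(m, n)) x v i j :
  differentiable F x -> ('D_v F x) i j = 'D_v (fun y => F y i j) x.
Proof. by move=> dF; rewrite derive_mx ?mxE//; exact: diff_derivable. Qed.

Lemma derive_comp (U W : normedModType R) (f : V -> U) (g : U -> W) x v :
  differentiable f x -> differentiable g (f x) ->
  'D_v (g \o f) x = 'D_('D_v f x) g (f x).
Proof.
move=> df dg; have dgf := differentiable_comp df dg.
by rewrite (deriveE _ dgf) (deriveE _ dg) (deriveE _ df) (diff_comp df dg).
Qed.

Lemma derive_linZ (W : normedModType R) (f : V -> W) x a u :
  differentiable f x -> 'D_(a *: u) f x = a *: 'D_u f x.
Proof. by move=> df; rewrite !deriveE// linearZ. Qed.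

End Differentiability.

Notation EE j := (delta_mx 0 j).

Lemma derive_coords (R : realType) n (W : normedModType R) (f : 'rV[R]_n -> W) x v :
  differentiable f x -> 'D_v f x = \sum_j v 0 j *: 'D_(EE j) f x.
Proof.
move=> df; rewrite deriveE// {1}(row_sum_delta v) linear_sum.
by apply: eq_bigr => j _; rewrite linearZ deriveE.
Qed.

Section CkGeneral.
Context {R : realType} {V : normedModType R}.
Implicit Types (A : set V).

Lemma Ck_on_cont (W : normedModType R) k A (f : V -> W) :
  Ck_on k A f -> {in A, continuous f}.
Proof.
case: k => //= k [df _] x; rewrite inE => /df.
exact: differentiable_continuous.
Qed.

Lemma Ck_onW (W : normedModType R) k A (f : V -> W) :
  Ck_on k.+1 A f -> Ck_on k A f.
Proof.
elim: k f => [|k IH] f; first exact: Ck_on_cont.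
by move=> [df Df]; split=> // v; exact: IH.
Qed.

Lemma Ck_on_sub (W : normedModType R) k A B (f : V -> W) :
  B `<=` A -> Ck_on k A f -> Ck_on k B f.
Proof.
move=> BA; elim: k f => [|k IH] f /=.
  by move=> cf x; rewrite inE => /BA Ax; apply: cf; rewrite inE.
by move=> [df Df]; split=> [x /BA /df//|v]; exact: IH.
Qed.

Lemma open_nearP A (P : V -> Prop) x :
  open A -> A x -> (forall y, A y -> P y) -> \forall y \near x, P y.
Proof.
move=> oA Ax AP; apply: (@filterS _ (nbhs x) _ A) => //.
exact: open_nbhs_nbhs.
Qed.

Lemma derive_congr (W : normedModType R) A (f g : V -> W) x v :
  open A -> (forall x, A x -> f x = g x) -> A x -> 'D_v f x = 'D_v g x.
Proof. by move=> oA fg Ax; apply: near_eq_derive; exact: open_nearP fg. Qed.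

(** Openness of [A] is what lets agreement on [A] survive differentiation. *)
Lemma Ck_on_congr (W : normedModType R) k A (f g : V -> W) :
  open A -> (forall x, A x -> f x = g x) -> Ck_on k A f -> Ck_on k A g.
Proof.
move=> oA; elim: k f g => [|k IH] f g fg /=.
  move=> cf x xA; have Ax : A x by rewrite inE in xA.
  have := cf x xA; rewrite /continuous_at fg//; apply: cvg_trans.
  apply: near_eq_cvg; apply: open_nearP oA Ax _ => y Ay; by rewrite fg.
move=> [df Df]; split=> [x Ax|v].
  by apply: near_eq_differentiable (df x Ax); exact: open_nearP fg.
by apply: IH (Df v) => x Ax; exact: derive_congr fg Ax.
Qed.

Lemma Ck_on_cst (W : normedModType R) k A (c : W) : Ck_on k A (cst c).
Proof.
elim: k c => [|k IH] c /=; first by move=> x _; exact: cst_continuous.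
split=> [x _|v]; first exact: differentiable_cst.
have -> : 'D_v (cst c) = cst (0 : W) by apply/funext => x; rewrite derive_cst.
exact: IH.
Qed.

Lemma Ck_on_add (W : normedModType R) k A (f g : V -> W) : open A ->
  Ck_on k A f -> Ck_on k A g -> Ck_on k A (fun x => f x + g x).
Proof.
move=> oA; elim: k f g => [|k IH] f g /=.
  by move=> cf cg x xA; apply: cvgD; [exact: cf|exact: cg].
move=> [df Df] [dg Dg]; split=> [x Ax|v].
  exact: (differentiableD (df _ Ax) (dg _ Ax)).
apply: Ck_on_congr (IH _ _ (Df v) (Dg v)) => // x Ax.
by rewrite -deriveD//; apply: diff_derivable; [exact: df|exact: dg].
Qed.

Lemma Ck_on_scale (W : normedModType R) k A c (f : V -> W) : open A ->
  Ck_on k A f -> Ck_on k A (fun x => c *: f x).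
Proof.
move=> oA; elim: k f => [|k IH] f /=.
  by move=> cf x xA; apply: cvgZ; [exact: cvg_cst|exact: cf].
move=> [df Df]; split=> [x Ax|v].
  exact: (differentiableZ c (df _ Ax)).
apply: Ck_on_congr (IH _ (Df v)) => // x Ax.
by rewrite -deriveZ//; apply: diff_derivable; exact: df.
Qed.

Lemma Ck_on_opp (W : normedModType R) k A (f : V -> W) : open A ->
  Ck_on k A f -> Ck_on k A (fun x => - f x).
Proof.
move=> oA sf; apply: Ck_on_congr (Ck_on_scale (-1) oA sf) => // x _.
by rewrite scaleN1r.
Qed.

Lemma Ck_on_sum (W : normedModType R) k A (I : Type) (s : seq I) (F : I -> V -> W) :
  open A -> (forall i, Ck_on k A (F i)) ->
  Ck_on k A (fun x => \sum_(i <- s) F i x).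
Proof.
move=> oA sF; elim: s => [|i s IH].
  by apply: Ck_on_congr (Ck_on_cst k A 0) => // x _; rewrite big_nil.
apply: Ck_on_congr (Ck_on_add oA (sF i) IH) => // x _.
by rewrite big_cons.
Qed.

Lemma Ck_on_mul k A (f g : V -> R) : open A ->
  Ck_on k A f -> Ck_on k A g -> Ck_on k A (fun x => f x * g x).
Proof.
move=> oA; elim: k f g => [|k IH] f g.
  by move=> cf cg x xA; apply: cvgM; [exact: cf|exact: cg].
move=> sf sg; have [df Df] := sf; have [dg Dg] := sg; split=> [x Ax|v].
  exact: (differentiableM (df _ Ax) (dg _ Ax)).
have := Ck_on_add oA (IH _ _ (Ck_onW sf) (Dg v)) (IH _ _ (Ck_onW sg) (Df v)).
apply: Ck_on_congr => // x Ax.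
by rewrite -deriveM//; apply: diff_derivable; [exact: df|exact: dg].
Qed.

Lemma Ck_on_prod k A (I : Type) (s : seq I) (F : I -> V -> R) :
  open A -> (forall i, Ck_on k A (F i)) ->
  Ck_on k A (fun x => \prod_(i <- s) F i x).
Proof.
move=> oA sF; elim: s => [|i s IH].
  by apply: Ck_on_congr (@Ck_on_cst R k A (1 : R)) => // x _; rewrite big_nil.
apply: Ck_on_congr (Ck_on_mul oA (sF i) IH) => // x _.
by rewrite big_cons.
Qed.

(** The derivative of [f^-1] is [- f^-1 * f^-1 * 'D_v f], which contains [f^-1] itself one order
    lower, so the induction on [k] closes. *)
Lemma Ck_on_inv k A (f : V -> R) : open A -> (forall x, A x -> f x != 0) ->
  Ck_on k A f -> Ck_on k A (fun x => (f x)^-1).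
Proof.
move=> oA f0; elim: k f f0 => [|k IH] f f0.
  move=> cf x xA; apply: cvgV; last exact: cf.
  by apply: f0; rewrite inE in xA.
move=> sf; have [df Df] := sf; split=> [x Ax|v].
  by apply: differentiableV; [exact: df|exact: f0].
have si := IH _ f0 (Ck_onW sf).
have := Ck_on_opp oA (Ck_on_mul oA (Ck_on_mul oA si si) (Df v)).
apply: (Ck_on_congr oA) => x Ax; rewrite deriveV ?f0//.
  by rewrite /GRing.scale /= expr2 invfM mulNr.
by apply: diff_derivable; exact: df.
Qed.

Lemma Ck_on_mxP m n k A (F : V -> 'M[R]_(m, n)) : open A ->
  Ck_on k A F <-> forall i j, Ck_on k A (fun x => F x i j).
Proof.
move=> oA; elim: k F => [|k IH] F /=; split.
- move=> cF i j x xA.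
  apply: (@continuous_comp _ _ _ F (fun M : 'M[R]_(m, n) => M i j)); first exact: cF.
  exact: coord_continuous.
- move=> cF x xA; apply/cvgrPdist_le => /= e e0.
  near=> y; rewrite /Num.Def.normr/= mx_normrE (bigmax_le _ (ltW e0))//= => i _.
  rewrite !mxE/=.
  move: i; near: y; apply: filter_forall => /= i.
  exact: ((cvgrPdist_le _ _).1 (cF i.1 i.2 x xA)).
- move=> [dF DF] i j; split=> [x /dF /differentiable_mxP//|v].
  apply: Ck_on_congr ((IH _).1 (DF v) i j) => // x Ax.
  by rewrite derive_entry//; exact: dF.
- move=> sF; have dF x : A x -> differentiable F x.
    by move=> Ax; apply/differentiable_mxP => i j; case: (sF i j) => + _; exact.
  split=> // v; apply/IH => i j; have [_ Df] := sF i j.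
  apply: Ck_on_congr (Df v) => // x Ax.
  by rewrite derive_entry//; exact: dF.
Unshelve. all: by end_near. Qed.

End CkGeneral.

Section CkMatrix.
Context {R : realType} {V : normedModType R}.
Implicit Types (A : set V).

Lemma Ck_on_coord m n k (A : set 'M[R]_(m, n)) i j : Ck_on k A (fun x => x i j).
Proof.
case: k => [|k] /=; first by move=> x _; exact: coord_continuous.
split=> [x _|v]; first exact: differentiable_coord.
have -> : 'D_v (fun x : 'M[R]_(m, n) => x i j) = cst (v i j).
  apply/funext => x.
  have dx : differentiable (id : 'M[R]_(m, n) -> _) x by [].
  by rewrite -(derive_entry v i j dx) derive_id.
exact: Ck_on_cst.
Qed.

Lemma Ck_on_mulmx m n p k A (F : V -> 'M[R]_(m, n)) (G : V -> 'M[R]_(n, p)) :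
  open A -> Ck_on k A F -> Ck_on k A G -> Ck_on k A (fun x => F x *m G x).
Proof.
move=> oA /(Ck_on_mxP _ _ oA) sF /(Ck_on_mxP _ _ oA) sG; apply/Ck_on_mxP => // i j.
have : Ck_on k A (fun x => \sum_l F x i l * G x l j).
  by apply: Ck_on_sum => // l; exact: Ck_on_mul.
by apply: Ck_on_congr => // x _; rewrite mxE.
Qed.

Lemma Ck_on_trmx m n k A (F : V -> 'M[R]_(m, n)) :
  open A -> Ck_on k A F -> Ck_on k A (fun x => (F x)^T).
Proof.
move=> oA /(Ck_on_mxP _ _ oA) sF; apply/Ck_on_mxP => // i j.
by apply: Ck_on_congr (sF j i) => // x _; rewrite mxE.
Qed.

Lemma Ck_on_det n k A (F : V -> 'M[R]_n) :
  open A -> Ck_on k A F -> Ck_on k A (fun x => \det (F x)).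
Proof.
move=> oA /(Ck_on_mxP _ _ oA) sF.
apply: Ck_on_sum => // s; apply: Ck_on_mul => //; first exact: Ck_on_cst.
exact: Ck_on_prod.
Qed.

(** Cramer's formula: the entries of the inverse are cofactors over the determinant. *)
Lemma Ck_on_invmx n k A (F : V -> 'M[R]_n) :
  open A -> (forall x, A x -> F x \in unitmx) ->
  Ck_on k A F -> Ck_on k A (fun x => invmx (F x)).
Proof.
move=> oA Fu sF; apply/Ck_on_mxP => // i j.
have : Ck_on k A (fun x => (\det (F x))^-1 * cofactor (F x) j i).
  apply: Ck_on_mul => //.
    apply: Ck_on_inv => //; last exact: Ck_on_det.
    by move=> x /Fu; rewrite unitmxE unitfE.
  rewrite /cofactor; apply: Ck_on_mul => //; first exact: Ck_on_cst.
  apply: Ck_on_det => //; apply/Ck_on_mxP => // a b.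
  move: sF => /(Ck_on_mxP _ _ oA) /(_ (lift j a) (lift i b)).
  by apply: Ck_on_congr => // x _; rewrite !mxE.
by apply: Ck_on_congr => // x Ax; rewrite /invmx Fu// !mxE.
Qed.

(** [Ck_on] differentiates in fixed directions, whereas the chain rule produces the moving direction
    ['D_v f x]. Expanding it in the basis leaves only the partial derivatives of [g], to which the
    induction applies. *)
Lemma Ck_on_comp m k A (B : set 'rV[R]_m) (f : V -> 'rV[R]_m) (g : 'rV[R]_m -> R) :
  open A -> (forall x, A x -> B (f x)) ->
  Ck_on k A f -> Ck_on k B g -> Ck_on k A (fun x => g (f x)).
Proof.
move=> oA AB; elim: k g => [|k IH] g.
  move=> cf cg x xA; apply: (@continuous_comp _ _ _ f g) (cf x xA) _; apply: cg.
  by rewrite inE; apply: AB; rewrite inE in xA.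
move=> sf sg; have [df Df] := sf; have [dg Dg] := sg; split=> [x Ax|v].
  by apply: (differentiable_comp (df _ Ax)); exact/dg/AB.
have : Ck_on k A (fun x => \sum_j ('D_v f x) 0 j * 'D_(EE j) g (f x)).
  apply: Ck_on_sum => // j; apply: Ck_on_mul => //.
    by have /(Ck_on_mxP _ _ oA) := Df v; exact.
  by apply: IH (Dg _); exact: Ck_onW.
apply: Ck_on_congr => // x Ax.
rewrite (_ : (fun _ => _) = g \o f)// (derive_comp _ (df _ Ax) (dg _ (AB _ Ax))).
by rewrite (derive_coords _ (dg _ (AB _ Ax))).
Qed.

Lemma Ck_on_comp_mx m p q k A (B : set 'rV[R]_m) (f : V -> 'rV[R]_m)
    (g : 'rV[R]_m -> 'M[R]_(p, q)) :
  open A -> open B -> (forall x, A x -> B (f x)) ->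
  Ck_on k A f -> Ck_on k B g -> Ck_on k A (fun x => g (f x)).
Proof.
move=> oA oB AB sf /(Ck_on_mxP _ _ oB) sg; apply/Ck_on_mxP => // i j.
exact: Ck_on_comp AB sf (sg i j).
Qed.

End CkMatrix.

(** * Mean value and Taylor estimates *)

Section MeanValue.
Context {R : realType} {V : normedModType R}.

Lemma is_derive_line (W : normedModType R) (f : V -> W) (x h : V) (t : R) :
  differentiable f (x + t *: h) ->
  is_derive t 1 (fun s : R => f (x + s *: h)) ('D_h f (x + t *: h)).
Proof.
move=> df.
have dl : differentiable (fun s : R => x + s *: h) t.
  apply: (@differentiableD _ _ _ (cst x) (fun s : R => s *: h)).
    exact: differentiable_cst.
  exact: (@differentiableZl _ _ _ id).
have dfl : differentiable (f \o (fun s : R => x + s *: h)) t.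
  exact: differentiable_comp.
have -> : 'D_h f (x + t *: h) = 'D_1 (f \o (fun s : R => x + s *: h)) t.
  rewrite (derive_comp _ dl df); congr ('D_ _ f _).
  rewrite (_ : (fun s => _) = cst x + (fun s : R => s *: h))//.
  rewrite deriveD; [|exact: derivable_cst|]; last first.
    by apply: diff_derivable; exact: (@differentiableZl _ _ _ id).
  rewrite derive_cst add0r deriveE; last exact: (@differentiableZl _ _ _ id).
  by rewrite diffZl//= diff_val scale1r.
exact/derivableP/diff_derivable.
Qed.

Lemma MVT_line (f : V -> R) (x h : V) :
  (forall t : R, 0 <= t <= 1 -> differentiable f (x + t *: h)) ->
  exists2 t : R, 0 <= t <= 1 & f (x + h) - f x = 'D_h f (x + t *: h).
Proof.
move=> df.
have [||t t01 e] := @MVT_segment R (fun s : R => f (x + s *: h))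
   (fun t => 'D_h f (x + t *: h)) 0 1 ler01 _ _.
- move=> t; rewrite in_itv/= => /andP[t0 t1]; apply: is_derive_line.
  by apply: df; rewrite !ltW.
- apply: derivable_within_continuous => t; rewrite in_itv/= => /df dt.
  by have [] := is_derive_line dt.
by exists t; [rewrite in_itv/= in t01|move: e; rewrite scale1r scale0r addr0 subr0 mulr1].
Qed.

End MeanValue.

Definition oball (R : realType) (n : nat) (r : R) : set 'rV[R]_n := [set x | `|x| < r].
Definition cball (R : realType) (n : nat) (r : R) : set 'rV[R]_n := [set x | `|x| <= r].
Definition convex_dom (R : realType) (n : nat) (K : set 'rV[R]_n) :=
  forall x y (t : R), K x -> K y -> 0 <= t <= 1 -> K (x + t *: (y - x)).
Arguments oball {R} n r _.
Arguments cball {R} n r _.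

Section Rowvec.
Context {R : realType}.

Lemma mx_entry_le m n (x : 'M[R]_(m, n)) i j : `|x i j| <= `|x|.
Proof.
rewrite [leRHS]/Num.Def.normr/= mx_normrE.
exact: (le_bigmax _ (fun ij : 'I_m * 'I_n => `|x ij.1 ij.2|) (i, j)).
Qed.

Lemma mx_norm_leP m n (x : 'M[R]_(m, n)) c : 0 <= c ->
  (forall i j, `|x i j| <= c) -> `|x| <= c.
Proof.
move=> c0 xc; rewrite /Num.Def.normr/= mx_normrE bigmax_le// => -[i j] _.
Qed.

Lemma mx_norm_ltP m n (x : 'M[R]_(m, n)) c : 0 < c ->
  (forall i j, `|x i j| < c) -> `|x| < c.
Proof.
move=> c0 xc; rewrite /Num.Def.normr/= mx_normrE bigmax_lt// => -[i j] _.
Qed.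

Lemma open_oball n (r : R) : open (oball n r).
Proof.
rewrite (_ : oball n r = Num.norm @^-1` [set t : R | t < r])//.
apply: open_comp; last exact: open_lt.
move=> x _; exact: norm_continuous.
Qed.

Lemma cvx_norm n (x y : 'rV[R]_n) (t : R) : 0 <= t <= 1 ->
  `|x + t *: (y - x)| <= (1 - t) * `|x| + t * `|y|.
Proof.
move=> /andP[t0 t1].
rewrite (_ : x + _ = (1 - t) *: x + t *: y); last first.
  by rewrite scalerBl scale1r scalerBr addrAC addrA.
rewrite (le_trans (ler_normD _ _))// !normrZ ger0_norm ?subr_ge0//.
by rewrite (ger0_norm t0).
Qed.

Lemma convex_cball n (r : R) : convex_dom (cball n r).
Proof.
move=> x y t; rewrite /cball/= => xr yr t01.
apply: le_trans (cvx_norm x y t01) _; move: t01 => /andP[t0 t1].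
have : (1 - t) * `|x| <= (1 - t) * r by rewrite ler_wpM2l// subr_ge0.
have : t * `|y| <= t * r by rewrite ler_wpM2l.
lra.
Qed.

Lemma convex_oball n (r : R) : convex_dom (oball n r).
Proof.
move=> x y t; rewrite /oball/= => xr yr t01.
set c := Num.max `|x| `|y|.
have cr : c < r by rewrite gt_max xr.
apply: le_lt_trans cr; apply: (@convex_cball n c) => //; rewrite /cball/= le_max.
  by rewrite lexx.
by rewrite lexx orbT.
Qed.

Lemma compact_cball n (r : R) : compact (cball n r).
Proof.
apply: bounded_closed_compact.
  exists r; split; first exact: num_real.
  by move=> s rs x /= xr; exact: le_trans xr (ltW rs).
rewrite (_ : cball n r = Num.norm @^-1` [set t : R | t <= r])//.
apply: preimage_closed; last exact: closed_le.
move=> x _; exact: norm_continuous.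
Qed.

Lemma cball_bounded n (A : set 'rV[R]_n) (f : 'rV[R]_n -> R) (r : R) :
  {in A, continuous f} -> cball n r `<=` A ->
  exists2 C, 0 <= C & forall x, cball n r x -> `|f x| <= C.
Proof.
move=> cf rA; have [C [_ CP]] : bounded_set (f @` cball n r).
  apply/compact_bounded/continuous_compact; last exact: compact_cball.
  apply: continuous_in_subspaceT => x; rewrite inE => xr; apply: cf.
  by rewrite inE; exact: rA.
exists (`|C| + 1) => [|x xr]; first by rewrite addr_ge0.
apply: (CP (`|C| + 1)); last by exists x.
by rewrite (le_lt_trans (ler_norm C))// ltrDl.
Qed.

Lemma derive_bound n (f : 'rV[R]_n -> R) x h C : 0 <= C -> differentiable f x ->
  (forall j, `|'D_(EE j) f x| <= C) -> `|'D_h f x| <= n%:R * C * `|h|.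
Proof.
move=> C0 df fC; rewrite derive_coords// (le_trans (ler_norm_sum _ _ _))//.
apply: (@le_trans _ _ (\sum_(j < n) C * `|h|)).
  apply: ler_sum => j _; rewrite normrM mulrC ler_pM//; exact: mx_entry_le.
by rewrite sumr_const card_ord -mulrA mulr_natl.
Qed.

Lemma lipschitz_convex n (K : set 'rV[R]_n) (f : 'rV[R]_n -> R) C x y :
  convex_dom K -> 0 <= C -> (forall z, K z -> differentiable f z) ->
  (forall z j, K z -> `|'D_(EE j) f z| <= C) -> K x -> K y ->
  `|f y - f x| <= n%:R * C * `|y - x|.
Proof.
move=> cK C0 df fC Kx Ky.
have [t t01|t t01] := @MVT_line _ _ f x (y - x); first by apply: df; exact: cK.
rewrite subrKC => ->; apply: derive_bound => //; first by apply: df; exact: cK.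
by move=> j; apply: fC; exact: cK.
Qed.

(** The mean value theorem for [f] moves its derivative to an intermediate point; the Lipschitz
    bound for each partial derivative moves it back to [x]. *)
Lemma taylor1 n (K : set 'rV[R]_n) (f : 'rV[R]_n -> R) C x y :
  convex_dom K -> 0 <= C -> (forall z, K z -> differentiable f z) ->
  (forall z j, K z -> differentiable ('D_(EE j) f) z) ->
  (forall z i j, K z -> `|'D_(EE i) ('D_(EE j) f) z| <= C) -> K x -> K y ->
  `|f y - f x - 'D_(y - x) f x| <= n%:R * (n%:R * C) * `|y - x| ^+ 2.
Proof.
move=> cK C0 df ddf fC Kx Ky.
have [t t01|t t01] := @MVT_line _ _ f x (y - x); first by apply: df; exact: cK.
rewrite subrKC => ->; set z := x + _.
have Kz : K z by exact: cK.
rewrite !derive_coords; [|exact: df|exact: df].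
rewrite -sumrB (le_trans (ler_norm_sum _ _ _))//.
apply: (@le_trans _ _ (\sum_(j < n) `|y - x| * (n%:R * C * `|y - x|))).
  apply: ler_sum => j _; rewrite -mulrBr normrM ler_pM//; first exact: mx_entry_le.
  apply: (@le_trans _ _ (n%:R * C * `|z - x|)).
    exact: (lipschitz_convex (f := 'D_(EE j) f) cK C0 (fun w => ddf w j)
      (fun w i => fC w i j) Kx Kz).
  rewrite ler_wpM2l ?mulr_ge0// /z addrC addKr normrZ ler_piMl//.
  by move: t01 => /andP[t0 t1]; rewrite ger0_norm.
rewrite sumr_const card_ord -[leLHS]mulr_natl expr2.
by rewrite le_eqVlt; apply/orP; left; apply/eqP; ring.
Qed.

Definition dform n (g : 'I_n -> R) (v : 'rV[R]_n) : R := \sum_j v 0 j * g j.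

Lemma dform_linear n (g : 'I_n -> R) : linear (dform g).
Proof.
move=> a u v; rewrite /dform scaler_sumr -big_split; apply: eq_bigr => j _ /=.
by rewrite !mxE mulrDl /GRing.scale /= mulrA.
Qed.

HB.instance Definition _ n (g : 'I_n -> R) :=
  GRing.isLinear.Build R 'rV[R]_n R _ (dform g) (dform_linear g).

Lemma dform_continuous n (g : 'I_n -> R) : continuous (dform g).
Proof.
have /(_ 'rV[R]_n [set: _] 'I_n (index_enum _) (fun j v => v 0 j * g j)) :=
  @Ck_on_sum R _ R 0.
move=> /(_ openT) s x; apply: s; last by rewrite inE.
move=> j; apply: (@Ck_on_mul _ _ 0 setT _ (cst (g j)) openT); last exact: Ck_on_cst.
exact: Ck_on_coord.
Qed.

(** A quadratic remainder with an explicit constant survives averaging and uniform limits. This is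
    how ray integrals and limits of iterates inherit their derivatives. *)
Lemma differentiable_quad n (f : 'rV[R]_n -> R) x (g : 'I_n -> R) C :
  (\forall y \near x, `|f y - f x - \sum_j (y - x) 0 j * g j| <= C * `|y - x| ^+ 2) ->
  differentiable f x /\ forall v, 'D_v f x = \sum_j v 0 j * g j.
Proof.
move=> fx.
suff [df dE] : differentiable f x /\ 'd f x = dform g :> ('rV[R]_n -> R).
  by split=> // v; rewrite deriveE// dE.
apply: (@differentiable_expand _ _ _ _ (dform g)); first exact: dform_continuous.
move=> e e0.
have C1 : 0 < `|C| + 1 by rewrite ltr_wpDl.
have : \forall h \near (0 : 'rV[R]_n), `|f (h + x) - f x - dform g h| <= C * `|h| ^+ 2.
  move: fx; rewrite (near_shift 0); apply: filterS => h /=.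
  by rewrite subr0 addrK.
have : \forall h \near (0 : 'rV[R]_n), `|h| < e / (`|C| + 1).
  have := @nbhs0_lt _ 'rV[R]_n (e / (`|C| + 1)); apply; exact: divr_gt0.
apply: filterS2 => h; rewrite ltr_pdivlMr// => he /le_trans; apply.
rewrite expr2 mulrA ler_wpM2r// (le_trans _ (ltW he))// mulrC ler_wpM2l//.
by rewrite (le_trans (ler_norm C))// lerDl.
Qed.

End Rowvec.

(** * Symmetry of second derivatives *)

Section Schwarz.
Context {R : realType} {V : normedModType R}.

Lemma differentiable_translate (c x : V) : differentiable (fun y => y + c) x.
Proof.
apply: (@differentiableD _ _ _ id (cst c)); last exact: differentiable_cst.
by have [] := is_diff_id x.
Qed.

Lemma derive_translate (W : normedModType R) (f : V -> W) c x u :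
  differentiable f (x + c) -> 'D_u (fun y => f (y + c)) x = 'D_u f (x + c).
Proof.
move=> df; rewrite (derive_comp _ (differentiable_translate c x) df).
congr ('D_ _ f _); rewrite (_ : (fun y => _) = id + cst c)//.
rewrite deriveD; [|exact: derivable_id|exact: derivable_cst].
by rewrite derive_id derive_cst addr0.
Qed.

(** Two applications of the mean value theorem, along [u] to the increment in [v] and then along
    [v], turn the second difference quotient into a mixed derivative at a nearby point; continuity
    does the rest. *)
Lemma schwarz_approx (A : set V) (f : V -> R) x u v (e : R) :
  open A -> Ck_on 2 A f -> A x -> 0 < e ->
  exists2 d, 0 < d & forall h : R, 0 < h < d ->
   `|h ^- 2 * (f (x + h *: u + h *: v) - f (x + h *: u) - f (x + h *: v) + f x)
     - 'D_v ('D_u f) x| <= e.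
Proof.
move=> oA [df ddf] Ax e0.
have [du dDu] := ddf u; have cD := dDu v.
have : \forall y \near x, A y /\ `|'D_v ('D_u f) x - 'D_v ('D_u f) y| < e.
  apply: filterI; first exact: open_nbhs_nbhs.
  by have /cvgrPdist_lt/(_ _ e0) : 'D_v ('D_u f) @ x --> 'D_v ('D_u f) x by apply: cD; rewrite inE.
move=> /nbhs_normP[r /= r0 rP].
have N0 : 0 < `|u| + `|v| + 1 by rewrite ltr_wpDl// addr_ge0.
exists (r / (`|u| + `|v| + 1)); first exact: divr_gt0.
move=> h /andP[h0]; rewrite ltr_pdivlMr// => hr.
have near_x (s t : R) : 0 <= s <= 1 -> 0 <= t <= 1 ->
    A (x + s *: (h *: u) + t *: (h *: v)) /\
    `|'D_v ('D_u f) x - 'D_v ('D_u f) (x + s *: (h *: u) + t *: (h *: v))| < e.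
  move=> /andP[s0 s1] /andP[t0 t1]; apply: rP => /=.
  rewrite -addrA opprD addNKr normrN (le_lt_trans _ hr)//.
  rewrite (le_trans (ler_normD _ _))// !normrZ !ger0_norm//; last exact: ltW.
  have : s * (h * `|u|) <= h * `|u|.
    by rewrite ler_piMl// mulr_ge0// ltW.
  have : t * (h * `|v|) <= h * `|v|.
    by rewrite ler_piMl// mulr_ge0// ltW.
  nra.
pose g := fun y => f (y + h *: v) - f y.
have dg t : 0 <= t <= 1 -> differentiable (fun y => f (y + h *: v)) (x + t *: (h *: u)).
  move=> t01; apply: (@differentiable_comp _ _ _ _ (fun y => y + h *: v) f).
    exact: differentiable_translate.
  apply: df; have [] := near_x t 1 t01; first by rewrite ler01 lexx.
  by rewrite scale1r.
have dg' t : 0 <= t <= 1 -> differentiable f (x + t *: (h *: u)).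
  move=> t01; apply: df; have [] := near_x t 0 t01; first by rewrite ler01 lexx.
  by rewrite scale0r addr0.
have [t t01|t t01] := @MVT_line _ _ g x (h *: u).
  exact: (differentiableB (dg t t01) (dg' t t01)).
set y := x + t *: (h *: u).
have -> : 'D_(h *: u) g y = h * ('D_u f (y + h *: v) - 'D_u f y).
  have dy : differentiable f (y + h *: v).
    apply: df; have [] := near_x t 1 t01; first by rewrite ler01 lexx.
    by rewrite scale1r.
  rewrite /g (_ : (fun y => _) = (fun y => f (y + h *: v)) - f)//.
  rewrite deriveB; [|apply: diff_derivable; exact: dg|apply: diff_derivable; exact: dg'].
  rewrite (derive_linZ _ _ (dg _ t01)) (derive_linZ _ _ (dg' _ t01)).
  by rewrite (derive_translate u dy) -scalerBr.
have [s s01|s s01] := @MVT_line _ _ ('D_u f) y (h *: v).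
  by apply: du; have [] := near_x t s t01 s01.
have [Ay ye] := near_x t s t01 s01.
move=> ->; rewrite derive_linZ; last exact: du.
rewrite /g => gE.
have -> : f (x + h *: u + h *: v) - f (x + h *: u) - f (x + h *: v) + f x =
  f (x + h *: u + h *: v) - f (x + h *: u) - (f (x + h *: v) - f x) by ring.
rewrite gE -[_ *: _]/(h * _) mulrA -expr2 mulrA mulVf ?mul1r; last first.
  by rewrite expf_neq0// gt_eqF.
by rewrite distrC ltW.
Qed.

Lemma schwarz (A : set V) (f : V -> R) x u v :
  open A -> Ck_on 2 A f -> A x -> 'D_v ('D_u f) x = 'D_u ('D_v f) x.
Proof.
move=> oA sf Ax; apply/eqP; rewrite -subr_eq0 -normr_le0; apply/ler_addgt0Pl => e e0.
have e2 : 0 < e / 2 by rewrite divr_gt0.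
have [d d0 dP] := schwarz_approx u v oA sf Ax e2.
have [d' d'0 d'P] := schwarz_approx v u oA sf Ax e2.
set m := Num.min d d'; have m0 : 0 < m by rewrite lt_min d0.
have h0 : 0 < m / 2 by rewrite divr_gt0.
have hm : m / 2 < m by rewrite ltr_pdivrMr// mulr2n mulrDr mulr1 ltrDr.
have /dP : 0 < m / 2 < d by rewrite h0 (lt_le_trans hm)// ge_min lexx.
have /d'P : 0 < m / 2 < d' by rewrite h0 (lt_le_trans hm)// ge_min lexx orbT.
(* The second difference is symmetric in [u] and [v], so both mixed derivatives lie within [e / 2]
   of the same quotient. *)
rewrite (addrAC x (_ *: v)); set h := m / 2.
rewrite (_ : f (x + h *: u + h *: v) - f (x + h *: v) - f (x + h *: u) + f x =
  f (x + h *: u + h *: v) - f (x + h *: u) - f (x + h *: v) + f x); last by ring.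
set w := h ^- 2 * _ => w1 w2.
rewrite addr0 (le_trans (ler_distD w _ _))// [leRHS]splitr distrC.
exact: (lerD w2 w1).
Qed.

End Schwarz.

(** * Averages along partial rays *)

Section Average.
Context {R : realType}.
Notation mu := (@lebesgue_measure R).

(** Continuity is two-sided at the end points as well: the integrands come from functions on an open
    ball, and pointwise continuity composes without subspace topologies. *)
Definition cont01 (g : R -> R) := forall t, 0 <= t <= 1 -> {for t, continuous g}.
Definition avg (g : R -> R) : R := \int[mu]_(t in `[0, 1]) g t.

Lemma cont01_within g : cont01 g -> {within `[0, 1], continuous g}.
Proof.
move=> cg; apply: continuous_in_subspaceT => t; rewrite inE/= in_itv/=.
exact: cg.
Qed.

Lemma cont01_integrable g : cont01 g -> mu.-integrable `[0, 1] (EFin \o g).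
Proof.
move=> cg; apply: continuous_compact_integrable; first exact: segment_compact.
exact: cont01_within.
Qed.

Lemma avgZ g c : cont01 g -> avg (fun t => c * g t) = c * avg g.
Proof. by move=> cg; apply: RintegralZl => //; exact: cont01_integrable. Qed.

Lemma avgD f g : cont01 f -> cont01 g -> avg (fun t => f t + g t) = avg f + avg g.
Proof. by move=> cf cg; apply: RintegralD => //; exact: cont01_integrable. Qed.

Lemma avgB f g : cont01 f -> cont01 g -> avg (fun t => f t - g t) = avg f - avg g.
Proof. by move=> cf cg; apply: RintegralB => //; exact: cont01_integrable. Qed.

Lemma eq_avg f g : (forall t, 0 <= t <= 1 -> f t = g t) -> avg f = avg g.
Proof. by move=> fg; apply: eq_Rintegral => t; rewrite inE/= in_itv/=; exact: fg. Qed.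

Lemma avg_cst (c : R) : avg (fun=> c) = c.
Proof.
rewrite /avg Rintegral_cst//.
have := lebesgue_measure_itv `[0%R : R, 1%R].
by rewrite /= lte_fin ltr01 -EFinB subr0 => ->; rewrite mulr1.
Qed.

Lemma cont01_cst (c : R) : cont01 (fun=> c).
Proof. by move=> t _; exact: cst_continuous. Qed.

Lemma cont01D f g : cont01 f -> cont01 g -> cont01 (fun t => f t + g t).
Proof. by move=> cf cg t t01; apply: cvgD; [exact: cf|exact: cg]. Qed.

Lemma cont01M f g : cont01 f -> cont01 g -> cont01 (fun t => f t * g t).
Proof. by move=> cf cg t t01; apply: cvgM; [exact: cf|exact: cg]. Qed.

Lemma cont01N f : cont01 f -> cont01 (fun t => - f t).
Proof. by move=> cf t t01; apply: cvgN; exact: cf. Qed.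

Lemma cont01X r : cont01 (fun t => t ^+ r).
Proof. by move=> t _; exact: exprn_continuous. Qed.

Lemma is_derive_exprn (c : nat) (t : R) :
  is_derive t 1 (fun s : R => s ^+ c) (c%:R * t ^+ c.-1).
Proof.
apply: DeriveDef; first exact: exprn_derivable.
by rewrite exp_derive -![_ *: _]/(_ * _) mulr1.
Qed.

Lemma cont01_sum (I : Type) (s : seq I) (F : I -> R -> R) :
  (forall i, cont01 (F i)) -> cont01 (fun t => \sum_(i <- s) F i t).
Proof.
move=> cF; elim: s => [|i s IH].
  by under [X in cont01 X]funext do rewrite big_nil; exact: cont01_cst.
by under [X in cont01 X]funext do rewrite big_cons; exact: cont01D.
Qed.

Lemma avg_sum (I : Type) (s : seq I) (F : I -> R -> R) :
  (forall i, cont01 (F i)) ->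
  avg (fun t => \sum_(i <- s) F i t) = \sum_(i <- s) avg (F i).
Proof.
move=> cF; elim: s => [|i s IH].
  by rewrite big_nil -[RHS](avg_cst 0); apply: eq_avg => t _; rewrite big_nil.
rewrite big_cons -IH -avgD//; last exact: cont01_sum.
by apply: eq_avg => t _; rewrite big_cons.
Qed.

Lemma avg_bound g C : cont01 g -> (forall t, 0 <= t <= 1 -> `|g t| <= C) ->
  `|avg g| <= C.
Proof.
move=> cg gC.
have le_avg f h : cont01 f -> cont01 h ->
    (forall t, 0 <= t <= 1 -> f t <= h t) -> avg f <= avg h.
  move=> cf ch fh; apply: le_Rintegral => //; try exact: cont01_integrable.
rewrite ler_norml; apply/andP; split.
  rewrite -[leLHS]avg_cst; apply: le_avg => //; first exact: cont01_cst.
  by move=> t /gC; rewrite ler_norml => /andP[].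
rewrite -[leRHS]avg_cst; apply: le_avg => //; first exact: cont01_cst.
by move=> t /gC; rewrite ler_norml => /andP[].
Qed.

Lemma avg_deriv (F f : R -> R) : cont01 f ->
  (forall t : R, 0 <= t <= 1 -> is_derive t 1 F (f t)) -> avg f = F 1 - F 0.
Proof.
move=> cf dF; rewrite /avg /Rintegral.
rewrite (@continuous_FTC2 _ f F 0 1 ltr01)//.
- exact: cont01_within.
- have cF t : 0 <= t <= 1 -> {for t, continuous F}.
    by move=> /dF [d _]; apply/differentiable_continuous/derivable1_diffP.
  split.
  + by move=> t; rewrite in_itv/= => /andP[t0 t1]; have [] := dF t; rewrite ?ltW.
  + by apply: cvg_at_right_filter; apply: cF; rewrite lexx ler01.
  + by apply: cvg_at_left_filter; apply: cF; rewrite lexx ler01.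
- move=> t; rewrite in_itv/= => /andP[t0 t1]; rewrite derive1E.
  by have [] := dF t; rewrite ?ltW.
Qed.

End Average.

Section Ray.
Context {R : realType} {n : nat}.
Variable w : 'I_n -> bool.
Implicit Types (p v : 'rV[R]_n) (f : 'rV[R]_n -> R).

(* The coordinates selected by [w] are scaled by [t], the other ones are kept. *)
Definition fixpart p : 'rV[R]_n := \row_j (if w j then 0 else p 0 j).
Definition scalepart p : 'rV[R]_n := \row_j (if w j then p 0 j else 0).
Definition ray p (t : R) : 'rV[R]_n := fixpart p + t *: scalepart p.
(** The weight is there for differentiation: a derivative in a scaled coordinate brings out one more
    factor [t], so the family of these averages is closed under partial derivatives. *)
Definition rayint (r : nat) f p : R := avg (fun t => t ^+ r * f (ray p t)).

Lemma rayE p t j : ray p t 0 j = t ^+ w j * p 0 j.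
Proof.
rewrite !mxE; case: (w j); first by rewrite add0r expr1.
by rewrite mulr0 addr0 expr0 mul1r.
Qed.

Lemma ray1 p : ray p 1 = p.
Proof. by apply/rowP => j; rewrite rayE expr1n mul1r. Qed.

Lemma rayB p q t : ray p t - ray q t = ray (p - q) t.
Proof. by apply/rowP => j; rewrite !mxE; case: (w j); lra. Qed.

Lemma ray_norm p (t : R) : 0 <= t <= 1 -> `|ray p t| <= `|p|.
Proof.
move=> /andP[t0 t1]; apply: mx_norm_leP => // i j; rewrite ord1 rayE normrM.
rewrite (le_trans _ (mx_entry_le p 0 j))// ler_piMl//.
by rewrite ger0_norm ?exprn_ge0// exprn_ile1.
Qed.

Lemma ray_oball p (t r : R) : 0 <= t <= 1 -> oball n r p -> oball n r (ray p t).
Proof. by move=> t01; apply: le_lt_trans; exact: ray_norm. Qed.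

Lemma scalepart_ray p t : scalepart (ray p t) = t *: scalepart p.
Proof. by apply/rowP => j; rewrite mxE rayE !mxE; case: (w j); lra. Qed.

Lemma is_derive_ray f p t : differentiable f (ray p t) ->
  is_derive t 1 (fun s => f (ray p s)) ('D_(scalepart p) f (ray p t)).
Proof. exact: is_derive_line. Qed.

Section OnBall.
Variable rho : R.
Notation D := (oball n rho).
Let oD : open D := @open_oball R n rho.

Lemma cont01_ray f p : Ck_on 1 D f -> D p -> cont01 (fun t => f (ray p t)).
Proof.
move=> [df _] Dp t t01.
have [d _] := is_derive_ray (df _ (ray_oball t01 Dp)).
exact/differentiable_continuous/derivable1_diffP.
Qed.

Lemma cont01_rayX r f p : Ck_on 1 D f -> D p ->
  cont01 (fun t => t ^+ r * f (ray p t)).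
Proof. by move=> sf Dp; apply: cont01M; [exact: cont01X|exact: cont01_ray]. Qed.

Lemma cont01_rayD f p j : Ck_on 2 D f -> D p ->
  cont01 (fun t => 'D_(EE j) f (ray p t)).
Proof. by move=> [_ df] Dp; apply: (cont01_ray (f := 'D_(EE j) f)) => //; exact: df. Qed.

Lemma cont01_rayXD r f p j : Ck_on 2 D f -> D p ->
  cont01 (fun t => t ^+ r * 'D_(EE j) f (ray p t)).
Proof. by move=> sf Dp; apply: cont01M; [exact: cont01X|exact: cont01_rayD]. Qed.

Lemma cont01_ray_sum r f p v : Ck_on 2 D f -> D p ->
  cont01 (fun t => \sum_j v 0 j * (t ^+ r j * 'D_(EE j) f (ray p t))).
Proof.
move=> sf Dp; apply: cont01_sum => j; apply: cont01M; first exact: cont01_cst.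
exact: cont01_rayXD.
Qed.

Lemma rayint_bound r f C p : Ck_on 1 D f -> D p ->
  (forall q, D q -> `|f q| <= C) -> `|rayint r f p| <= C.
Proof.
move=> sf Dp fC; apply: avg_bound; first exact: cont01_rayX.
move=> t t01; rewrite normrM.
rewrite (le_trans _ (fC _ (ray_oball t01 Dp)))// ler_piMl//.
by case/andP: t01 => t0 t1; rewrite ger0_norm ?exprn_ge0// exprn_ile1.
Qed.

Lemma rayintB r f g p : Ck_on 1 D f -> Ck_on 1 D g -> D p ->
  rayint r (fun q => f q - g q) p = rayint r f p - rayint r g p.
Proof.
move=> sf sg Dp; rewrite /rayint -avgB; try exact: cont01_rayX.
by apply: eq_avg => t _; rewrite mulrBr.
Qed.

Lemma rayintD r f g p : Ck_on 1 D f -> Ck_on 1 D g -> D p ->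
  rayint r (fun q => f q + g q) p = rayint r f p + rayint r g p.
Proof.
move=> sf sg Dp; rewrite /rayint -avgD; try exact: cont01_rayX.
by apply: eq_avg => t _; rewrite mulrDr.
Qed.

Lemma eq_rayint r f g p : D p -> (forall q, D q -> f q = g q) ->
  rayint r f p = rayint r g p.
Proof. by move=> Dp fg; apply: eq_avg => t t01; rewrite fg//; exact: ray_oball. Qed.

(** Differentiation under the integral: the Taylor estimate of [f] holds uniformly along the rays,
    which [ray] only brings closer together, and its average is the quadratic remainder required by
    [differentiable_quad]. *)
Lemma rayint_differentiable r f p : Ck_on 2 D f -> D p ->
  differentiable (rayint r f) p /\
  forall v, 'D_v (rayint r f) p = \sum_j v 0 j * rayint (r + w j) ('D_(EE j) f) p.
Proof.
move=> sf Dp; have [df ddf] := sf.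
(* A compact ball strictly inside [D] is needed to bound the second derivatives. *)
have [r' /andP[pr rr]] : exists r', `|p| < r' < rho.
  by exists ((`|p| + rho) / 2); move: Dp; rewrite /oball/= => Dp; apply/andP; split; lra.
have rD : cball n r' `<=` D by move=> x /= xr; exact: le_lt_trans rr.
have [C C0 CP] : exists2 C, 0 <= C & forall x i j, cball n r' x ->
    `|'D_(EE i) ('D_(EE j) f) x| <= C.
  have /choice[c cP] : forall ij : 'I_n * 'I_n, exists C, 0 <= C /\
      forall x, cball n r' x -> `|'D_(EE ij.1) ('D_(EE ij.2) f) x| <= C.
    move=> [i j]; have [_ cj] := ddf (EE j).
    by have [C C0 CP] := cball_bounded (cj (EE i)) rD; exists C.
  exists (\sum_ij c ij) => [|x i j xr].
    by apply: sumr_ge0 => ij _; have [] := cP ij.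
  rewrite (bigD1 (i, j))//= -[leLHS]addr0 lerD//.
    by have [_] := cP (i, j); exact.
  by apply: sumr_ge0 => ij _; have [] := cP ij.
apply: (@differentiable_quad _ _ _ _ _ (n%:R * (n%:R * C))).
apply: (@open_nearP _ _ (oball n r')) => // [|q qr]; first exact: open_oball.
have Dq : D q by exact: (rD _ (ltW qr)).
have sD j : Ck_on 1 D ('D_(EE j) f) by exact: ddf.
have -> : rayint r f q - rayint r f p -
    \sum_j (q - p) 0 j * rayint (r + w j) ('D_(EE j) f) p =
  avg (fun t => t ^+ r * (f (ray q t) - f (ray p t) -
    \sum_j (t ^+ w j * (q - p) 0 j) * 'D_(EE j) f (ray p t))).
  have sf1 : Ck_on 1 D f := Ck_onW sf.
  have -> : \sum_j (q - p) 0 j * rayint (r + w j) ('D_(EE j) f) p =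
      avg (fun t => \sum_j (q - p) 0 j * (t ^+ (r + w j) * 'D_(EE j) f (ray p t))).
    rewrite avg_sum; last first.
      by move=> j; apply: cont01M; [exact: cont01_cst|exact: cont01_rayXD].
    by apply: eq_bigr => j _; rewrite avgZ//; exact: cont01_rayXD.
  rewrite /rayint -avgB; try exact: cont01_rayX.
  rewrite -avgB; last 2 first.
  - by apply: cont01D; [|apply: cont01N]; exact: cont01_rayX.
  - exact: (cont01_ray_sum (r := fun j => (r + w j)%N) (v := q - p) sf Dp).
  apply: eq_avg => t t01.
  rewrite [RHS]mulrBr mulrBr; congr (_ - _); rewrite mulr_sumr.
  by apply: eq_bigr => j _; rewrite exprD; ring.
apply: avg_bound.
  apply: cont01M; first exact: cont01X.
  apply: cont01D; first by apply: cont01D; [|apply: cont01N]; apply: cont01_ray => //; exact: Ck_onW.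
  apply: cont01N; apply: cont01_sum => j; apply: cont01M; last exact: cont01_rayD.
  by apply: cont01M; [exact: cont01X|exact: cont01_cst].
move=> t t01.
have -> : \sum_j (t ^+ w j * (q - p) 0 j) * 'D_(EE j) f (ray p t) =
    'D_(ray q t - ray p t) f (ray p t).
  rewrite derive_coords; last exact/df/ray_oball.
  by apply: eq_bigr => j _; rewrite rayB rayE.
have t1 : t ^+ r <= 1 by case/andP: t01 => t0 t1; rewrite exprn_ile1.
have t0 : 0 <= t ^+ r by case/andP: t01 => t0 _; rewrite exprn_ge0.
rewrite normrM (ger0_norm t0).
apply: (@le_trans _ _ (n%:R * (n%:R * C) * `|ray q t - ray p t| ^+ 2)); last first.
  rewrite ler_wpM2l ?mulr_ge0// lerXn2r ?nnegrE// rayB.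
  exact: ray_norm.
rewrite -[leRHS]mul1r ler_pM//.
apply: (taylor1 (@convex_cball R n r')) => //.
- by move=> z zr; apply/df/rD.
- by move=> z j zr; have [+ _] := ddf (EE j); apply; exact: rD.
- by apply: le_trans (ray_norm _ t01) _; exact: ltW.
- by apply: le_trans (ray_norm _ t01) _; exact: ltW.
Qed.

Lemma rayint_smooth r f : smooth_on D f -> smooth_on D (rayint r f).
Proof.
move=> sf k; elim: k r f sf => [|k IH] r f sf.
  move=> p; rewrite inE => Dp.
  by apply: differentiable_continuous; have [] := rayint_differentiable r (sf 2%N) Dp.
split=> [p Dp|v]; first by have [] := rayint_differentiable r (sf 2%N) Dp.
have : Ck_on k D (fun p => \sum_j v 0 j * rayint (r + w j) ('D_(EE j) f) p).
  apply: Ck_on_sum => // j; apply: Ck_on_scale => //; apply: IH => k'.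
  by have [_] := sf k'.+1; exact.
apply: Ck_on_congr => // p Dp.
by have [_ ->] := rayint_differentiable r (sf 2%N) Dp.
Qed.

Lemma derive_rayint r f p j : Ck_on 2 D f -> D p ->
  'D_(EE j) (rayint r f) p = rayint (r + w j) ('D_(EE j) f) p.
Proof.
move=> sf Dp; have [_ ->] := rayint_differentiable r sf Dp.
rewrite (bigD1 j)//= big1 => [|i ij]; first by rewrite mxE !eqxx mul1r addr0.
by rewrite mxE eqxx (negbTE ij) mul0r.
Qed.

(** Integrate the derivative of [t ^+ r.+1 * f (ray p t)] from 0 to 1. Averages along rays thus
    invert the Euler operators [E + (r + 1)], which turns integral equations into radial
    differential equations. *)
Lemma rayint_euler r f p : Ck_on 2 D f -> D p ->
  'D_(scalepart p) (rayint r f) p + r.+1%:R * rayint r f p = f p.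
Proof.
move=> sf Dp; have [_ ->] := rayint_differentiable r sf Dp.
have [df ddf] := sf.
have sD j : Ck_on 1 D ('D_(EE j) f) by exact: ddf.
have sf1 : Ck_on 1 D f := Ck_onW sf.
have -> : \sum_j (scalepart p) 0 j * rayint (r + w j) ('D_(EE j) f) p =
    avg (fun t => \sum_j (scalepart p) 0 j * (t ^+ r.+1 * 'D_(EE j) f (ray p t))).
  rewrite avg_sum; last first.
    by move=> j; apply: cont01M; [exact: cont01_cst|exact: cont01_rayXD].
  apply: eq_bigr => j _; rewrite avgZ; last exact: cont01_rayXD.
  by rewrite mxE; case: (w j); rewrite ?addn1// !mul0r.
rewrite -[X in _ + X]avgZ; last exact: cont01_rayX.
rewrite -avgD; last 2 first.
- exact: (cont01_ray_sum (r := fun=> r.+1) (v := scalepart p) sf Dp).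
- by apply: cont01M; [exact: cont01_cst|exact: cont01_rayX].
have dF (t : R) : 0 <= t <= 1 -> is_derive t 1 (fun t => t ^+ r.+1 * f (ray p t))
    (\sum_j scalepart p 0 j * (t ^+ r.+1 * 'D_(EE j) f (ray p t)) +
     r.+1%:R * (t ^+ r * f (ray p t))).
  move=> t01; have dr := is_derive_ray (df _ (ray_oball t01 Dp)).
  apply: (is_derive_eq (is_deriveM (is_derive_exprn r.+1 t) dr)).
  rewrite derive_coords; last exact/df/ray_oball.
  rewrite -![_ *: _]/(_ * _) mulr_sumr; congr (_ + _).
    by apply: eq_bigr => j _; rewrite mulrCA.
  by rewrite -mulr_natl; ring.
rewrite (avg_deriv _ dF).
  by rewrite expr1n mul1r ray1 expr0n/= mul0r subr0.
apply: cont01D; last by apply: cont01M; [exact: cont01_cst|exact: cont01_rayX].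
exact: (cont01_ray_sum (r := fun=> r.+1) (v := scalepart p) sf Dp).
Qed.

(** The function [t ^+ c * g (ray p t)] has derivative 0 inside the unit interval and is continuous
    up to [t = 0], so its values at 1 and 0 agree. The factor [0 ^+ c] merges two cases: [g]
    vanishes if [c] is positive and is constant along rays if [c = 0]. *)
Lemma euler_ray_cst (c : nat) (g : 'rV[R]_n -> R) p : Ck_on 1 D g -> D p ->
  (forall q, D q -> 'D_(scalepart q) g q + c%:R * g q = 0) ->
  g p = 0 ^+ c * g (fixpart p).
Proof.
move=> sg Dp ge; have [dg _] := sg.
have [||t t01] := @MVT R (fun t => t ^+ c * g (ray p t)) (fun=> 0) 0 1 ltr01.
- move=> t; rewrite in_itv/= => /andP[t0 t1].
  have t01 : 0 <= t <= 1 by rewrite !ltW.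
  have Dr := ray_oball t01 Dp.
  have dr := is_derive_ray (dg _ Dr).
  have e := ge _ Dr; rewrite scalepart_ray derive_linZ in e; last exact: dg.
  have dgt : 'D_(scalepart p) g (ray p t) = - (c%:R * g (ray p t)) / t.
    by apply: (mulfI (lt0r_neq0 t0)); rewrite mulrCA mulfV ?gt_eqF// mulr1; apply/eqP; rewrite -addr_eq0; apply/eqP.
  (* Writing [t ^+ c / t] instead of [t ^+ c.-1] treats [c = 0] uniformly and matches the factor
     [1 / t] in [dgt]. *)
  have dX : is_derive t 1 (fun t : R => t ^+ c) (c%:R * t ^+ c / t).
    case: c {ge e dgt} => [|c].
      by rewrite !mul0r; exact: is_derive_cst.
    apply: (is_derive_eq (is_derive_exprn c.+1 t)).
    by rewrite exprSr mulrA mulfK ?gt_eqF.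
  apply: (is_derive_eq (is_deriveM dX dr)).
  by rewrite dgt -![_ *: _]/(_ * _); field; rewrite gt_eqF.
- apply: (cont01_within (g := fun t => t ^+ c * g (ray p t))).
  exact: cont01_rayX.
move=> /eqP; rewrite mul0r subr_eq0 => /eqP; rewrite expr1n mul1r ray1 => ->.
by rewrite /ray scale0r addr0.
Qed.

End OnBall.
End Ray.

(** * The radial flow *)

Section UniformCauchy.
Context {R : realType} {n : nat}.
Variables (w : 'I_n -> bool) (rho : R).
Notation D := (oball n rho).
Notation V := 'rV[R]_n.
Let oD : open D := @open_oball R n rho.
Implicit Types (f g : nat -> V -> R).

(* [SUC k f]: the functions [f i] are smooth, and all their partial derivatives of
   order at most [k] are uniformly bounded and uniformly Cauchy in [i]. *)
Definition ubounded f := exists C, forall i p, D p -> `|f i p| <= C.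
Definition ucauchy f := forall e, 0 < e ->
  exists N : nat, forall i j p, (N <= i)%N -> (N <= j)%N -> D p -> `|f i p - f j p| <= e.

Fixpoint UCk (k : nat) f : Prop :=
  [/\ ubounded f, ucauchy f &
      match k with
      | 0 => True
      | k'.+1 => forall j, UCk k' (fun i => 'D_(EE j) (f i))
      end].

Definition SUC (k : nat) f := (forall i, smooth_on D (f i)) /\ UCk k f.

Lemma smooth_derive (A : set V) (g : V -> R) v : smooth_on A g -> smooth_on A ('D_v g).
Proof. by move=> sg k; have [_] := sg k.+1; exact. Qed.

Lemma smooth_diff (A : set V) (g : V -> R) x : smooth_on A g -> A x -> differentiable g x.
Proof. by move=> sg; have [+ _] := sg 1%N; exact. Qed.

Lemma SUC_smooth k f i : SUC k f -> smooth_on D (f i).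
Proof. by case. Qed.

Lemma SUC_bounded k f : SUC k f -> ubounded f.
Proof. by case=> _; case: k => [|k] []. Qed.

Lemma SUC_cauchy k f : SUC k f -> ucauchy f.
Proof. by case=> _; case: k => [|k] []. Qed.

Lemma SUC_derive k f j : SUC k.+1 f -> SUC k (fun i => 'D_(EE j) (f i)).
Proof.
move=> [sf [_ _ Df]]; split=> [i|]; last exact: Df.
exact: smooth_derive.
Qed.

Lemma SUC_step k f : (forall i, smooth_on D (f i)) -> ubounded f -> ucauchy f ->
  (forall j, SUC k (fun i => 'D_(EE j) (f i))) -> SUC k.+1 f.
Proof. by move=> sf bf cf Df; split=> //; split=> // j; have [] := Df j. Qed.

Lemma SUC_base f : (forall i, smooth_on D (f i)) -> ubounded f -> ucauchy f -> SUC 0 f.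
Proof. by move=> sf bf cf; split. Qed.

Lemma SUCW k f : SUC k.+1 f -> SUC k f.
Proof.
elim: k f => [|k IH] f sf.
  by apply: SUC_base; [case: sf|exact: SUC_bounded sf|exact: SUC_cauchy sf].
apply: SUC_step; [by case: sf|exact: SUC_bounded sf|exact: SUC_cauchy sf|].
by move=> j; apply: IH; exact: SUC_derive.
Qed.

Lemma SUC_congr k f g : (forall i p, D p -> f i p = g i p) -> SUC k f -> SUC k g.
Proof.
elim: k f g => [|k IH] f g fg sf.
(* The base case and the inductive step need the same three facts: each [all: have] states one in
   both goals, and the [all: try] after it closes the side goals. *)
all: have sg i : smooth_on D (g i).
all: try by move=> k'; apply: Ck_on_congr (SUC_smooth i sf k') => //; exact: fg.
all: have bg : ubounded g.
all: try by have [C CP] := SUC_bounded sf; exists C => i p Dp; rewrite -fg//; exact: CP.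
all: have cg : ucauchy g.
all: try by move=> e e0; have [N NP] := SUC_cauchy sf e0; exists N => i j p iN jN Dp;
  rewrite -!fg//; exact: NP.
  exact: SUC_base.
apply: SUC_step => // j; apply: IH (SUC_derive j sf) => i p Dp.
by apply: derive_congr Dp => // q; exact: fg.
Qed.

Lemma SUC_add k f g : SUC k f -> SUC k g -> SUC k (fun i p => f i p + g i p).
Proof.
elim: k f g => [|k IH] f g sf sg.
all: have s i : smooth_on D (fun p => f i p + g i p).
all: try by move=> k'; apply: Ck_on_add => //; [exact: SUC_smooth i sf _|exact: SUC_smooth i sg _].
all: have b : ubounded (fun i p => f i p + g i p).
all: try (have [C CP] := SUC_bounded sf; have [C' CP'] := SUC_bounded sg; exists (C + C') => i p Dp;
  by rewrite (le_trans (ler_normD _ _))// lerD ?CP ?CP').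
all: have c : ucauchy (fun i p => f i p + g i p).
all: try (move=> e e0; have e2 : 0 < e / 2 by rewrite divr_gt0).
all: try (have [N NP] := SUC_cauchy sf e2; have [N' NP'] := SUC_cauchy sg e2;
  exists (maxn N N') => i j p; rewrite !geq_max => /andP[iN iN'] /andP[jN jN'] Dp;
  by rewrite opprD addrACA (le_trans (ler_normD _ _))// [leRHS]splitr lerD ?NP ?NP').
  exact: SUC_base.
apply: SUC_step => // j.
apply: SUC_congr (IH _ _ (SUC_derive j sf) (SUC_derive j sg)) => i p Dp.
by rewrite -deriveD//; apply: diff_derivable; apply: smooth_diff Dp;
  [exact: SUC_smooth i sf|exact: SUC_smooth i sg].
Qed.

(** Uniformly Cauchy sequences are stable under products once they are bounded, which is why [UCk]
    records bounds along with the Cauchy property. *)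
Lemma SUC_mul k f g : SUC k f -> SUC k g -> SUC k (fun i p => f i p * g i p).
Proof.
elim: k f g => [|k IH] f g sf sg.
all: have s i : smooth_on D (fun p => f i p * g i p).
all: try by move=> k'; apply: Ck_on_mul => //; [exact: SUC_smooth i sf _|exact: SUC_smooth i sg _].
all: have b : ubounded (fun i p => f i p * g i p).
all: try (have [C CP] := SUC_bounded sf; have [C' CP'] := SUC_bounded sg; exists (C * C') => i p Dp;
  by rewrite normrM ler_pM ?CP ?CP').
all: have c : ucauchy (fun i p => f i p * g i p).
all: try (move=> e e0; have [C CP] := SUC_bounded sf; have [C' CP'] := SUC_bounded sg;
  have K0 : 0 < 2 * (`|C| + `|C'| + 1) by rewrite mulr_gt0// ltr_wpDl// addr_ge0).
all: try (have e2 : 0 < e / (2 * (`|C| + `|C'| + 1)) by rewrite divr_gt0).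
all: try (have [N NP] := SUC_cauchy sf e2; have [N' NP'] := SUC_cauchy sg e2;
  exists (maxn N N') => i j p; rewrite !geq_max => /andP[iN iN'] /andP[jN jN'] Dp).
all: try (have -> : f i p * g i p - f j p * g j p =
    (f i p - f j p) * g i p + f j p * (g i p - g j p) by ring).
all: try (rewrite (le_trans (ler_normD _ _))// !normrM;
  set d := e / _ in e2 NP NP';
  have h1 : `|f i p - f j p| * `|g i p| <= d * `|C'|
    by rewrite ler_pM ?NP// (le_trans (CP' _ _ Dp))// ler_norm).
all: try (have h2 : `|f j p| * `|g i p - g j p| <= `|C| * d
    by rewrite ler_pM ?NP'// (le_trans (CP _ _ Dp))// ler_norm).
all: try (have -> : e = d * (2 * (`|C| + `|C'| + 1)) by rewrite /d divfK// gt_eqF).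
all: try by move: (normr_ge0 C) (normr_ge0 C') e2; clearbody d; nra.
  exact: SUC_base.
apply: SUC_step => // j.
have := SUC_add (IH _ _ (SUCW sf) (SUC_derive j sg)) (IH _ _ (SUCW sg) (SUC_derive j sf)).
apply: SUC_congr => i p Dp.
by rewrite -deriveM//; apply: diff_derivable; apply: smooth_diff Dp;
  [exact: SUC_smooth i sf|exact: SUC_smooth i sg].
Qed.

Lemma SUC_cst k (c : R) : SUC k (fun _ _ => c).
Proof.
elim: k c => [|k IH] c.
all: have s (i : nat) : smooth_on D (fun=> c) by move=> k'; exact: Ck_on_cst.
all: have b : ubounded (fun _ _ => c) by exists `|c|.
all: have cc : ucauchy (fun _ _ => c)
  by move=> e e0; exists 0%N => i j p _ _ _; rewrite subrr normr0 ltW.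
  exact: SUC_base.
apply: SUC_step => // j; apply: SUC_congr (IH 0) => i p Dp.
by apply: esym; exact: derive_cst.
Qed.

Lemma SUC_coord k j : SUC k (fun _ p => p 0 j).
Proof.
have s (i : nat) : smooth_on D (fun p : V => p 0 j) by move=> k'; exact: Ck_on_coord.
have b : ubounded (fun _ p => p 0 j).
  by exists rho => i p Dp; apply: le_trans (mx_entry_le _ _ _) _; exact: ltW.
have c : ucauchy (fun _ p => p 0 j).
  by move=> e e0; exists 0%N => i i' p _ _ _; rewrite subrr normr0 ltW.
case: k => [|k]; first exact: SUC_base.
apply: SUC_step => // l; apply: SUC_congr (SUC_cst k ((EE l : V) 0 j)) => i p Dp.
have dx : differentiable (id : V -> V) p by have [] := is_diff_id p.
by rewrite -(derive_entry (EE l) 0 j dx) derive_id.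
Qed.

Lemma SUC_sum k (I : Type) (s : seq I) (F : I -> nat -> V -> R) :
  (forall i, SUC k (F i)) -> SUC k (fun i p => \sum_(l <- s) F l i p).
Proof.
move=> sF; elim: s => [|l s IH].
  by apply: SUC_congr (SUC_cst k 0) => i p _; rewrite big_nil.
by apply: SUC_congr (SUC_add (sF l) IH) => i p _; rewrite big_cons.
Qed.

Lemma SUC_rayint k r f : SUC k f -> SUC k (fun i => rayint w r (f i)).
Proof.
elim: k r f => [|k IH] r f sf.
all: have s i : smooth_on D (rayint w r (f i)) by apply: rayint_smooth; exact: SUC_smooth i sf.
all: have b : ubounded (fun i => rayint w r (f i)).
all: try by have [C CP] := SUC_bounded sf; exists C => i p Dp;
  apply: rayint_bound Dp _; [exact: SUC_smooth i sf 1%N|exact: CP].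
all: have c : ucauchy (fun i => rayint w r (f i)).
all: try (move=> e e0; have [N NP] := SUC_cauchy sf e0; exists N => i j p iN jN Dp;
  rewrite -(rayintB w r (SUC_smooth i sf 1%N) (SUC_smooth j sf 1%N) Dp);
  apply: rayint_bound Dp _; last by move=> q Dq; exact: NP).
all: try by apply: Ck_on_add => //; [exact: SUC_smooth i sf 1%N|
  apply: Ck_on_opp => //; exact: SUC_smooth j sf 1%N].
  exact: SUC_base.
apply: SUC_step => // j; apply: SUC_congr (IH (r + w j)%N _ (SUC_derive j sf)) => i p Dp.
by rewrite (derive_rayint w r j (SUC_smooth i sf 2%N) Dp).
Qed.

Lemma fin_bound m (B : 'I_m -> R -> Prop) :
  (forall a C C', B a C -> C <= C' -> B a C') -> (forall a, exists C, B a C) ->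
  exists2 C, 0 <= C & forall a, B a C.
Proof.
move=> Bm /choice[c cP]; exists (\sum_a `|c a|); first exact: sumr_ge0.
move=> a; apply: Bm (cP a) _; rewrite (bigD1 a)//= (le_trans (ler_norm _))//.
by rewrite lerDl sumr_ge0.
Qed.

Lemma fin_rank m (B : 'I_m -> nat -> Prop) :
  (forall a N N', B a N -> (N <= N')%N -> B a N') -> (forall a, exists N, B a N) ->
  exists N, forall a, B a N.
Proof.
move=> Bm /choice[c cP]; exists (\sum_a c a)%N => a; apply: Bm (cP a) _.
by rewrite (bigD1 a)//= leq_addr.
Qed.

(** The recursion [e |-> d + e / 2] has the fixed point [2 * d], and the initial oscillation [2 * K]
    is halved [t] times. The error [d] leaves room for iterations whose coefficients themselves vary
    with the index. *)
Lemma ucauchy_contract m (u : 'I_m -> nat -> V -> R) (K d : R) (N : nat) :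
  0 <= K -> 0 <= d ->
  (forall a i p, D p -> `|u a i p| <= K) ->
  (forall i j e, (N <= i)%N -> (N <= j)%N ->
     (forall a p, D p -> `|u a i p - u a j p| <= e) ->
     forall a p, D p -> `|u a i.+1 p - u a j.+1 p| <= d + e / 2) ->
  forall t i j, (N + t <= i)%N -> (N + t <= j)%N ->
    forall a p, D p -> `|u a i p - u a j p| <= 2 * d + 2 * K / 2 ^+ t.
Proof.
move=> K0 d0 uK ustep; elim=> [|t IH] i j.
  move=> _ _ a p Dp; rewrite expr0 divr1 (le_trans (ler_normB _ _))//.
  have := uK a i p Dp; have := uK a j p Dp; lra.
case: i => [|i]; first by rewrite addnS.
case: j => [|j]; first by rewrite addnS.
rewrite addnS !ltnS => iN jN a p Dp.
have := ustep i j _ (leq_trans (leq_addr _ _) iN) (leq_trans (leq_addr _ _) jN) (IH _ _ iN jN) a p Dp.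
move=> /le_trans; apply; rewrite exprS.
rewrite (_ : 2 * K / (2 * 2 ^+ t) = (2 * K / 2 ^+ t) / 2); last first.
  by field; rewrite expf_neq0.
lra.
Qed.

Lemma halves_small (K e : R) : 0 <= K -> 0 < e -> exists t, K / 2 ^+ t <= e.
Proof.
move=> K0 e0; exists (Num.trunc (K / e)).+1.
rewrite ler_pdivrMr ?exprn_gt0// mulrC -ler_pdivrMr//.
have /andP[_ h] : (Num.trunc (K / e))%:R <= K / e < (Num.trunc (K / e)).+1%:R.
  by apply: truncn_itv; rewrite divr_ge0// ltW.
rewrite (le_trans (ltW h))// -natrX ler_nat ltnW// ltn_expl//.
Qed.

End UniformCauchy.

(** * Linear iterations of ray integrals *)

Section LinearIteration.
Context {R : realType} {n : nat}.
Variables (w : 'I_n -> bool) (rho : R).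
Hypothesis rho0 : 0 <= rho.
Notation D := (oball n rho).
Notation V := 'rV[R]_n.
Let oD : open D := @open_oball R n rho.
Notation SUC := (@SUC R n rho).

(** This is the linearised Picard operator. The weight [r] is a parameter because it rises with each
    derivative in a scaled coordinate. *)
Definition linterm m (r : nat) (A : 'I_n -> 'I_m -> V -> R) (u : 'I_m -> V -> R) (p : V) : R :=
  \sum_l scalepart w p 0 l * rayint w r (fun q => \sum_c A l c q * u c q) p.

Lemma scalepart_le (p : V) l : D p -> `|scalepart w p 0 l| <= rho.
Proof.
move=> Dp; rewrite mxE; case: (w l); last by rewrite normr0.
by apply: le_trans (mx_entry_le _ _ _) _; exact: ltW.
Qed.

Lemma sum_scalepart_bound (g : 'I_n -> R) (C : R) p : D p -> 0 <= C ->
  (forall l, `|g l| <= C) -> `|\sum_l scalepart w p 0 l * g l| <= n%:R * rho * C.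
Proof.
move=> Dp C0 gC; rewrite (le_trans (ler_norm_sum _ _ _))//.
apply: (@le_trans _ _ (\sum_(l < n) rho * C)).
  by apply: ler_sum => l _; rewrite normrM ler_pM//; exact: scalepart_le.
by rewrite sumr_const card_ord -mulrA mulr_natl.
Qed.

Lemma smooth_lin m (A u : 'I_m -> V -> R) k :
  (forall c, smooth_on D (A c)) -> (forall c, smooth_on D (u c)) ->
  Ck_on k D (fun q => \sum_c A c q * u c q).
Proof.
move=> sA su; apply: Ck_on_sum => // c; apply: Ck_on_mul => //.
  exact: sA.
exact: su.
Qed.

Lemma linterm_bound m r (A : 'I_n -> 'I_m -> V -> R) (u : 'I_m -> V -> R) (C K : R) p :
  (forall l c, smooth_on D (A l c)) -> (forall c, smooth_on D (u c)) ->
  0 <= C -> 0 <= K -> (forall l c q, D q -> `|A l c q| <= C) ->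
  (forall c q, D q -> `|u c q| <= K) -> D p ->
  `|linterm r A u p| <= n%:R * rho * (m%:R * (C * K)).
Proof.
move=> sA su C0 K0 AC uK Dp; apply: sum_scalepart_bound => //.
  by rewrite !mulr_ge0.
move=> l; apply: rayint_bound Dp _; first exact: smooth_lin.
move=> q Dq; rewrite (le_trans (ler_norm_sum _ _ _))//.
apply: (@le_trans _ _ (\sum_(c < m) C * K)).
  by apply: ler_sum => c _; rewrite normrM ler_pM ?AC ?uK.
by rewrite sumr_const card_ord mulr_natl.
Qed.

Lemma lintermB m r (A : 'I_n -> 'I_m -> V -> R) (u v : 'I_m -> V -> R) p :
  (forall l c, smooth_on D (A l c)) -> (forall c, smooth_on D (u c)) ->
  (forall c, smooth_on D (v c)) -> D p ->
  linterm r A u p - linterm r A v p = linterm r A (fun c q => u c q - v c q) p.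
Proof.
move=> sA su sv Dp; rewrite /linterm -sumrB; apply: eq_bigr => l _.
rewrite -mulrBr -(rayintB w r (smooth_lin 1 (sA l) su) (smooth_lin 1 (sA l) sv) Dp).
congr (_ * _); apply: eq_rayint Dp _ => q _; rewrite -sumrB.
by apply: eq_bigr => c _; rewrite mulrBr.
Qed.

Lemma lintermBl m r (A B : 'I_n -> 'I_m -> V -> R) (u : 'I_m -> V -> R) p :
  (forall l c, smooth_on D (A l c)) -> (forall l c, smooth_on D (B l c)) ->
  (forall c, smooth_on D (u c)) -> D p ->
  linterm r A u p - linterm r B u p = linterm r (fun l c q => A l c q - B l c q) u p.
Proof.
move=> sA sB su Dp; rewrite /linterm -sumrB; apply: eq_bigr => l _.
rewrite -mulrBr -(rayintB w r (smooth_lin 1 (sA l) su) (smooth_lin 1 (sB l) su) Dp).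
congr (_ * _); apply: eq_rayint Dp _ => q _; rewrite -sumrB.
by apply: eq_bigr => c _; rewrite mulrBl.
Qed.

Lemma smooth_sub (f g : V -> R) : smooth_on D f -> smooth_on D g ->
  smooth_on D (fun q => f q - g q).
Proof.
by move=> sf sg k; apply: Ck_on_add => //; apply: Ck_on_opp.
Qed.

Section Iteration.
Variables (m r : nat) (A : 'I_n -> 'I_m -> 'I_m -> nat -> V -> R)
  (b u : 'I_m -> nat -> V -> R) (C : R).
Hypotheses (C0 : 0 <= C) (rC : n%:R * rho * (m%:R * C) <= 2^-1).
Hypothesis AC : forall l a c i p, D p -> `|A l a c i p| <= C.
Hypothesis su : forall a i, smooth_on D (u a i).
Hypothesis uE : forall a i p, D p ->
  u a i.+1 p = b a i p + linterm r (fun l c => A l a c i) (fun c => u c i) p.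

Let contr K : 0 <= K -> n%:R * rho * (m%:R * (C * K)) <= K / 2.
Proof.
move=> K0; rewrite (mulrA m%:R) mulrA mulrC ler_wpM2l//.
Qed.

Lemma lin_bounded : (forall l a c i, smooth_on D (A l a c i)) ->
  (forall a, ubounded rho (b a)) -> (forall a, ubounded rho (fun=> u a 0%N)) ->
  exists2 K, 0 <= K & forall a i p, D p -> `|u a i p| <= K.
Proof.
move=> sA /(fin_bound (B := fun a C => forall i p, D p -> `|b a i p| <= C)) [].
  by move=> a c c' h cc' i p Dp; exact: le_trans (h i p Dp) cc'.
move=> Kb Kb0 bK /(fin_bound (B := fun a C => forall (i : nat) p, D p -> `|u a 0%N p| <= C)) [].
  by move=> a c c' h cc' i p Dp; exact: le_trans (h i p Dp) cc'.
(* This bound is preserved by one step: the linear term contributes at most half of it, and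
   [Kb + (2 * Kb + Ku) / 2] does not exceed it. *)
move=> Ku Ku0 uK; exists (2 * Kb + Ku) => [|a i]; first lra.
elim: i a => [|i IH] a p Dp; first by have := uK a 0%N p Dp; lra.
rewrite uE// (le_trans (ler_normD _ _))//.
have K0 : 0 <= 2 * Kb + Ku by lra.
have /(_ p Dp) := linterm_bound r (fun l c => sA l a c i) (fun c => su c i) C0 K0
   (fun l c q => @AC l a c i q) IH.
have := contr K0; have := bK a i p Dp; lra.
Qed.

Lemma lin_cauchy : (forall l a c i, smooth_on D (A l a c i)) ->
  (forall a, ubounded rho (b a)) -> (forall a, ubounded rho (fun=> u a 0%N)) ->
  (forall l a c, ucauchy rho (A l a c)) -> (forall a, ucauchy rho (b a)) ->
  forall a, ucauchy rho (u a).
Proof.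
move=> sA bb b0 cA cb a e e0.
have [K K0 uK] := lin_bounded sA bb b0.
have d0 : 0 < e / 4 by rewrite divr_gt0.
have [Nb NbP] : exists N, forall a i j p, (N <= i)%N -> (N <= j)%N -> D p ->
    `|b a i p - b a j p| <= e / 8.
  apply: (fin_rank (B := fun a N => forall i j p, (N <= i)%N -> (N <= j)%N -> D p ->
    `|b a i p - b a j p| <= e / 8)).
    by move=> c N N' h NN i j p iN jN; apply: h; exact: leq_trans NN _.
  by move=> c; apply: cb; rewrite divr_gt0.
(* [M] is such that coefficients known up to [e / 8 / M] change the linear term by at most [e / 8];
   the summand 1 makes it positive. With [e / 8] more from [b] the error per step is [e / 4], hence
   [e / 2] in the limit. *)
set M := n%:R * rho * (m%:R * K) + 1.
have M0 : 0 < M by rewrite ltr_wpDl// !mulr_ge0.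
have eM : 0 < e / 8 / M by rewrite !divr_gt0.
have [NA NAP] : exists N, forall x : 'I_n * 'I_m * 'I_m, forall i j p, (N <= i)%N -> (N <= j)%N -> D p ->
    `|A x.1.1 x.1.2 x.2 i p - A x.1.1 x.1.2 x.2 j p| <= e / 8 / M.
  have /choice[c cP] : forall x : 'I_n * 'I_m * 'I_m, exists N, forall i j p,
      (N <= i)%N -> (N <= j)%N -> D p ->
      `|A x.1.1 x.1.2 x.2 i p - A x.1.1 x.1.2 x.2 j p| <= e / 8 / M.
    by move=> x; exact: cA.
  exists (\sum_x c x)%N => x i j p iN jN; apply: cP.
    by apply: leq_trans iN; rewrite (bigD1 x)//= leq_addr.
  by apply: leq_trans jN; rewrite (bigD1 x)//= leq_addr.
have t0 : forall t i j, (maxn Nb NA + t <= i)%N -> (maxn Nb NA + t <= j)%N ->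
    forall c p, D p -> `|u c i p - u c j p| <= 2 * (e / 4) + 2 * K / 2 ^+ t.
  apply: (ucauchy_contract K0 (ltW d0) uK) => i j e' iN jN uij c p Dp.
  have e'0 : 0 <= e' by exact: le_trans (normr_ge0 _) (uij c p Dp).
  have [iNb iNA] : (Nb <= i)%N /\ (NA <= i)%N by apply/andP; rewrite -geq_max.
  have [jNb jNA] : (Nb <= j)%N /\ (NA <= j)%N by apply/andP; rewrite -geq_max.
  rewrite !uE//.
  have h1 := NbP c i j p iNb jNb Dp.
  pose L i j := linterm r (fun l d => A l c d i) (fun d => u d j) p.
  (* Coefficients and unknowns are exchanged one at a time: this term varies the coefficients, and
     [h3] varies the unknowns, where the contraction acts. *)
  have h2 : `|L i i - L j i| <= e / 8.
    rewrite /L lintermBl//.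
    apply: (@le_trans _ _ (n%:R * rho * (m%:R * (e / 8 / M * K)))).
      apply: linterm_bound Dp => //.
      - by move=> l d; exact: smooth_sub.
      - exact: ltW.
      - by move=> l d q Dq; exact: (NAP (l, c, d)).
      - by move=> d q; exact: uK.
    rewrite (_ : n%:R * rho * (m%:R * (e / 8 / M * K)) = e / 8 * ((M - 1) / M)); last first.
      by rewrite /M addrK; field; rewrite gt_eqF.
    by rewrite ler_piMr// ?divr_ge0 ?ltW// ltr_pdivrMr// mul1r ltrBlDr ltrDl.
  have h3 : `|L j i - L j j| <= e' / 2.
    rewrite /L lintermB//; apply: le_trans (contr e'0).
    apply: linterm_bound Dp => //.
    - by move=> d; exact: smooth_sub.
    - by move=> l d q; exact: AC.
  rewrite (_ : _ - _ = (b c i p - b c j p) + (L i i - L j i) + (L j i - L j j)); last first.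
    rewrite -/(L i i) -/(L j j); ring.
  rewrite (le_trans (ler_normD _ _))// (le_trans (lerD (ler_normD _ _) (lexx _)))//.
  lra.
have [t tK] : exists t, 2 * K / 2 ^+ t <= e / 2.
  by apply: halves_small; [rewrite mulr_ge0|rewrite divr_gt0].
exists (maxn Nb NA + t)%N => i j p iN jN Dp.
rewrite (le_trans (t0 t i j iN jN a p Dp))//; lra.
Qed.

End Iteration.

Lemma SUC_scalepart k l : SUC k (fun _ p => scalepart w p 0 l).
Proof.
case wl: (w l).
  by apply: SUC_congr (SUC_coord rho k l) => i p _; rewrite mxE wl.
by apply: SUC_congr (SUC_cst rho k 0) => i p _; rewrite mxE wl.
Qed.

Lemma derive_sumfun (I : Type) (s : seq I) (F : I -> V -> R) x v :
  (forall i, differentiable (F i) x) ->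
  differentiable (fun y => \sum_(i <- s) F i y) x /\
  'D_v (fun y => \sum_(i <- s) F i y) x = \sum_(i <- s) 'D_v (F i) x.
Proof.
move=> dF; elim: s => [|i s [ds IH]].
  under eq_fun do rewrite big_nil; rewrite big_nil.
  by split; [exact: differentiable_cst|exact: derive_cst].
under eq_fun do rewrite big_cons; rewrite big_cons.
split; first exact: (differentiableD (dF i) ds).
by rewrite -IH; apply: deriveD; apply: diff_derivable.
Qed.

Lemma derive_mulfun (f g : V -> R) x v :
  differentiable f x -> differentiable g x ->
  'D_v (fun y => f y * g y) x = 'D_v f x * g x + f x * 'D_v g x.
Proof.
move=> df dg; have := deriveM (diff_derivable (v := v) df) (diff_derivable (v := v) dg).
by move=> /= ->; rewrite addrC -![_ *: _]/(_ * _) (mulrC (g x)).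
Qed.

Lemma derive_coordfun (x v : V) j : 'D_v (fun y : V => y 0 j) x = v 0 j.
Proof.
have dx : differentiable (id : V -> V) x by have [] := is_diff_id x.
by rewrite -(derive_entry v 0 j dx) derive_id.
Qed.

Lemma derive_scalepart (x v : V) l :
  'D_v (fun y : V => scalepart w y 0 l) x = scalepart w v 0 l.
Proof.
have e (y : V) : scalepart w y 0 l = if w l then y 0 l else 0 by rewrite mxE.
under eq_fun do rewrite e; rewrite e; case: (w l); last exact: derive_cst.
exact: derive_coordfun.
Qed.

Lemma derive_linterm m r (A : 'I_n -> 'I_m -> V -> R) (u : 'I_m -> V -> R) p j :
  (forall l c, smooth_on D (A l c)) -> (forall c, smooth_on D (u c)) -> D p ->
  'D_(EE j) (linterm r A u) p =
  \sum_l (scalepart w (EE j) 0 l * rayint w r (fun q => \sum_c A l c q * u c q) p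
     + scalepart w p 0 l *
       rayint w (r + w j) (fun q => \sum_c 'D_(EE j) (A l c) q * u c q) p)
  + linterm (r + w j) A (fun c => 'D_(EE j) (u c)) p.
Proof.
move=> sA su Dp; rewrite /linterm -big_split /=.
have sr l : smooth_on D (rayint w r (fun q => \sum_c A l c q * u c q)).
  by apply: rayint_smooth => k; exact: smooth_lin.
have ds l : differentiable (fun y : V => scalepart w y 0 l) p.
  by apply: smooth_diff Dp; exact: SUC_smooth 0%N (SUC_scalepart 0 l).
have [|_ ->] := @derive_sumfun 'I_n (index_enum _) (fun l q => scalepart w q 0 l *
   rayint w r (fun q => \sum_c A l c q * u c q) q) p (EE j).
  by move=> l; apply: differentiableM => //; apply: smooth_diff Dp.
apply: eq_bigr => l _; rewrite derive_mulfun//; last exact: smooth_diff Dp.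
rewrite derive_scalepart -addrA; congr (_ + _).
rewrite (derive_rayint w r j (smooth_lin 2 (sA l) su) Dp).
rewrite -mulrDr; congr (_ * _).
have sD1 : Ck_on 1 D (fun q => \sum_c 'D_(EE j) (A l c) q * u c q).
  by apply: smooth_lin => // c; exact: smooth_derive.
have sD2 : Ck_on 1 D (fun q => \sum_c A l c q * 'D_(EE j) (u c) q).
  by apply: smooth_lin => // c; exact: smooth_derive.
rewrite -(rayintD w (r + w j) sD1 sD2 Dp); apply: eq_rayint Dp _ => q Dq.
have [|_ ->] := @derive_sumfun 'I_m (index_enum _) (fun c q => A l c q * u c q) q (EE j).
  move=> c; apply: differentiableM; apply: smooth_diff Dq; [exact: sA|exact: su].
rewrite -big_split /=; apply: eq_bigr => c _.
by rewrite derive_mulfun//; apply: smooth_diff Dq; [exact: sA|exact: su].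
Qed.

(* The first derivatives of an iteration [u_(i+1) = b_i + linterm r A_i u_i] form
   an iteration of the same shape, whose inhomogeneous term only involves the
   [u_i] themselves; hence the induction on [k]. *)
Lemma lin_SUC (m k : nat) (A : 'I_n -> 'I_m -> 'I_m -> nat -> V -> R) (C : R) :
  0 <= C -> n%:R * rho * (m%:R * C) <= 2^-1 ->
  (forall l a c i p, D p -> `|A l a c i p| <= C) ->
  (forall l a c, SUC k (A l a c)) ->
  forall (r : nat) (b u : 'I_m -> nat -> V -> R),
  (forall a, SUC k (b a)) ->
  (forall a, SUC k (fun=> u a 0%N)) ->
  (forall a i, smooth_on D (u a i)) ->
  (forall a i p, D p ->
     u a i.+1 p = b a i p + linterm r (fun l c => A l a c i) (fun c => u c i) p) ->
  forall a, SUC k (u a).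
Proof.
move=> C0 rC AC; elim: k => [|k IH] sA r b u sb su0 su uE.
all: have sA' l a c i : smooth_on D (A l a c i) by exact: SUC_smooth i (sA l a c).
all: have bb a : ubounded rho (b a) by exact: SUC_bounded (sb a).
all: have b0 a : ubounded rho (fun=> u a 0%N) by exact: SUC_bounded (su0 a).
all: have cA l a c : ucauchy rho (A l a c) by exact: SUC_cauchy (sA l a c).
all: have cb a : ucauchy rho (b a) by exact: SUC_cauchy (sb a).
all: have [K K0 uK] := lin_bounded C0 rC AC su uE sA' bb b0.
all: have cu := lin_cauchy C0 rC AC su uE sA' bb b0 cA cb.
all: have bu a : ubounded rho (u a) by (exists K => i p Dp; exact: uK).
  by move=> a; exact: SUC_base.
have IHu : forall a, SUC k (u a).
  apply: (IH _ r b) => //.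
  - by move=> l a c; exact: SUCW.
  - by move=> a; exact: SUCW.
  - by move=> a; exact: SUCW (su0 a).
move=> a; apply: SUC_step => // j; move: a.
pose b' a i p := 'D_(EE j) (b a i) p +
  \sum_l (scalepart w (EE j) 0 l * rayint w r (fun q => \sum_c A l a c i q * u c i q) p
     + scalepart w p 0 l *
       rayint w (r + w j) (fun q => \sum_c 'D_(EE j) (A l a c i) q * u c i q) p).
apply: (IH _ (r + w j)%N b' (fun a i => 'D_(EE j) (u a i))).
- by move=> l a c; exact: SUCW.
- move=> a; apply: SUC_add; first exact: SUC_derive (sb a).
  apply: SUC_sum => l; apply: SUC_add; apply: SUC_mul.
  + exact: SUC_cst.
  + apply: (@SUC_rayint R n w rho k r (fun i q => \sum_c A l a c i q * u c i q)).
    apply: SUC_sum => c; apply: SUC_mul; last exact: IHu.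
    exact: SUCW.
  + exact: SUC_scalepart.
  + apply: (@SUC_rayint R n w rho k (r + w j)
        (fun i q => \sum_c 'D_(EE j) (A l a c i) q * u c i q)).
    apply: SUC_sum => c; apply: SUC_mul; last exact: IHu.
    exact: SUC_derive (sA l a c).
- by move=> a; exact: SUC_derive (su0 a).
- by move=> a i; exact: smooth_derive.
move=> a i p Dp.
rewrite (derive_congr (g := fun p => b a i p +
  linterm r (fun l c => A l a c i) (fun c => u c i) p) _ oD _ Dp); last exact: uE.
have db : differentiable (b a i) p by apply: smooth_diff Dp; exact: SUC_smooth i (sb a).
have dl : differentiable (linterm r (fun l c => A l a c i) (fun c => u c i)) p.
  have [] // := @derive_sumfun 'I_n (index_enum _) (fun l q => scalepart w q 0 l *
     rayint w r (fun q => \sum_c A l a c i q * u c i q) q) p (EE j) => l.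
  apply: differentiableM.
    by apply: smooth_diff Dp; exact: SUC_smooth 0%N (SUC_scalepart 0 l).
  by apply: smooth_diff Dp; apply: rayint_smooth => k'; exact: smooth_lin.
have -> := deriveD (diff_derivable (v := EE j) db) (diff_derivable (v := EE j) dl).
by rewrite derive_linterm// addrA.
Qed.

End LinearIteration.

(** * Compositions and uniform limits of the iterates *)

Section Limits.
Context {R : realType} {n : nat}.
Variable rho : R.
Notation D := (oball n rho).
Notation V := 'rV[R]_n.
Let oD : open D := @open_oball R n rho.
Notation SUC := (@SUC R n rho).

Lemma smooth_row m (A : set V) (F : 'I_m -> V -> R) : open A ->
  (forall c, smooth_on A (F c)) -> smooth_on A (fun p => \row_c F c p).
Proof.
move=> oA sF k; apply/Ck_on_mxP => // i j.
by apply: Ck_on_congr (sF j k) => // p _; rewrite mxE.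
Qed.

Lemma derive_rowcomp m (F : 'I_m -> V -> R) (G : 'rV[R]_m -> R) p v :
  (forall c, differentiable (F c) p) -> differentiable G (\row_c F c p) ->
  'D_v (fun q => G (\row_c F c q)) p =
    \sum_c 'D_(EE c) G (\row_c F c p) * 'D_v (F c) p.
Proof.
move=> dF dG.
have dr : differentiable (fun q => \row_c F c q : 'rV[R]_m) p.
  apply/differentiable_mxP => i j.
  by under eq_fun do rewrite mxE.
rewrite (derive_comp v dr dG) (derive_coords _ dG); apply: eq_bigr => c _.
rewrite (derive_entry v 0 c dr) -[_ *: _]/(_ * _) mulrC; congr (_ * _).
by under eq_fun do rewrite mxE.
Qed.

(** The gap [r < s] confines the values to a compact ball on which [G] and its partial derivatives
    are bounded, which makes [G] Lipschitz there. The chain rule then reduces order [k.+1] to order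
    [k] for the partial derivatives of [G]. *)
Lemma SUC_comp m k (G : 'rV[R]_m -> R) (F : 'I_m -> nat -> V -> R) (r s : R) :
  smooth_on (oball m s) G -> r < s ->
  (forall c, SUC k (F c)) ->
  (forall i p, D p -> `|\row_c F c i p| <= r) ->
  SUC k (fun i p => G (\row_c F c i p)).
Proof.
move=> sG rs; elim: k G sG => [|k IH] G sG sF Fr.
all: have FB i p : D p -> oball m s (\row_c F c i p)
       by (move=> Dp; exact: le_lt_trans (Fr i p Dp) rs).
all: have sGF i : smooth_on D (fun p => G (\row_c F c i p)).
all: try (move=> k'; apply: (Ck_on_comp (B := oball m s) oD) => //;
  [exact: FB|by apply: smooth_row => // c; exact: SUC_smooth i (sF c)]).
all: have rB : cball m r `<=` oball m s by (move=> x /= xr; exact: le_lt_trans xr rs).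
all: have bG : ubounded rho (fun i p => G (\row_c F c i p)).
all: try (have [C _ CP] := cball_bounded (sG 0%N) rB;
  by exists C => i p Dp; apply: CP; exact: Fr).
all: have cG : ucauchy rho (fun i p => G (\row_c F c i p)).
all: try (have [C C0 CP] := fin_bound (B := fun j C => forall x, cball m r x -> `|'D_(EE j) G x| <= C)
    (fun j c c' (h : forall x, cball m r x -> `|'D_(EE j) G x| <= c) cc x xr => le_trans (h x xr) cc)
    (fun j => let: ex_intro2 C _ CP := cball_bounded (smooth_derive (EE j) sG 0%N) rB in
              ex_intro _ C CP)).
all: try (move=> e e0; have M0 : 0 < m%:R * C + 1 by rewrite ltr_wpDl// mulr_ge0).
all: try (have e1 : 0 < e / (m%:R * C + 1) by rewrite divr_gt0).
all: try (have [N NP] : exists N, forall c i j p, (N <= i)%N -> (N <= j)%N -> D p ->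
      `|F c i p - F c j p| <= e / (m%:R * C + 1);
  [apply: (fin_rank (B := fun c N => forall i j p, (N <= i)%N -> (N <= j)%N -> D p ->
      `|F c i p - F c j p| <= e / (m%:R * C + 1)));
   [by move=> c N N' h NN i j p iN jN; apply: h; exact: leq_trans NN _
   |by move=> c; exact: SUC_cauchy (sF c) _ e1]|]).
all: try (exists N => i j p iN jN Dp;
  rewrite (le_trans (lipschitz_convex (@convex_cball R m r) C0
    (fun z zr => smooth_diff sG (rB z zr)) (fun z c zr => CP c z zr) (Fr j p Dp) (Fr i p Dp)))//).
all: try (apply: (@le_trans _ _ (m%:R * C * (e / (m%:R * C + 1))));
  [rewrite ler_wpM2l ?mulr_ge0//; apply: mx_norm_leP (ltW e1) _ => a b; rewrite !mxE;
   exact: NP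
  |rewrite mulrCA ler_piMr ?ltW//; rewrite ltr_pdivrMr// mul1r ltrDl//]).
  exact: SUC_base.
apply: SUC_step => // j.
have : SUC k (fun i p => \sum_c 'D_(EE c) G (\row_c F c i p) * 'D_(EE j) (F c i) p).
  apply: SUC_sum => c; apply: SUC_mul; last exact: SUC_derive (sF c).
  apply: (IH ('D_(EE c) G)) => //; first exact: smooth_derive.
  by move=> d; exact: SUCW.
apply: SUC_congr => i p Dp; rewrite derive_rowcomp//.
- by move=> c; apply: smooth_diff Dp; exact: SUC_smooth i (sF c).
- by apply: smooth_diff (FB i p Dp).
Qed.

Definition ulim (f : nat -> V -> R) (g : V -> R) := forall e, 0 < e ->
  exists N : nat, forall i p, (N <= i)%N -> D p -> `|f i p - g p| <= e.

Lemma ucauchy_ulim f : ucauchy rho f -> exists g, ulim f g.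
Proof.
move=> cf.
have cp p : exists l : R, D p -> forall e, 0 < e -> exists N : nat, forall i, (N <= i)%N -> `|f i p - l| <= e.
  have [Dp|nDp] := pselect (D p); last by exists 0.
  have : cvg ((fun i => f i p) @ \oo).
    apply/cauchy_cvgP/cauchy_exP => e e0.
    have [N NP] := cf (e / 2) (divr_gt0 e0 (ltr0n _ 2)).
    exists (f N p); exists N => // i /= iN.
    rewrite /ball /= (le_lt_trans (NP N i p (leqnn N) iN Dp))//.
    by rewrite ltr_pdivrMr// ltr_pMr// ltr1n.
  move=> /cvg_ex[l fl]; exists l => _ e e0.
  move/cvgrPdist_le : fl => /(_ e e0)[N _ NP]; exists N => i iN.
  by rewrite distrC; exact: NP.
have [g gP] := choice cp; exists g => e e0.
have e2 : 0 < e / 2 by rewrite divr_gt0.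
have [N NP] := cf _ e2; exists N => i p iN Dp.
have [M MP] := gP p Dp _ e2.
rewrite (le_trans (ler_distD (f (maxn N M) p) _ _))// [leRHS]splitr lerD//.
  by apply: NP => //; exact: leq_maxl.
by apply: MP; exact: leq_maxr.
Qed.

Lemma bound_of_approx (a b a' b' s s' B B' d : R) :
  `|a - b - s| <= B -> `|s - s'| <= B' -> `|a - a'| <= d -> `|b - b'| <= d ->
  `|a' - b' - s'| <= B + (2 * d + B').
Proof.
rewrite !ler_norml => /andP[? ?] /andP[? ?] /andP[? ?] /andP[? ?].
by apply/andP; split; lra.
Qed.

(** The second derivatives of the [f i] are bounded uniformly in [i], so their Taylor estimates
    share one constant and pass to the limit as a quadratic remainder for [g]. *)
Lemma ulim_differentiable f g p (gd : 'I_n -> V -> R) : SUC 2 f -> ulim f g ->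
  (forall j, ulim (fun i => 'D_(EE j) (f i)) (gd j)) -> D p ->
  differentiable g p /\ forall v, 'D_v g p = \sum_j v 0 j * gd j p.
Proof.
move=> sf fg fgd Dp.
have [C C0 CP] : exists2 C, 0 <= C & forall i a b q, D q ->
    `|'D_(EE a) ('D_(EE b) (f i)) q| <= C.
  have /choice[c cP] : forall x : 'I_n * 'I_n, exists C, forall i q, D q ->
      `|'D_(EE x.1) ('D_(EE x.2) (f i)) q| <= C.
    by move=> [a b]; exact: SUC_bounded (SUC_derive a (SUC_derive b sf)).
  exists (\sum_x `|c x|) => [|i a b q Dq]; first exact: sumr_ge0.
  rewrite (le_trans (cP (a, b) i q Dq))// (le_trans (ler_norm _))//.
  by rewrite (bigD1 (a, b))//= lerDl sumr_ge0.
apply: (@differentiable_quad _ _ _ _ _ (n%:R * (n%:R * C))).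
apply: (@open_nearP _ _ D) => // q Dq.
apply/ler_addgt0Pr => e e0.
(* Replacing the two values and the partial derivatives by their limits costs [M] times the
   accuracy, hence the accuracy [e / M]. *)
set M := 2 + n%:R * `|q - p|.
have M0 : 0 < M by rewrite ltr_pwDl// mulr_ge0.
have e1 : 0 < e / M by rewrite divr_gt0.
have [N NP] := fg _ e1.
have [N' NP'] : exists N, forall j i p, (N <= i)%N -> D p ->
    `|'D_(EE j) (f i) p - gd j p| <= e / M.
  apply: (fin_rank (B := fun j N => forall i p, (N <= i)%N -> D p ->
    `|'D_(EE j) (f i) p - gd j p| <= e / M)).
    by move=> j a b h ab i x bi; apply: h; exact: leq_trans ab _.
  by move=> j; exact: fgd.
set i := maxn N N'.
have iN : (N <= i)%N by exact: leq_maxl.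
have iN' : (N' <= i)%N by exact: leq_maxr.
have sfi := SUC_smooth i sf.
have T := taylor1 (@convex_oball R n rho) C0 (fun z Dz => smooth_diff sfi Dz)
  (fun z j Dz => smooth_diff (smooth_derive (EE j) sfi) Dz) (fun z a b => CP i a b z) Dp Dq.
rewrite derive_coords in T; last exact: smooth_diff Dp.
have S : `|\sum_j (q - p) 0 j * 'D_(EE j) (f i) p - \sum_j (q - p) 0 j * gd j p| <=
    n%:R * `|q - p| * (e / M).
  rewrite -sumrB (le_trans (ler_norm_sum _ _ _))//.
  apply: (@le_trans _ _ (\sum_(j < n) `|q - p| * (e / M))).
    apply: ler_sum => j _; rewrite -mulrBr normrM ler_pM//; first exact: mx_entry_le.
    exact: NP'.
  by rewrite sumr_const card_ord -mulrA mulr_natl.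
have h1 := NP i q iN Dq; have h2 := NP i p iN Dp.
have eE : e = 2 * (e / M) + n%:R * `|q - p| * (e / M).
  by rewrite -mulrDl mulrC divfK// gt_eqF.
have := bound_of_approx T S h1 h2.
by rewrite -eE.
Qed.

Lemma SUC_ulim_smooth f g : (forall k, SUC k f) -> ulim f g -> smooth_on D g.
Proof.
move=> sf fg k; elim: k f g sf fg => [|k IH] f g sf fg.
all: have /choice[gd gdP] : forall j, exists gd, ulim (fun i => 'D_(EE j) (f i)) gd
  by (move=> j; apply: ucauchy_ulim; exact: SUC_cauchy (SUC_derive j (sf 1%N))).
all: have dg p : D p -> differentiable g p /\ forall v, 'D_v g p = \sum_j v 0 j * gd j p
  by (exact: ulim_differentiable (sf 2%N) fg gdP).
  move=> p; rewrite inE => Dp; apply: differentiable_continuous.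
  by have [] := dg p Dp.
split=> [p Dp|v]; first by have [] := dg p Dp.
have : Ck_on k D (fun p => \sum_j v 0 j * gd j p).
  apply: Ck_on_sum => // j; apply: Ck_on_scale => //.
  by apply: (IH (fun i => 'D_(EE j) (f i))) => // k'; exact: SUC_derive.
by apply: Ck_on_congr => // p Dp; have [_ ->] := dg p Dp.
Qed.

End Limits.

(** * The Picard iteration for the radial equation *)

Section Picard.
Context {R : realType} {n : nat}.
Variables (w : 'I_n -> bool) (rho r1 r0 C : R).
Notation V := 'rV[R]_n.
Variable X : 'I_n -> 'I_n -> V -> R.
Hypothesis sX : forall l a, smooth_on (oball n r0) (X l a).
Hypotheses (rho_gt0 : 0 < rho) (r1_gt0 : 0 < r1) (r10 : r1 < r0) (C0 : 0 <= C).
Hypothesis XC : forall l a x, cball n r1 x -> `|X l a x| <= C.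
Hypothesis DXC : forall l a c x, cball n r1 x -> `|'D_(EE c) (X l a) x| <= C.
Hypotheses (rho1 : rho <= r1 / 2) (rho2 : n%:R * rho * C <= r1 / 2).
Hypothesis rho3 : n%:R * rho * (n%:R * C) <= 2^-1.
Notation D := (oball n rho).
Let oD : open D := @open_oball R n rho.
Let rho0 : 0 <= rho := ltW rho_gt0.
Notation SUC := (@SUC R n rho).

(** The unknown is the displacement [h] from the slice. The right-hand side of its equation carries
    a factor [scalepart w p], so a solution automatically fixes the slice. *)
Definition flowcoord (h : 'I_n -> V -> R) (q : V) : V :=
  \row_c (fixpart w q 0 c + h c q).

(** [rho1] and [rho2] keep every iterate in the ball of radius [r1], where [C] bounds [X] and its
    first derivatives; [rho3] makes each step halve distances. *)
Fixpoint picard (i : nat) (a : 'I_n) (p : V) : R :=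
  match i with
  | 0 => 0
  | i'.+1 => \sum_l scalepart w p 0 l *
      rayint w 0 (fun q => X l a (flowcoord (picard i') q)) p
  end.
Notation h := (fun a i => picard i a).

Lemma fixpart_le (p : V) c : `|fixpart w p 0 c| <= `|p|.
Proof. by rewrite mxE; case: (w c); rewrite ?normr0// mx_entry_le. Qed.

Lemma derive_fixpart (x v : V) c :
  'D_v (fun y : V => fixpart w y 0 c) x = fixpart w v 0 c.
Proof.
have e (y : V) : fixpart w y 0 c = if w c then 0 else y 0 c by rewrite mxE.
under eq_fun do rewrite e; rewrite e; case: (w c); first exact: derive_cst.
exact: derive_coordfun.
Qed.

Lemma SUC_fixpart k c : SUC k (fun _ p => fixpart w p 0 c).
Proof.
case wc: (w c).
  by apply: SUC_congr (SUC_cst rho k 0) => i p _; rewrite mxE wc.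
by apply: SUC_congr (SUC_coord rho k c) => i p _; rewrite mxE wc.
Qed.

Lemma flowcoord_le g p : D p -> (forall a, `|g a p| <= r1 / 2) ->
  cball n r1 (flowcoord g p).
Proof.
move=> Dp gr; apply: mx_norm_leP (ltW r1_gt0) _ => i c; rewrite mxE.
rewrite (le_trans (ler_normD _ _))// [leRHS]splitr lerD//.
by rewrite (le_trans (fixpart_le _ _))// (le_trans (ltW Dp)).
Qed.

Lemma smooth_flow g (G : V -> R) : (forall a, smooth_on D (g a)) ->
  (forall a p, D p -> `|g a p| <= r1 / 2) -> smooth_on (oball n r0) G ->
  smooth_on D (fun p => G (flowcoord g p)).
Proof.
move=> sg gr sG k; apply: (Ck_on_comp (B := oball n r0) oD) => //.
  by move=> p Dp; apply: le_lt_trans r10; apply: flowcoord_le => // a; exact: gr.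
apply: smooth_row => // c k'; apply: Ck_on_add => //; last exact: sg.
exact: SUC_smooth 0%N (SUC_fixpart 0 c) k'.
Qed.

Lemma picard_inv i : (forall a, smooth_on D (h a i)) /\
  forall a p, D p -> `|h a i p| <= r1 / 2.
Proof.
elim: i => [|i [sh hr]] /=.
  split=> [a k|a p _]; first exact: Ck_on_cst.
  by rewrite normr0 divr_ge0// ltW.
have sF l a : smooth_on D (fun p => X l a (flowcoord (picard i) p)) by exact: smooth_flow.
split=> [a k|a p Dp].
  apply: Ck_on_sum => // l; apply: Ck_on_mul => //.
    exact: SUC_smooth 0%N (SUC_scalepart w rho 0 l) k.
  exact: rayint_smooth.
apply: le_trans rho2; apply: sum_scalepart_bound => // l.
apply: rayint_bound Dp _; first exact: sF.
by move=> q Dq; apply: XC; apply: flowcoord_le => // c; exact: hr.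
Qed.

Let sh a i : smooth_on D (h a i). Proof. by have [] := picard_inv i. Qed.
Let hr a i p : D p -> `|h a i p| <= r1 / 2. Proof. by have [_] := picard_inv i; exact. Qed.
Let sF (G : V -> R) i : smooth_on (oball n r0) G ->
  smooth_on D (fun p => G (flowcoord (picard i) p)).
Proof. by move=> sG; apply: smooth_flow => // a p; exact: hr. Qed.

Lemma flow_lip (g g' : 'I_n -> V -> R) (l a : 'I_n) (e : R) p : D p -> 0 <= e ->
  (forall a, `|g a p| <= r1 / 2) -> (forall a, `|g' a p| <= r1 / 2) ->
  (forall a, `|g a p - g' a p| <= e) ->
  `|X l a (flowcoord g p) - X l a (flowcoord g' p)| <= n%:R * C * e.
Proof.
move=> Dp e0 gr gr' ge.
have rB : cball n r1 `<=` oball n r0 by move=> x /= xr; exact: le_lt_trans xr r10.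
have := lipschitz_convex (@convex_cball R n r1) C0
  (fun z zr => smooth_diff (@sX l a) (rB z zr)) (fun z c zr => @DXC l a c z zr)
  (flowcoord_le Dp gr') (flowcoord_le Dp gr).
move=> /le_trans; apply; rewrite ler_wpM2l ?mulr_ge0//.
by apply: mx_norm_leP => // i c; rewrite !mxE opprD addrACA subrr add0r.
Qed.

Lemma picard_contract (g g' : 'I_n -> V -> R) (a : 'I_n) (e : R) p : 0 <= e -> D p ->
  (forall a, smooth_on D (g a)) -> (forall a, smooth_on D (g' a)) ->
  (forall a p, D p -> `|g a p| <= r1 / 2) -> (forall a p, D p -> `|g' a p| <= r1 / 2) ->
  (forall a p, D p -> `|g a p - g' a p| <= e) ->
  `|\sum_l scalepart w p 0 l * rayint w 0 (fun q => X l a (flowcoord g q)) p -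
    \sum_l scalepart w p 0 l * rayint w 0 (fun q => X l a (flowcoord g' q)) p| <= e / 2.
Proof.
move=> e0 Dp sg sg' gr gr' ge; rewrite -sumrB.
under eq_bigr do rewrite -mulrBr.
apply: (@le_trans _ _ (n%:R * rho * (n%:R * C * e))); last first.
  by rewrite mulrA mulrC ler_wpM2l.
apply: sum_scalepart_bound => //; first by rewrite !mulr_ge0.
move=> l.
have s1 : Ck_on 1 D (fun q => X l a (flowcoord g q)) by exact: smooth_flow.
have s2 : Ck_on 1 D (fun q => X l a (flowcoord g' q)) by exact: smooth_flow.
rewrite -(rayintB w 0 s1 s2 Dp); apply: rayint_bound Dp _.
  exact: (Ck_on_add oD s1 (Ck_on_opp oD s2)).
move=> q Dq; apply: flow_lip => // c; [exact: gr|exact: gr'|exact: ge].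
Qed.

Lemma picard_cauchy a : ucauchy rho (h a).
Proof.
move=> e e0.
have K0 : 0 <= r1 / 2 by rewrite divr_ge0// ltW.
have cc : forall t i j, (0 + t <= i)%N -> (0 + t <= j)%N ->
    forall c p, D p -> `|h c i p - h c j p| <= 2 * 0 + 2 * (r1 / 2) / 2 ^+ t.
  apply: (ucauchy_contract K0 (lexx _)) => [c i p|i j e' _ _ ij c p Dp]; first exact: hr.
  have e'0 : 0 <= e' by exact: le_trans (normr_ge0 _) (ij c p Dp).
  rewrite add0r; exact: (@picard_contract (picard i) (picard j) c e' p e'0 Dp
    (fun b => sh b i) (fun b => sh b j) (fun b => @hr b i) (fun b => @hr b j) ij).
have [t tK] : exists t, 2 * (r1 / 2) / 2 ^+ t <= e.
  by apply: halves_small => //; rewrite mulr_ge0.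
exists t => i j p ti tj Dp.
by rewrite (le_trans (cc t i j ti tj a p Dp))// mulr0 add0r.
Qed.

(** Differentiating the nonlinear iteration once gives a linear one whose coefficients are first
    derivatives of [X] at the iterates. By induction these coefficients converge to order [k], so
    [lin_SUC] applies. Its smallness condition only involves the bound [C] on first derivatives, so
    [rho] does not shrink as [k] grows. *)
Lemma SUC_picard k a : SUC k (h a).
Proof.
elim: k a => [|k IH] a.
  apply: SUC_base; first by move=> i; exact: sh.
  - by exists (r1 / 2) => i p; exact: hr.
  - exact: picard_cauchy.
apply: SUC_step; first by move=> i; exact: sh.
- by exists (r1 / 2) => i p; exact: hr.
- exact: picard_cauchy.
move=> j; move: a.
have Fle i p : D p -> `|flowcoord (picard i) p| <= r1.
  by move=> Dp; apply: flowcoord_le => // a; exact: hr.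
have sG (G : V -> R) : smooth_on (oball n r0) G -> SUC k (fun i p => G (flowcoord (picard i) p)).
  move=> G0; apply: (SUC_comp (F := fun c i p => fixpart w p 0 c + picard i c p) G0 r10) => //.
  by move=> c; apply: SUC_add; [exact: SUC_fixpart|exact: IH].
(* The chain rule splits the derivative of [flowcoord] into that of [fixpart], which goes into [b],
   and that of the iterate, which [A] multiplies. *)
pose b a i p := \sum_l (scalepart w (EE j) 0 l *
    rayint w 0 (fun q => X l a (flowcoord (picard i) q)) p +
  scalepart w p 0 l * rayint w (w j) (fun q => \sum_c
    'D_(EE c) (X l a) (flowcoord (picard i) q) * fixpart w (EE j) 0 c) p).
pose A l a c i q := 'D_(EE c) (X l a) (flowcoord (picard i) q).
apply: (@lin_SUC R n w rho rho0 n k A C C0 rho3 _ _ (w j) b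
  (fun a i => 'D_(EE j) (picard i a))).
- by move=> l a c i p Dp; apply: DXC; exact: Fle.
- by move=> l a c; apply: (sG ('D_(EE c) (X l a))); exact: smooth_derive.
- move=> a; apply: SUC_sum => l; apply: SUC_add; apply: SUC_mul.
  + exact: SUC_cst.
  + apply: (@SUC_rayint R n w rho k 0 (fun i q => X l a (flowcoord (picard i) q))).
    exact: sG.
  + exact: SUC_scalepart.
  + apply: (@SUC_rayint R n w rho k (w j) (fun i q => \sum_c
      'D_(EE c) (X l a) (flowcoord (picard i) q) * fixpart w (EE j) 0 c)).
    apply: SUC_sum => c; apply: SUC_mul; last exact: SUC_cst.
    by apply: (sG ('D_(EE c) (X l a))); exact: smooth_derive.
- move=> a; apply: SUC_congr (SUC_cst rho k 0) => i p _ /=.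
  by apply: esym; exact: derive_cst.
- by move=> a i; apply: smooth_derive; exact: sh.
move=> a i p Dp.
have sXF l : smooth_on D (fun q => X l a (flowcoord (picard i) q)) by exact: sF.
have ds l : differentiable (fun y : V => scalepart w y 0 l) p.
  by apply: smooth_diff Dp; exact: SUC_smooth 0%N (SUC_scalepart w rho 0 l).
have [|_ /= ->] := @derive_sumfun R n 'I_n (index_enum _) (fun l q => scalepart w q 0 l *
   rayint w 0 (fun q => X l a (flowcoord (picard i) q)) q) p (EE j).
  move=> l; apply: differentiableM => //; apply: smooth_diff Dp.
  exact: rayint_smooth.
rewrite /b /linterm -big_split /=; apply: eq_bigr => l _.
rewrite derive_mulfun//; last by apply: smooth_diff Dp; exact: rayint_smooth.
rewrite derive_scalepart -addrA; congr (_ + _).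
rewrite (derive_rayint w 0 j (sXF l 2%N) Dp) add0n -mulrDr; congr (_ * _).
have sDX c : smooth_on D (fun q => 'D_(EE c) (X l a) (flowcoord (picard i) q)).
  by apply: (sF (G := 'D_(EE c) (X l a))); exact: smooth_derive.
rewrite -(rayintD (rho := rho) w (w j) _ _ Dp); last 2 first.
- by apply: smooth_lin => // c k'; exact: Ck_on_cst.
- by apply: smooth_lin => // c; apply: smooth_derive; exact: sh.
apply: eq_rayint Dp _ => q Dq; rewrite -big_split /=.
rewrite (derive_rowcomp (F := fun c q => fixpart w q 0 c + picard i c q)); last 2 first.
- move=> c; apply: smooth_diff Dq => k'; apply: Ck_on_add => //; last exact: sh.
  exact: SUC_smooth 0%N (SUC_fixpart 0 c) k'.
- by apply: smooth_diff (@sX l a) _; exact: le_lt_trans (Fle i q Dq) r10.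
apply: eq_bigr => c _; rewrite -mulrDr; congr (_ * _).
have df : differentiable (fun y : V => fixpart w y 0 c) q.
  by apply: smooth_diff Dq; exact: SUC_smooth 0%N (SUC_fixpart 0 c).
have dh : differentiable (picard i c) q by apply: smooth_diff Dq; exact: sh.
have -> := deriveD (diff_derivable (v := EE j) df) (diff_derivable (v := EE j) dh).
by rewrite derive_fixpart.
Qed.

Lemma picard_limit : exists g : 'I_n -> V -> R, [/\ forall a, smooth_on D (g a),
  forall a p, D p -> `|g a p| <= r1 / 2 &
  forall a p, D p -> g a p =
    \sum_l scalepart w p 0 l * rayint w 0 (fun q => X l a (flowcoord g q)) p].
Proof.
have /choice[g gP] : forall a, exists g, ulim rho (h a) g.
  by move=> a; apply: ucauchy_ulim; exact: picard_cauchy.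
have sg a : smooth_on D (g a).
  by apply: (SUC_ulim_smooth (f := h a)) => // k; exact: SUC_picard.
have gr a p : D p -> `|g a p| <= r1 / 2.
  move=> Dp; apply/ler_addgt0Pr => e e0; have [N NP] := gP a e e0.
  have := NP N p (leqnn _) Dp; have := hr a N Dp.
  rewrite -{2}(subrK (h a N p) (g a p)) distrC => h1 h2.
  by rewrite (le_trans (ler_normD _ _))// addrC lerD.
exists g; split=> // a p Dp.
apply/eqP; rewrite -subr_eq0 -normr_le0; apply/ler_addgt0Pr => e e0; rewrite add0r.
have e2 : 0 < e / 2 by rewrite divr_gt0.
have [N NP] : exists N, forall a i p, (N <= i)%N -> D p -> `|h a i p - g a p| <= e / 2.
  apply: (fin_rank (B := fun a N => forall i p, (N <= i)%N -> D p -> `|h a i p - g a p| <= e / 2)).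
    by move=> b N N' hN NN i q iN; apply: hN; exact: leq_trans NN _.
  by move=> b; exact: gP.
rewrite (le_trans (ler_distD (h a N.+1 p) _ _))// [leRHS]splitr lerD//.
  by rewrite distrC; apply: NP.
have := @picard_contract (picard N) g a (e / 2) p (ltW e2) Dp.
move=> /(_ (fun b => sh b N) sg (fun b => @hr b N) gr (fun b q => NP b N q (leqnn _))).
by move=> /le_trans; apply; lra.
Qed.

End Picard.

Section RadialFlow.
Context {R : realType} {n : nat}.
Variable w : 'I_n -> bool.
Notation V := 'rV[R]_n.

(* The flow-out of the coordinate slice [fixpart p = p] along the [X_l]: it solves
   the singular equation [D_(sp p) Phi = sp p *m X(Phi)], whose integral form
   [Phi = fixpart p + sum_l p_l int_0^1 X_l(Phi(ray p t)) dt] is iterated. *)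
Theorem radial_flow (X : V -> 'M[R]_n) (r0 : R) : 0 < r0 ->
  smooth_on (oball n r0) X ->
  exists (rho : R) (Phi : V -> V), [/\ 0 < rho, smooth_on (oball n rho) Phi,
    forall p, oball n rho p -> oball n r0 (Phi p),
    forall p, oball n rho p -> 'D_(scalepart w p) Phi p = scalepart w p *m X (Phi p) &
    (forall p, oball n rho p -> Phi (fixpart w p) = fixpart w p) /\
    forall j, 'D_(EE j) Phi 0 = if w j then row j (X 0) else EE j].
Proof.
move=> r00 sX.
have oB : open (oball n r0) := @open_oball R n r0.
have sXe l a : smooth_on (oball n r0) (fun x => X x l a).
  by move=> k; have /(Ck_on_mxP _ _ oB) := sX k; exact.
pose r1 := r0 / 2.
have r10 : r1 < r0 by rewrite /r1; lra.
have r1_gt0 : 0 < r1 by rewrite /r1; lra.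
have rB : cball n r1 `<=` oball n r0 by move=> x /= xr; exact: le_lt_trans xr r10.
have [C C0 [XC DXC]] : exists2 C, 0 <= C &
   (forall l a x, cball n r1 x -> `|X x l a| <= C) /\
   (forall l a c x, cball n r1 x -> `|'D_(EE c) (fun x => X x l a) x| <= C).
  have /choice[c cP] : forall x : 'I_n * 'I_n * option 'I_n, exists C, forall y, cball n r1 y ->
     match x with (l, a, None) => `|X y l a| <= C
     | (l, a, Some b) => `|'D_(EE b) (fun x => X x l a) y| <= C end.
    move=> [[l a] [b|]].
      by have [C _ CP] := cball_bounded (smooth_derive (EE b) (sXe l a) 0%N) rB; exists C.
    by have [C _ CP] := cball_bounded (sXe l a 0%N) rB; exists C.
  have cle x : c x <= \sum_x `|c x|.
    by rewrite (le_trans (ler_norm _))// (bigD1 x)//= lerDl sumr_ge0.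
  exists (\sum_x `|c x|); first exact: sumr_ge0.
  split=> [l a x xr|l a b x xr].
    exact: le_trans (cP (l, a, None) x xr) (cle _).
  exact: le_trans (cP (l, a, Some b) x xr) (cle _).
(* [K] dominates the factors of [rho] in both smallness conditions, so [rho * K <= mm / 2] with [mm]
   the minimum of [r1] and 1 gives the invariance of the ball and the contraction at once. *)
pose K := n%:R * C + n%:R * (n%:R * C) + 1.
have nC : 0 <= n%:R * C by rewrite mulr_ge0.
have nnC : 0 <= n%:R * (n%:R * C) by rewrite mulr_ge0.
have K0 : 0 < K by rewrite /K; lra.
pose mm := Num.min r1 1.
have mm0 : 0 < mm by rewrite lt_min r1_gt0 ltr01.
pose rho := Num.min (r1 / 2) (mm / (2 * K)).
have rho_gt0 : 0 < rho.
  by rewrite lt_min divr_gt0//= divr_gt0// mulr_gt0.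
have rhoK : rho * K <= mm / 2.
  have : rho <= mm / (2 * K) by rewrite /rho ge_min lexx orbT.
  by rewrite ler_pdivlMr ?mulr_gt0// mulrCA; lra.
have rho1 : rho <= r1 / 2 by rewrite /rho ge_min lexx.
have mm1 : mm <= r1 by rewrite /mm ge_min lexx.
have mm2 : mm <= 1 by rewrite /mm ge_min lexx orbT.
have rho2 : n%:R * rho * C <= r1 / 2.
  have : n%:R * rho * C <= rho * K by rewrite /K; move: (ltW rho_gt0); nra.
  lra.
have rho3 : n%:R * rho * (n%:R * C) <= 2^-1.
  have : n%:R * rho * (n%:R * C) <= rho * K by rewrite /K; move: (ltW rho_gt0); nra.
  lra.
have [g [sg gr gE]] := picard_limit w (X := fun l a x => X x l a) sXe rho_gt0 r1_gt0 r10 C0 XC DXC rho1 rho2 rho3.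
have oD : open (oball n rho) := @open_oball R n rho.
have Phir p : oball n rho p -> oball n r0 (flowcoord w g p).
  move=> Dp; apply: rB; apply: (flowcoord_le w r1_gt0 rho1 Dp) => a; exact: gr.
have sfix c : smooth_on (oball n rho) (fun q : V => fixpart w q 0 c).
  exact: SUC_smooth 0%N (SUC_fixpart w rho 0 c).
have ssc c : smooth_on (oball n rho) (fun q : V => scalepart w q 0 c).
  exact: SUC_smooth 0%N (SUC_scalepart w rho 0 c).
have sPhi : smooth_on (oball n rho) (flowcoord w g).
  by apply: smooth_row => // c k; apply: Ck_on_add => //; [exact: sfix|exact: sg].
have sXF l a : smooth_on (oball n rho) (fun q => X (flowcoord w g q) l a).
  move=> k; exact: (Ck_on_comp (g := fun x => X x l a) oD Phir (sPhi k) (sXe l a k)).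
have dPhi p v c : oball n rho p ->
    ('D_v (flowcoord w g) p) 0 c = fixpart w v 0 c +
     \sum_l (scalepart w v 0 l * rayint w 0 (fun q => X (flowcoord w g q) l c) p +
             scalepart w p 0 l * 'D_v (rayint w 0 (fun q => X (flowcoord w g q) l c)) p).
  move=> Dp; rewrite derive_entry; last by have [+ _] := sPhi 1%N; exact.
  have sr l : smooth_on (oball n rho) (rayint w 0 (fun q => X (flowcoord w g q) l c)).
    exact: rayint_smooth.
  have [|dS DS] := @derive_sumfun R n 'I_n (index_enum _) (fun l q => scalepart w q 0 l *
     rayint w 0 (fun q => X (flowcoord w g q) l c) q) p v.
    by move=> l; apply: differentiableM; apply: smooth_diff Dp.
  rewrite (derive_congr (g := fun q => fixpart w q 0 c +
     \sum_l scalepart w q 0 l * rayint w 0 (fun q => X (flowcoord w g q) l c) q) _ oD _ Dp); last first.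
    by move=> q Dq; rewrite mxE gE.
  have df : differentiable (fun y : V => fixpart w y 0 c) p by apply: smooth_diff Dp.
  have -> := deriveD (diff_derivable (v := v) df) (diff_derivable (v := v) dS).
  rewrite derive_fixpart DS; congr (_ + _); apply: eq_bigr => l _.
  rewrite derive_mulfun; [|exact: smooth_diff Dp|exact: smooth_diff Dp].
  by rewrite derive_scalepart.
have sp0 (l : 'I_n) : scalepart w 0 0 l = 0 :> R by rewrite !mxE; case: (w l).
exists rho, (flowcoord w g); split=> //; last split.
- move=> p Dp; apply/rowP => c; rewrite dPhi// [RHS]mxE.
  have -> : fixpart w (scalepart w p) 0 c = 0 by rewrite !mxE; case: (w c).
  rewrite add0r; apply: eq_bigr => l _.
  rewrite [scalepart w (scalepart w p) 0 l](_ : _ = scalepart w p 0 l); last first.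
    by rewrite !mxE; case: (w l).
  rewrite -mulrDr; congr (_ * _).
  (* With weight 0 the Euler identity says that the average plus its radial derivative is the
     integrand [X (Phi p)], which is the required equation. *)
  have := rayint_euler w 0 (sXF l c 2%N) Dp.
  by rewrite mul1r addrC.
- move=> p Dp; apply/rowP => c; rewrite mxE gE; last first.
    have -> : fixpart w p = ray w p 0 by rewrite /ray scale0r addr0.
    by apply: ray_oball; rewrite // lexx ler01.
  rewrite big1 ?addr0 => [|l _]; first by rewrite !mxE; case: (w c).
  by rewrite !mxE; case: (w l); rewrite mul0r.
move=> j; apply/rowP => c.
have D0 : oball n rho 0 by rewrite /oball /= normr0.
rewrite dPhi//.
(* At the origin the derivatives of the averages are multiplied by 0, and the averages themselves
   reduce to [X 0], because the ray through 0 is constant and [Phi] fixes 0. *)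
have -> : \sum_l (scalepart w (EE j) 0 l * rayint w 0 (fun q => X (flowcoord w g q) l c) 0 +
   scalepart w 0 0 l * 'D_(EE j) (rayint w 0 (fun q => X (flowcoord w g q) l c)) 0) =
   \sum_l scalepart w (EE j) 0 l * X 0 l c.
  apply: eq_bigr => l _; rewrite sp0 mul0r addr0; congr (_ * _).
  rewrite -[RHS](avg_cst (X 0 l c)); apply: eq_avg => t _.
  rewrite expr0 mul1r; congr (X _ l c); apply/rowP => d.
  have -> : ray w 0 t = 0 by apply/rowP => e; rewrite rayE !mxE mulr0.
  rewrite mxE gE// big1 ?addr0 => [|l' _]; last by rewrite sp0 mul0r.
  by rewrite !mxE; case: (w d).
case wj: (w j).
  rewrite (bigD1 j)//= big1 ?addr0 => [|l lj]; last first.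
    by rewrite !mxE eqxx (negbTE lj) /=; case: (w l); rewrite mul0r.
  rewrite !mxE wj !eqxx mul1r; case wc: (w c); rewrite ?add0r//.
  case: eqVneq => [cj|_]; last by rewrite add0r.
  by rewrite cj wj in wc.
rewrite big1 => [|l _]; last first.
  rewrite !mxE eqxx /=; case: eqVneq => [->|_]; first by rewrite wj mul0r.
  by case: (w l); rewrite mul0r.
rewrite addr0 !mxE eqxx /=; case: eqVneq => [->|_]; first by rewrite wj.
by case: (w c).
Qed.

End RadialFlow.

(** * The Courant torsion *)

Section MatrixDerivative.
Context {R : realType} {V : normedModType R}.

Lemma differentiable_mulmx m n p (F : V -> 'M[R]_(m, n)) (G : V -> 'M[R]_(n, p)) x :
  differentiable F x -> differentiable G x -> differentiable (fun y => F y *m G y) x.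
Proof.
move=> /differentiable_mxP dF /differentiable_mxP dG; apply/differentiable_mxP => i j.
under eq_fun do rewrite mxE.
rewrite (_ : (fun y => _) = \sum_l (fun y => F y i l * G y l j)); last first.
  by apply/funext => y; rewrite fct_sumE.
by apply: differentiable_sum => l; exact: differentiableM.
Qed.

Lemma derive_mulmx m n p (F : V -> 'M[R]_(m, n)) (G : V -> 'M[R]_(n, p)) x v :
  differentiable F x -> differentiable G x ->
  'D_v (fun y => F y *m G y) x = 'D_v F x *m G x + F x *m 'D_v G x.
Proof.
move=> dF dG; apply/matrixP => i j.
rewrite (derive_entry v i j (differentiable_mulmx dF dG)) !mxE -big_split /=.
under eq_fun do rewrite mxE.
have dFe l : differentiable (fun y => F y i l) x by move/differentiable_mxP: dF; exact.
have dGe l : differentiable (fun y => G y l j) x by move/differentiable_mxP: dG; exact.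
rewrite (_ : (fun y => _) = \sum_l (fun y => F y i l * G y l j)); last first.
  by apply/funext => y; rewrite fct_sumE.
rewrite derive_sum => [|l]; last exact/diff_derivable/differentiableM.
apply: eq_bigr => l _; rewrite (derive_entry v i l dF) (derive_entry v l j dG).
have -> := deriveM (diff_derivable (v := v) (dFe l)) (diff_derivable (v := v) (dGe l)).
by rewrite -![_ *: _]/(_ * _) addrC (mulrC (G x l j)).
Qed.

Lemma differentiable_trmx m n (F : V -> 'M[R]_(m, n)) x :
  differentiable F x -> differentiable (fun y => (F y)^T) x.
Proof.
move=> /differentiable_mxP dF; apply/differentiable_mxP => i j.
by under eq_fun do rewrite mxE.
Qed.

Lemma derive_trmx m n (F : V -> 'M[R]_(m, n)) x v :
  differentiable F x -> 'D_v (fun y => (F y)^T) x = ('D_v F x)^T.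
Proof.
move=> dF; apply/matrixP => i j; rewrite mxE.
rewrite (derive_entry v i j (differentiable_trmx dF)) (derive_entry v j i dF).
by under eq_fun do rewrite mxE.
Qed.

Lemma deriveD_fun (W : normedModType R) (F G : V -> W) x v :
  differentiable F x -> differentiable G x ->
  'D_v (fun y => F y + G y) x = 'D_v F x + 'D_v G x.
Proof.
move=> dF dG.
exact: (deriveD (diff_derivable (v := v) dF) (diff_derivable (v := v) dG)).
Qed.

Lemma deriveB_fun (W : normedModType R) (F G : V -> W) x v :
  differentiable F x -> differentiable G x ->
  'D_v (fun y => F y - G y) x = 'D_v F x - 'D_v G x.
Proof.
move=> dF dG.
exact: (deriveB (diff_derivable (v := v) dF) (diff_derivable (v := v) dG)).
Qed.

End MatrixDerivative.

Section Torsion.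
Context {R : realType}.

Definition dot n (u v : 'rV[R]_n) : R := (u *m v^T) 0 0.

Lemma dotC n (u v : 'rV[R]_n) : dot u v = dot v u.
Proof. by rewrite /dot -[in LHS](trmxK (u *m v^T)) mxE trmx_mul trmxK. Qed.
Lemma dotDl n (u v w : 'rV[R]_n) : dot (u + v) w = dot u w + dot v w.
Proof. by rewrite /dot mulmxDl mxE. Qed.
Lemma dotDr n (u v w : 'rV[R]_n) : dot u (v + w) = dot u v + dot u w.
Proof. by rewrite dotC dotDl !(dotC u). Qed.
Lemma dotNl n (u w : 'rV[R]_n) : dot (- u) w = - dot u w.
Proof. by rewrite /dot mulNmx mxE. Qed.
Lemma dotNr n (u w : 'rV[R]_n) : dot u (- w) = - dot u w.
Proof. by rewrite dotC dotNl dotC. Qed.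
Lemma dotBl n (u v w : 'rV[R]_n) : dot (u - v) w = dot u w - dot v w.
Proof. by rewrite dotDl dotNl. Qed.
Lemma dotBr n (u v w : 'rV[R]_n) : dot u (v - w) = dot u v - dot u w.
Proof. by rewrite dotDr dotNr. Qed.
Lemma dot_mulmx m n (u : 'rV[R]_m) (A : 'M[R]_(m, n)) (v : 'rV[R]_n) :
  dot (u *m A) v = dot u (v *m A^T).
Proof. by rewrite /dot trmx_mul trmxK mulmxA. Qed.
Lemma dot_mulmxT m n (u : 'rV[R]_m) (A : 'M[R]_(n, m)) (v : 'rV[R]_n) :
  dot (u *m A^T) v = dot u (v *m A).
Proof. by rewrite dot_mulmx trmxK. Qed.
Lemma dot0l n (u : 'rV[R]_n) : dot 0 u = 0.
Proof. by rewrite /dot mul0mx mxE. Qed.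
Lemma dot0r n (u : 'rV[R]_n) : dot u 0 = 0.
Proof. by rewrite dotC dot0l. Qed.

Lemma skew_dot n (W : 'M[R]_n) (u v : 'rV[R]_n) : W^T = - W ->
  dot (u *m W) v = - dot (v *m W) u.
Proof. by move=> WT; rewrite dot_mulmx WT mulmxN dotNr dotC. Qed.

Lemma isotropic_lmul n r p q (X a : 'M[R]_(r, n)) (C : 'M[R]_(p, r))
    (D : 'M[R]_(q, r)) : X *m a^T + a *m X^T = 0 ->
  (C *m X) *m (D *m a)^T + (C *m a) *m (D *m X)^T = 0.
Proof.
move=> iso; rewrite !trmx_mul !mulmxA -mulmxDl -!(mulmxA C) -mulmxDr iso.
by rewrite mulmx0 mul0mx.
Qed.

Lemma isotropic_dot n r (X a : 'M[R]_(r, n)) (c d : 'rV[R]_r) :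
  X *m a^T + a *m X^T = 0 -> dot (c *m X) (d *m a) + dot (c *m a) (d *m X) = 0.
Proof.
move=> /(congr1 (fun M => (c *m M *m d^T) 0 0)).
rewrite mulmx0 mul0mx [RHS]mxE => <-.
by rewrite mulmxDr mulmxDl [RHS]mxE /dot !trmx_mul !mulmxA.
Qed.

Lemma isotropic_dot_diag n r (X a : 'M[R]_(r, n)) (c : 'rV[R]_r) :
  X *m a^T + a *m X^T = 0 -> dot (c *m a) (c *m X) = 0.
Proof.
move=> /(isotropic_dot c c); rewrite (dotC (c *m X)) -mulr2n => /eqP.
by rewrite mulrn_eq0 => /eqP.
Qed.

(** [H1], [H2], [H3] stand for the derivatives of the Jacobian along [x1], [x2], [x3]. Symmetry of
    second derivatives makes all their contributions cancel. *)
Lemma natural_algebra n (J H1 H2 H3 : 'M[R]_n)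
    (x1 x2 x3 y1 y2 y3 a2 a3 b1 b2 b3 d12 d21 d31 e12 e21 e31 : 'rV[R]_n)
    (D E : 'rV[R]_n -> 'rV[R]_n) (D' E' : 'rV[R]_n -> 'rV[R]_n) :
  d12 *m J = D (x1 *m J) - x2 *m H1 -> d21 *m J = D' (x2 *m J) - x1 *m H2 ->
  d31 *m J = D' (x3 *m J) - x1 *m H3 ->
  e12 = E (x1 *m J) *m J^T + b2 *m H1^T -> e21 = E' (x2 *m J) *m J^T + b1 *m H2^T ->
  e31 = E' (x3 *m J) *m J^T + b1 *m H3^T ->
  x2 *m H1 = x1 *m H2 -> x3 *m H1 = x1 *m H3 -> x3 *m H2 = x2 *m H3 ->
  a2 = b2 *m J^T -> a3 = b3 *m J^T ->
  x1 *m J = y1 -> x2 *m J = y2 -> x3 *m J = y3 ->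
  dot (d12 - d21) a3 + dot e12 x3 + dot a2 d31 - dot e21 x3 + dot x2 e31 =
  dot (D y1 - D' y2) b3 + dot (E y1) y3 + dot b2 (D' y3) - dot (E' y2) y3 + dot y2 (E' y3).
Proof.
move=> d1 d2 d3 -> -> -> s12 s13 s23 -> -> <- <- <-.
rewrite -dot_mulmx mulmxBl d1 d2 s12 opprB addrA subrK.
rewrite dot_mulmxT d3 (dotC x2) !dotBr !dotDl !dot_mulmxT s13 s23.
rewrite (dotC (x2 *m J)).
lra.
Qed.

(** [W1], [W2], [W3] are the derivatives of the two-form [w] along [x1], [x2], [x3]. Skewness
    cancels the terms in [w], and what remains is, up to sign, the exterior derivative evaluated on
    the three vectors. *)
Lemma gauge_algebra n (w W1 W2 W3 : 'M[R]_n)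
    (x1 x2 x3 a2 a3 b2 b3 d12 d21 d31 e12 e21 e31 f12 f21 f31 : 'rV[R]_n) :
  f12 = e12 - (d12 *m w + x2 *m W1) -> f21 = e21 - (d21 *m w + x1 *m W2) ->
  f31 = e31 - (d31 *m w + x1 *m W3) -> b2 = a2 - x2 *m w -> b3 = a3 - x3 *m w ->
  (forall u v, dot (u *m w) v = - dot (v *m w) u) ->
  (forall u v, dot (u *m W2) v = - dot (v *m W2) u) ->
  dot (x1 *m W3) x2 + dot (x2 *m W1) x3 + dot (x3 *m W2) x1 = 0 ->
  dot (d12 - d21) b3 + dot f12 x3 + dot b2 d31 - dot f21 x3 + dot x2 f31 =
  dot (d12 - d21) a3 + dot e12 x3 + dot a2 d31 - dot e21 x3 + dot x2 e31.
Proof.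
move=> -> -> -> -> -> skw skW cl.
rewrite !dotBr !dotBl !dotDl !dotDr.
rewrite (dotC x2 (d31 *m w)) (dotC x2 (x1 *m W3)).
rewrite (skw d12) (skw d21) (skw d31) (dotC d12 (x3 *m w)) (dotC d21 (x3 *m w)).
have := skW x3 x1; lra.
Qed.

Lemma linear_algebra n r (X a : 'M[R]_(r, n)) (c2 c3 u12 u21 u31 : 'rV[R]_r)
    (d12 d21 d31 e12 e21 e31 d12' d21' d31' e12' e21' e31' : 'rV[R]_n) :
  (forall u v : 'rV[R]_r, dot (u *m X) (v *m a) + dot (u *m a) (v *m X) = 0) ->
  d12 = u12 *m X + d12' -> d21 = u21 *m X + d21' -> d31 = u31 *m X + d31' ->
  e12 = u12 *m a + e12' -> e21 = u21 *m a + e21' -> e31 = u31 *m a + e31' ->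
  dot (d12 - d21) (c3 *m a) + dot e12 (c3 *m X) + dot (c2 *m a) d31
    - dot e21 (c3 *m X) + dot (c2 *m X) e31 =
  dot (d12' - d21') (c3 *m a) + dot e12' (c3 *m X) + dot (c2 *m a) d31'
    - dot e21' (c3 *m X) + dot (c2 *m X) e31'.
Proof.
move=> iso -> -> -> -> -> ->; rewrite !dotBl !dotDl !dotDr.
have := iso u12 c3; have := iso u21 c3; have := iso c2 u31; lra.
Qed.

Section OneDimension.
Variable n : nat.
Notation V := 'rV[R]_n.

(* Twice the pairing of the Dorfman bracket of the first two sections with the
   third one; on sections of an isotropic subbundle it is C^oo-trilinear. *)
Definition tor (X1 a1 X2 a2 X3 a3 : V -> V) (x : V) : R :=
  dot ('D_(X1 x) X2 x - 'D_(X2 x) X1 x) (a3 x)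
  + dot ('D_(X1 x) a2 x) (X3 x) + dot (a2 x) ('D_(X3 x) X1 x)
  - dot ('D_(X2 x) a1 x) (X3 x) + dot (X2 x) ('D_(X3 x) a1 x).

Lemma jacobian_mul m (f : V -> 'rV[R]_m) x v : differentiable f x ->
  v *m jacobian f x = 'D_v f x.
Proof. by move=> df; rewrite deriveEjacobian. Qed.

Lemma jacobian_entry m (f : V -> 'rV[R]_m) x i j : differentiable f x ->
  jacobian f x i j = 'D_(EE i) (fun y => f y 0 j) x.
Proof.
move=> df; rewrite -(derive_entry (EE i) 0 j df) -jacobian_mul//.
by rewrite -rowE [RHS]mxE.
Qed.

Lemma Ck_on_jacobian m k (A : set V) (f : V -> 'rV[R]_m) : open A ->
  Ck_on k.+1 A f -> Ck_on k A (jacobian f).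
Proof.
move=> oA [df Df]; apply/Ck_on_mxP => // i j.
have := (Ck_on_mxP k ('D_(EE i) f) oA).1 (Df (EE i)) 0 j.
apply: Ck_on_congr => // x Ax.
by rewrite jacobian_entry ?derive_entry//; exact: df.
Qed.

Lemma Ck_diff (W : normedModType R) k (A : set V) (f : V -> W) x :
  Ck_on k.+1 A f -> A x -> differentiable f x.
Proof. by case=> + _; exact. Qed.

Lemma jacobian_sym m (A : set V) (f : V -> 'rV[R]_m) x u v : open A ->
  Ck_on 2 A f -> A x -> u *m 'D_v (jacobian f) x = v *m 'D_u (jacobian f) x.
Proof.
move=> oA sf Ax; apply/rowP => j.
have dJ : differentiable (jacobian f) x by exact: (Ck_diff (Ck_on_jacobian oA sf) Ax).
have [df Df] := sf.
have E (a b : V) : (a *m 'D_b (jacobian f) x) 0 j = 'D_b ('D_a (fun y => f y 0 j)) x.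
  have dc := @differentiable_cst R V _ a x.
  have dm := differentiable_mulmx dc dJ.
  have := derive_mulmx b dc dJ; rewrite derive_cst mul0mx add0r => <-.
  rewrite (derive_entry b 0 j dm); apply: derive_congr oA _ Ax => y Ay.
  by rewrite jacobian_mul ?derive_entry//; exact: df.
have sfj : Ck_on 2 A (fun y => f y 0 j) by have /(Ck_on_mxP _ _ oA) := sf; exact.
exact: (etrans (E u v) (etrans (schwarz u v oA sfj Ax) (esym (E v u)))).
Qed.

Lemma tor_natural (A : set V) (kap : V -> V) (X1 a1 X2 a2 X3 a3 Y1 b1 Y2 b2 Y3 b3 : V -> V) x :
  open A -> A x -> Ck_on 2 A kap ->
  differentiable X1 x -> differentiable a1 x -> differentiable X2 x -> differentiable a2 x ->
  differentiable Y1 (kap x) -> differentiable b1 (kap x) ->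
  differentiable Y2 (kap x) -> differentiable b2 (kap x) ->
  (forall y, A y -> X1 y *m jacobian kap y = Y1 (kap y)) ->
  (forall y, A y -> a1 y = b1 (kap y) *m (jacobian kap y)^T) ->
  (forall y, A y -> X2 y *m jacobian kap y = Y2 (kap y)) ->
  (forall y, A y -> a2 y = b2 (kap y) *m (jacobian kap y)^T) ->
  X3 x *m jacobian kap x = Y3 (kap x) ->
  a3 x = b3 (kap x) *m (jacobian kap x)^T ->
  tor X1 a1 X2 a2 X3 a3 x = tor Y1 b1 Y2 b2 Y3 b3 (kap x).
Proof.
move=> oA Ax sk dX1 da1 dX2 da2 dY1 db1 dY2 db2 XY1 ab1 XY2 ab2 XY3 ab3.
have dk : differentiable kap x by exact: (Ck_diff sk Ax).
have dJ : differentiable (jacobian kap) x by exact: (Ck_diff (Ck_on_jacobian oA sk) Ax).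
have sym u v := jacobian_sym u v oA sk Ax.
have DX (X Y : V -> V) v : differentiable X x -> differentiable Y (kap x) ->
    (forall y, A y -> X y *m jacobian kap y = Y (kap y)) ->
    'D_v X x *m jacobian kap x =
      'D_(v *m jacobian kap x) Y (kap x) - X x *m 'D_v (jacobian kap) x.
  move=> dX dY XY; rewrite (jacobian_mul v dk) -(derive_comp v dk dY).
  rewrite -(derive_congr v (f := fun y => X y *m jacobian kap y) oA XY Ax).
  by rewrite (derive_mulmx v dX dJ) addrK.
have Da (a b : V -> V) v : differentiable b (kap x) ->
    (forall y, A y -> a y = b (kap y) *m (jacobian kap y)^T) ->
    'D_v a x = 'D_(v *m jacobian kap x) b (kap x) *m (jacobian kap x)^T +
       b (kap x) *m ('D_v (jacobian kap) x)^T.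
  move=> db ab; rewrite (derive_congr v oA ab Ax).
  have dbk : differentiable (b \o kap) x by exact: differentiable_comp.
  rewrite (derive_mulmx v (F := b \o kap) dbk (differentiable_trmx dJ)).
  by rewrite (derive_comp v dk db) (jacobian_mul v dk) derive_trmx.
exact: (natural_algebra (DX _ _ (X1 x) dX2 dY2 XY2) (DX _ _ (X2 x) dX1 dY1 XY1)
  (DX _ _ (X3 x) dX1 dY1 XY1) (Da _ _ (X1 x) db2 ab2) (Da _ _ (X2 x) db1 ab1)
  (Da _ _ (X3 x) db1 ab1) (sym (X2 x) (X1 x)) (sym (X3 x) (X1 x)) (sym (X3 x) (X2 x))
  (ab2 x Ax) ab3 (XY1 x Ax) (XY2 x Ax) XY3).
Qed.

Lemma tor_gauge (A : set V) (om : V -> 'M[R]_n) (X1 a1 X2 a2 X3 a3 b1 b2 b3 : V -> V) x :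
  open A -> A x -> (forall y, A y -> differentiable om y) ->
  (forall y, A y -> (om y)^T = - om y) ->
  (forall u v z, dot (u *m 'D_z om x) v + dot (v *m 'D_u om x) z + dot (z *m 'D_v om x) u = 0) ->
  differentiable X1 x -> differentiable a1 x -> differentiable X2 x -> differentiable a2 x ->
  (forall y, A y -> b1 y = a1 y - X1 y *m om y) ->
  (forall y, A y -> b2 y = a2 y - X2 y *m om y) ->
  b3 x = a3 x - X3 x *m om x ->
  tor X1 b1 X2 b2 X3 b3 x = tor X1 a1 X2 a2 X3 a3 x.
Proof.
move=> oA Ax dom som cl dX1 da1 dX2 da2 e1 e2 e3.
have Db (X a b : V -> V) v : differentiable X x -> differentiable a x ->
    (forall y, A y -> b y = a y - X y *m om y) ->
    'D_v b x = 'D_v a x - ('D_v X x *m om x + X x *m 'D_v om x).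
  move=> dX da ba; rewrite (derive_congr v oA ba Ax).
  have dm := differentiable_mulmx dX (dom x Ax).
  by rewrite (deriveB_fun v da dm) (derive_mulmx v dX (dom x Ax)).
have sk y u v : A y -> dot (u *m om y) v = - dot (v *m om y) u.
  by move=> Ay; apply: skew_dot; exact: som.
have skD w u v : dot (u *m 'D_w om x) v = - dot (v *m 'D_w om x) u.
  have dT : ('D_w om x)^T = - 'D_w om x.
    apply/eqP; rewrite -addr_eq0; apply/eqP.
    rewrite -(derive_trmx w (dom x Ax)) addrC -(deriveD_fun w (dom x Ax)); last first.
      exact/differentiable_trmx/dom.
    rewrite (derive_congr w (g := cst 0) oA _ Ax) ?derive_cst// => y Ay.
    by rewrite som// subrr.
  exact: skew_dot.
exact: (gauge_algebra (Db _ _ _ (X1 x) dX2 da2 e2) (Db _ _ _ (X2 x) dX1 da1 e1)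
  (Db _ _ _ (X3 x) dX1 da1 e1) (e2 x Ax) e3 (fun u v => sk x u v Ax)
  (skD (X2 x)) (cl (X1 x) (X2 x) (X3 x))).
Qed.

(** The derivatives of the coefficients only contribute pairings between rows of the frame, and
    isotropy makes those vanish. Hence identities known for constant combinations extend to variable
    ones. *)
Lemma tor_linear r (X a : V -> 'M[R]_(r, n)) (c1 c2 c3 : V -> 'rV[R]_r) x :
  differentiable X x -> differentiable a x ->
  differentiable c1 x -> differentiable c2 x ->
  X x *m (a x)^T + a x *m (X x)^T = 0 ->
  tor (fun y => c1 y *m X y) (fun y => c1 y *m a y)
      (fun y => c2 y *m X y) (fun y => c2 y *m a y)
      (fun y => c3 y *m X y) (fun y => c3 y *m a y) x =
  tor (fun y => c1 x *m X y) (fun y => c1 x *m a y)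
      (fun y => c2 x *m X y) (fun y => c2 x *m a y)
      (fun y => c3 x *m X y) (fun y => c3 x *m a y) x.
Proof.
move=> dX da dc1 dc2 iso.
have Dc (c : V -> 'rV[R]_r) (F : V -> 'M[R]_(r, n)) v :
    differentiable c x -> differentiable F x ->
    'D_v (fun y => c y *m F y) x =
      'D_v c x *m F x + 'D_v (fun y => c x *m F y) x.
  move=> dc dF; rewrite (derive_mulmx v dc dF).
  by rewrite (derive_mulmx v (differentiable_cst (c x) x) dF) derive_cst mul0mx add0r.
have isoP (u v : 'rV[R]_r) := isotropic_dot u v iso.
exact: (linear_algebra (c2 x) (c3 x) isoP (Dc _ _ (c1 x *m X x) dc2 dX) (Dc _ _ (c2 x *m X x) dc1 dX)
  (Dc _ _ (c3 x *m X x) dc1 dX) (Dc _ _ (c1 x *m X x) dc2 da) (Dc _ _ (c2 x *m X x) dc1 da)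
  (Dc _ _ (c3 x *m X x) dc1 da)).
Qed.
End OneDimension.

End Torsion.

(** * The local normal form *)

Section RadialPrimitive.
Context {R : realType} {n : nat}.
Variables (w : 'I_n -> bool) (rho : R).
Hypothesis rho_gt0 : 0 < rho.
Notation V := 'rV[R]_n.
Notation D := (oball n rho).
Notation sp := (scalepart w).
Let oD : open D := @open_oball R n rho.
Let D0 : D 0. Proof. by rewrite /oball /= normr0. Qed.

Lemma scalepartK (p : V) : sp (sp p) = sp p.
Proof. by apply/rowP => j; rewrite !mxE; case: (w j). Qed.

Lemma scalepart_fixpart (p : V) : sp (fixpart w p) = 0.
Proof. by apply/rowP => j; rewrite !mxE; case: (w j). Qed.

Lemma scalepart0 : sp (0 : V) = 0.
Proof. by apply/rowP => j; rewrite !mxE; case: (w j). Qed.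

Lemma scalepart_delta j : sp (EE j : V) = (w j)%:R *: EE j.
Proof.
apply/rowP => i; rewrite !mxE eqxx /=; case: (eqVneq i j) => [->|ij].
  by case: (w j); rewrite /= ?mul1r ?mul0r.
by rewrite mulr0 if_same.
Qed.

Lemma dot_sum (u v : V) : dot u v = \sum_j u 0 j * v 0 j.
Proof. by rewrite /dot mxE; apply: eq_bigr => j _; rewrite mxE. Qed.

Variable A : V -> 'M[R]_n.
Hypothesis sA : smooth_on D A.

Let sAe l j : smooth_on D (fun q => A q l j).
Proof. by move=> k; have /(Ck_on_mxP _ _ oD) := sA k; exact. Qed.

(* The radial homotopy [int_0^1 t^-1 m_t^* (sum_l p_l A_l) dt] with [m_t p = ray p t]:
   pulling back the j-th coordinate differential produces the weight [t ^+ w j]. *)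
Definition primitive1 (p : V) : V :=
  \row_j \sum_l sp p 0 l * rayint w (w j) (fun q => A q l j) p.
Notation theta := primitive1.

Let sri r l j : smooth_on D (rayint w r (fun q => A q l j)).
Proof. exact: rayint_smooth. Qed.

Let ssp l : smooth_on D (fun q : V => sp q 0 l).
Proof. exact: SUC_smooth 0%N (SUC_scalepart w rho 0 l). Qed.

Lemma smooth_primitive1 : smooth_on D theta.
Proof.
apply: smooth_row => // j k; apply: Ck_on_sum => // l.
by apply: Ck_on_mul => //; [exact: ssp|exact: sri].
Qed.

Lemma derive_primitive1 p v j : D p -> ('D_v theta p) 0 j =
  \sum_l (sp v 0 l * rayint w (w j) (fun q => A q l j) p +
          sp p 0 l * 'D_v (rayint w (w j) (fun q => A q l j)) p).
Proof.
move=> Dp; rewrite derive_entry; last by apply: Ck_diff Dp; exact: smooth_primitive1 1%N.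
rewrite (derive_congr v (g := fun q => \sum_l sp q 0 l * rayint w (w j) (fun q => A q l j) q)
  oD _ Dp); last by move=> q _; rewrite mxE.
have [|_ ->] := @derive_sumfun R n 'I_n (index_enum _) (fun l q => sp q 0 l *
   rayint w (w j) (fun q => A q l j) q) p v.
  move=> l; apply: differentiableM; [exact: smooth_diff (ssp l) Dp|].
  exact: smooth_diff (sri _ l j) Dp.
apply: eq_bigr => l _.
rewrite (derive_mulfun v (smooth_diff (ssp l) Dp) (smooth_diff (sri _ l j) Dp)).
by rewrite derive_scalepart.
Qed.

(** Read invariantly: the Lie derivative of [theta] along the Euler field, with components
    [E theta_j + w_j theta_j], is the one-form [sp p *m A p]. *)
Lemma euler_primitive1 p j : D p ->
  ('D_(sp p) theta p) 0 j = (sp p *m A p) 0 j - (w j)%:R * theta p 0 j.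
Proof.
move=> Dp; rewrite derive_primitive1// scalepartK mxE mxE mulr_sumr -sumrB.
apply: eq_bigr => l _; rewrite -mulrDr mulrCA -mulrBr; congr (_ * _).
have e := rayint_euler w (w j) (sAe l j 2%N) Dp.
by rewrite -[A p l j]e -natr1; ring.
Qed.

Hypothesis isoA : forall p, D p -> dot (sp p *m A p) (sp p) = 0.

(** By [euler_primitive1], the radial derivative of [theta] contracted with [E] is
    [dot (sp p *m A p) (sp p)], which is 0 by [isoA]. The contraction is thus constant along rays,
    and it is 0 on the slice. *)
Lemma primitive1_radial p : D p -> dot (sp p) (theta p) = 0.
Proof.
move=> Dp.
pose G q := \sum_j sp q 0 j * theta q 0 j.
have sth j : smooth_on D (fun q => theta q 0 j).
  by move=> k; have /(Ck_on_mxP _ _ oD) := smooth_primitive1 k; exact.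
have sG : smooth_on D G.
  by move=> k; apply: Ck_on_sum => // j; apply: Ck_on_mul => //; [exact: ssp|exact: sth].
have dth q : D q -> differentiable theta q.
  by move=> Dq; apply: Ck_diff Dq; exact: smooth_primitive1 1%N.
have GE : G p = 0 ^+ 0 * G (fixpart w p).
  apply: (euler_ray_cst (sG 1%N) Dp) => q Dq; rewrite mul0r addr0.
  have [|_ ->] := @derive_sumfun R n 'I_n (index_enum _) (fun j q => sp q 0 j * theta q 0 j) q (sp q).
    by move=> j; apply: differentiableM; apply: smooth_diff Dq.
  rewrite -[RHS](isoA Dq) dotC dot_sum; apply: eq_bigr => j _.
  rewrite (derive_mulfun (sp q) (smooth_diff (ssp j) Dq) (smooth_diff (sth j) Dq)).
  rewrite derive_scalepart scalepartK -(derive_entry (sp q) 0 j (dth q Dq)).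
  rewrite euler_primitive1// -mulrDr addrC.
  rewrite [sp q 0 j]mxE; case: (w j); last by rewrite !mul0r.
  by rewrite mul1r subrK.
rewrite dot_sum -/(G p) GE expr0 mul1r /G scalepart_fixpart.
by apply: big1 => j _; rewrite mxE mul0r.
Qed.

(** The matrix of the exterior derivative of [theta]: on [u] and [v] it gives the derivative along
    [u] of [theta] at [v], minus the same with [u] and [v] exchanged. *)
Definition dprimitive (p : V) : 'M[R]_n := jacobian theta p - (jacobian theta p)^T.

Lemma skew_dprimitive p : (dprimitive p)^T = - dprimitive p.
Proof. by rewrite /dprimitive linearB /= trmxK opprB. Qed.

Let sJ : smooth_on D (jacobian theta).
Proof. by move=> k; apply: Ck_on_jacobian => //; exact: smooth_primitive1. Qed.

Let dJ p : D p -> differentiable (jacobian theta) p.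
Proof. by move=> Dp; exact: Ck_diff (sJ 1%N) Dp. Qed.

Lemma smooth_dprimitive : smooth_on D dprimitive.
Proof.
by move=> k; exact: (Ck_on_add oD (sJ k) (Ck_on_opp oD (Ck_on_trmx oD (sJ k)))).
Qed.

Lemma closed_algebra (J : V -> 'M[R]_n) (u v z : V) :
  (forall a b, a *m J b = b *m J a) ->
  dot (u *m (J z - (J z)^T)) v + dot (v *m (J u - (J u)^T)) z
  + dot (z *m (J v - (J v)^T)) u = 0.
Proof.
move=> sym; rewrite !mulmxBr !dotBl !dot_mulmxT (sym u z) (sym v z) (sym u v).
rewrite (dotC u) (dotC v) (dotC z); ring.
Qed.

Lemma closed_dprimitive p u v z : D p ->
  dot (u *m 'D_z dprimitive p) v + dot (v *m 'D_u dprimitive p) z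
  + dot (z *m 'D_v dprimitive p) u = 0.
Proof.
move=> Dp.
have DE y : 'D_y dprimitive p = 'D_y (jacobian theta) p - ('D_y (jacobian theta) p)^T.
  rewrite /dprimitive (deriveB_fun y (dJ Dp) (differentiable_trmx (dJ Dp))).
  by rewrite (derive_trmx y (dJ Dp)).
rewrite (DE z) (DE u) (DE v); apply: (closed_algebra (J := fun y => 'D_y (jacobian theta) p)).
by move=> a b; exact: (jacobian_sym a b oD (smooth_primitive1 2%N) Dp).
Qed.

(** Cartan's formula: contracting the exterior derivative with [E] gives the Lie derivative of
    [theta] minus the differential of its contraction with [E], and that contraction is identically
    0. *)
Lemma contract_dprimitive p : D p -> sp p *m dprimitive p = sp p *m A p.
Proof.
move=> Dp; have dth : differentiable theta p.
  by apply: Ck_diff Dp; exact: smooth_primitive1 1%N.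
apply/rowP => j; rewrite /dprimitive mulmxBr jacobian_mul//.
rewrite mxE euler_primitive1// [X in _ + X]mxE.
have sth i : smooth_on D (fun q => theta q 0 i).
  by move=> k; have /(Ck_on_mxP _ _ oD) := smooth_primitive1 k; exact.
suff -> : (sp p *m (jacobian theta p)^T) 0 j = - ((w j)%:R * theta p 0 j).
  by rewrite opprK subrK.
have G0 : 'D_(EE j) (fun q => \sum_i sp q 0 i * theta q 0 i) p = 0.
  rewrite (derive_congr (EE j) (g := cst 0) oD _ Dp) ?derive_cst// => q Dq.
  by rewrite -dot_sum primitive1_radial.
have [|_ E] := @derive_sumfun R n 'I_n (index_enum _) (fun i q => sp q 0 i * theta q 0 i) p (EE j).
  by move=> i; apply: differentiableM; apply: smooth_diff Dp.
apply/eqP; rewrite -addr_eq0 -[X in _ == X]G0 E mxE; apply/eqP.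
have -> : (w j)%:R * theta p 0 j = \sum_i sp (EE j) 0 i * theta p 0 i.
  rewrite scalepart_delta (bigD1 j)//= big1 ?addr0 => [|i ij].
    by rewrite !mxE !eqxx mulr1.
  by rewrite !mxE eqxx (negbTE ij) mulr0 mul0r.
rewrite -big_split /=; apply: eq_bigr => i _.
rewrite (derive_mulfun (EE j) (smooth_diff (ssp i) Dp) (smooth_diff (sth i) Dp)).
by rewrite derive_scalepart [_^T i j]mxE jacobian_entry// addrC.
Qed.

Hypothesis A0 : forall i j, w i -> A 0 i j = 0.

(** Since [theta] carries a factor [sp p], its derivative at 0 only involves the rows of [A 0] with
    scaled index, which vanish by [A0]. *)
Lemma dprimitive0 : dprimitive 0 = 0.
Proof.
have dth : differentiable theta 0 by apply: Ck_diff D0; exact: smooth_primitive1 1%N.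
suff J0 : jacobian theta 0 = 0 by rewrite /dprimitive J0 trmx0 subr0.
apply/matrixP => i j.
rewrite jacobian_entry// -(derive_entry (EE i) 0 j dth) derive_primitive1// mxE.
apply: big1 => l _; rewrite scalepart0 scalepart_delta !mxE mul0r addr0.
case wi: (w i); last by rewrite !mul0r.
rewrite eqxx /=; case: (eqVneq l i) => [->|_]; last by rewrite mulr0 mul0r.
rewrite !mul1r -[RHS](avg_cst (0 : R)); apply: eq_avg => t _.
have -> : ray w 0 t = 0 by apply/rowP => e; rewrite rayE !mxE mulr0.
by rewrite A0// mulr0.
Qed.

End RadialPrimitive.

(** * Block coordinates and the rigidity of radial frames *)

Section Blocks.
Context {R : realType} {k l : nat}.
Notation V := 'rV[R]_(k + l).

Definition lblock (j : 'I_(k + l)) : bool := (j < k)%N.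

Lemma scalepart_block (p : V) : scalepart lblock p = row_mx (lsubmx p) 0.
Proof.
rewrite -[LHS]hsubmxK; congr row_mx; apply/rowP => j; rewrite !mxE /lblock /=.
  by rewrite ltn_ord.
by rewrite ltnNge leq_addr.
Qed.

Lemma fixpart_block (p : V) : fixpart lblock p = row_mx 0 (rsubmx p).
Proof.
rewrite -[LHS]hsubmxK; congr row_mx; apply/rowP => j; rewrite !mxE /lblock /=.
  by rewrite ltn_ord.
by rewrite ltnNge leq_addr.
Qed.

Lemma scalepart_mul (p : V) : scalepart lblock p = p *m block_mx 1%:M 0 0 0.
Proof.
rewrite scalepart_block -{2}(hsubmxK p) mul_row_block !mulmx0 mulmx1 addr0.
by rewrite addr0.
Qed.

Lemma dot_row (u u' : 'rV[R]_k) (v v' : 'rV[R]_l) :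
  dot (row_mx u v) (row_mx u' v') = dot u u' + dot v v'.
Proof. by rewrite /dot tr_row_mx mul_row_col mxE. Qed.

Lemma dot_matrix0 m (M : 'M[R]_m) : (forall c d, dot (c *m M) d = 0) -> M = 0.
Proof.
move=> M0; apply/matrixP => i j; have := M0 (EE i) (EE j).
by rewrite /dot -rowE trmx_delta -colE !mxE.
Qed.

(** Isotropy makes [A] and [P] skew and ties [C] to [B]; the rest is read off the blocks of the
    second equation. The eigenvalue 2 arises because the terms [- A^T] and [A] coincide. *)
Lemma block_euler_algebra (B Y1 : 'M[R]_(k, l)) (P Y2 : 'M[R]_l) (A Z1 : 'M[R]_k)
    (C Z2 : 'M[R]_(l, k)) :
  let X := block_mx 1%:M B 0 P in let a := block_mx A 0 C 1%:M in
  let Y := block_mx 0 Y1 0 Y2 in let Z := block_mx Z1 0 Z2 0 in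
  X *m a^T + a *m X^T = 0 ->
  Y *m a^T - X *m block_mx 1%:M 0 0 0 *m a^T + Z *m X^T
    + a *m (X *m block_mx 1%:M 0 0 0)^T = 0 ->
  [/\ Z1 + 2 *: A = 0, Y1 + B = 0, Y2 = 0, C = - B^T & P^T = - P].
Proof.
move=> X a Y Z; rewrite /X /a /Y /Z.
rewrite !tr_block_mx !mulmx_block !trmx0 !trmx1 ?tr_block_mx ?trmx0 ?trmx1.
rewrite !mulmx_block !(mulmx0, mul0mx, mulmx1, mul1mx, addr0, add0r, trmx0, trmx1).
rewrite opp_block_mx !add_block_mx -[X in _ = X -> _]block_mx0 => /eq_block_mx[iA iB iC iP].
rewrite -[X in _ = X -> _]block_mx0 => /eq_block_mx[eA eB _ eP].
rewrite !addr0 in iB eB eP; rewrite sub0r in eA; rewrite subr0 in eP.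
have aT : A^T = - A by apply/eqP; rewrite -addr_eq0 iA.
have cT : C^T = - B by apply/eqP; rewrite -addr_eq0 iB.
split=> //.
- by rewrite -eA aT opprK scaler_nat mulr2n addrA (addrC Z1).
- by rewrite -eB cT opprK.
- by rewrite -[C]trmxK cT linearN.
- by apply/eqP; rewrite -addr_eq0 addrC iP.
Qed.

Lemma jacobi_algebra (z1 z2 z3 : 'rV[R]_k) (u v w b2 b3 : 'rV[R]_l) (x : R) :
  dot (row_mx z1 u - row_mx z2 v) (row_mx 0 b3) + dot (row_mx 0 b2) (row_mx z3 w) = 0 ->
  x = - dot v b3 -> dot u b3 + x + dot w b2 = 0.
Proof.
move=> + ->; rewrite (dotC w) dotBl dot_row dot_row dot_row.
by rewrite !dot0l !dot0r !add0r.
Qed.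

End Blocks.

Lemma tor_congr (R : realType) n (A : set 'rV[R]_n)
    (X1 a1 X2 a2 X3 a3 X1' a1' X2' a2' X3' a3' : 'rV[R]_n -> 'rV[R]_n) x :
  open A -> A x ->
  (forall y, A y -> X1 y = X1' y) -> (forall y, A y -> a1 y = a1' y) ->
  (forall y, A y -> X2 y = X2' y) -> (forall y, A y -> a2 y = a2' y) ->
  X3 x = X3' x -> a3 x = a3' x ->
  tor X1 a1 X2 a2 X3 a3 x = tor X1' a1' X2' a2' X3' a3' x.
Proof.
move=> oA Ax e1 f1 e2 f2 e3 f3; rewrite /tor.
rewrite (e1 x Ax) (e2 x Ax) (f2 x Ax) e3 f3.
rewrite (derive_congr (X1' x) oA e2 Ax) (derive_congr (X2' x) oA e1 Ax).
rewrite (derive_congr (X1' x) oA f2 Ax) (derive_congr (X3' x) oA e1 Ax).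
by rewrite (derive_congr (X2' x) oA f1 Ax) (derive_congr (X3' x) oA f1 Ax).
Qed.

Section RadialNormalFrame.
Context {R : realType} {k l : nat}.
Variable rho : R.
Notation V := 'rV[R]_(k + l).
Notation D := (oball (k + l) rho).
Notation sp := (scalepart (@lblock k l)).
Let oD : open D := @open_oball R (k + l) rho.
Variables X a : V -> 'M[R]_(k + l).
Hypotheses (sX : smooth_on D X) (sa : smooth_on D a).
Hypothesis X_ul : forall p, D p -> ulsubmx (X p) = 1%:M.
Hypothesis X_dl : forall p, D p -> dlsubmx (X p) = 0.
Hypothesis a_ur : forall p, D p -> ursubmx (a p) = 0.
Hypothesis a_dr : forall p, D p -> drsubmx (a p) = 1%:M.
Hypothesis iso : forall p, D p -> X p *m (a p)^T + a p *m (X p)^T = 0.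
Hypothesis tor0 : forall p (c1 c2 c3 : V), D p ->
  tor (fun y => c1 *m X y) (fun y => c1 *m a y) (fun y => c2 *m X y)
      (fun y => c2 *m a y) (fun y => c3 *m X y) (fun y => c3 *m a y) p = 0.
Hypothesis spX : forall p, D p -> sp p *m X p = sp p.
Hypothesis spa : forall p, D p -> sp p *m a p = 0.

Let dX p : D p -> differentiable X p. Proof. exact: Ck_diff (sX 1%N). Qed.
Let da p : D p -> differentiable a p. Proof. exact: Ck_diff (sa 1%N). Qed.

Lemma differentiable_scalepart (p : V) : differentiable sp p.
Proof.
rewrite (_ : sp = fun y => id y *m cst (block_mx 1%:M 0 0 0) y); last first.
  by apply/funext => y; rewrite scalepart_mul.
apply: differentiable_mulmx; last exact: differentiable_cst.
by have [] := is_diff_id p.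
Qed.

Lemma derive_scalepart_row (p v : V) : 'D_v sp p = sp v.
Proof.
apply/rowP => j; rewrite (derive_entry v 0 j (differentiable_scalepart p)).
exact: derive_scalepart.
Qed.

Lemma derive_lmul (F : V -> 'M[R]_(k + l)) (c p v : V) : differentiable F p ->
  'D_v (fun y => c *m F y) p = c *m 'D_v F p.
Proof.
move=> dF; rewrite (derive_mulmx v (differentiable_cst c p) dF).
by rewrite derive_cst mul0mx add0r.
Qed.

(** The vanishing of [tor] with the Euler section in the first slot and arbitrary constant
    combinations in the other two, rewritten as one matrix equation. *)
Lemma radial_frame_identity p : D p ->
  'D_(sp p) X p *m (a p)^T - X p *m block_mx 1%:M 0 0 0 *m (a p)^T
  + 'D_(sp p) a p *m (X p)^T + a p *m (X p *m block_mx 1%:M 0 0 0)^T = 0.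
Proof.
move=> Dp; apply: dot_matrix0 => c2 c3.
(* By [spX] and [spa] the Euler section is the combination of the rows with the variable
   coefficients [sp]; trilinearity then brings it under [tor0]. *)
have T : tor sp (cst 0) (fun y => c2 *m X y) (fun y => c2 *m a y)
      (fun y => c3 *m X y) (fun y => c3 *m a y) p = 0.
  rewrite (@tor_congr R (k + l) D _ _ _ _ _ _ (fun y => sp y *m X y) (fun y => sp y *m a y)
    (fun y => c2 *m X y) (fun y => c2 *m a y) (fun y => c3 *m X y) (fun y => c3 *m a y) p oD Dp)//.
  - rewrite (tor_linear (c1 := sp) (c2 := cst c2) (cst c3) (dX Dp) (da Dp)).
    + exact: tor0.
    + exact: differentiable_scalepart.
    + exact: differentiable_cst.
    + exact: iso.
  - by move=> y Dy; rewrite spX.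
  - by move=> y Dy; rewrite spa.
move: T; rewrite /tor !derive_cst dot0l dot0r addr0 subr0.
rewrite (derive_lmul c2 (sp p) (dX Dp)) (derive_lmul c2 (sp p) (da Dp)) !derive_scalepart_row.
rewrite !scalepart_mul => T.
rewrite mulmxDr mulmxDr mulmxBr dotDl dotDl dotBl -[RHS]T dotBl.
rewrite !trmx_mul !mulmxA !dot_mulmxT -!mulmxA.
reflexivity.
Qed.

(* [tor] vanishes with [(sp, 0)] in the first slot; in block form this says that
   the blocks are eigenfunctions of the derivative along [sp]. *)
Lemma radial_euler_blocks q : D q ->
  [/\ ulsubmx ('D_(sp q) a q) + 2 *: ulsubmx (a q) = 0,
      ursubmx ('D_(sp q) X q) + ursubmx (X q) = 0,
      drsubmx ('D_(sp q) X q) = 0,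
      dlsubmx (a q) = - (ursubmx (X q))^T &
      (drsubmx (X q))^T = - drsubmx (X q)].
Proof.
move=> Dq.
have D0 (F : V -> 'M[R]_(k + l)) (M : 'M[R]_(k + l)) i j : differentiable F q ->
    (forall y, D y -> F y i j = M i j) -> ('D_(sp q) F q) i j = 0.
  move=> dF FM; rewrite (derive_entry _ i j dF).
  by rewrite (derive_congr _ (g := cst (M i j)) oD FM Dq) derive_cst.
have YE : 'D_(sp q) X q = block_mx 0 (ursubmx ('D_(sp q) X q)) 0 (drsubmx ('D_(sp q) X q)).
  rewrite -{1}[LHS]submxK; congr block_mx; apply/matrixP => i j; rewrite !mxE.
    apply: (D0 X (block_mx 1%:M 0 0 0)) (dX Dq) _ => y Dy.
    by rewrite -[X y]submxK X_ul// !block_mxEul.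
  apply: (D0 X 0) (dX Dq) _ => y Dy.
  by rewrite -[X y]submxK X_dl// !block_mxEdl !mxE.
have ZE : 'D_(sp q) a q = block_mx (ulsubmx ('D_(sp q) a q)) 0 (dlsubmx ('D_(sp q) a q)) 0.
  rewrite -{1}[LHS]submxK; congr block_mx; apply/matrixP => i j; rewrite !mxE.
    apply: (D0 a 0) (da Dq) _ => y Dy.
    by rewrite -[a y]submxK a_ur// !block_mxEur !mxE.
  apply: (D0 a (block_mx 0 0 0 1%:M)) (da Dq) _ => y Dy.
  by rewrite -[a y]submxK a_dr// !block_mxEdr.
have XE : X q = block_mx 1%:M (ursubmx (X q)) 0 (drsubmx (X q)).
  by rewrite -{1}[X q]submxK X_ul// X_dl.
have aE : a q = block_mx (ulsubmx (a q)) 0 (dlsubmx (a q)) 1%:M.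
  by rewrite -{1}[a q]submxK a_ur// a_dr.
have I := radial_frame_identity Dq; have J := iso Dq.
rewrite {1}YE {1}ZE {1 2 3}XE {1 2 3}aE in I.
rewrite {1 2}XE {1 2}aE in J.
exact: (block_euler_algebra J I).
Qed.

(** The lower left block of [a] follows the others: isotropy makes it [- B^T], so it vanishes
    together with [B]. *)
Lemma radial_normal_form p : D p ->
  [/\ X p = block_mx 1%:M 0 0 (drsubmx (X (fixpart (@lblock k l) p))),
      a p = block_mx 0 0 0 1%:M &
      (drsubmx (X p))^T = - drsubmx (X p)].
Proof.
move=> Dp.
have sXe i j : Ck_on 1 D (fun y => X y i j) by have /(Ck_on_mxP _ _ oD) := sX 1%N; exact.
have sae i j : Ck_on 1 D (fun y => a y i j) by have /(Ck_on_mxP _ _ oD) := sa 1%N; exact.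
have [_ _ _ aC skP] := radial_euler_blocks Dp.
have A0 : ulsubmx (a p) = 0.
  apply/matrixP => i j; rewrite !mxE.
  rewrite (@euler_ray_cst R (k + l) (@lblock k l) rho 2 (fun y => a y (lshift l i) (lshift l j)) p (sae _ _) Dp) ?expr0n ?mul0r// => q Dq.
  rewrite -(derive_entry _ _ _ (da Dq)); have [/matrixP /(_ i j) + _ _ _ _] := radial_euler_blocks Dq.
  by rewrite !mxE.
have B0 : ursubmx (X p) = 0.
  apply/matrixP => i j; rewrite !mxE.
  rewrite (@euler_ray_cst R (k + l) (@lblock k l) rho 1 (fun y => X y (lshift l i) (rshift k j)) p (sXe _ _) Dp) ?expr0n ?mul0r// => q Dq.
  rewrite -(derive_entry _ _ _ (dX Dq)) mul1r; have [_ /matrixP /(_ i j) + _ _ _] := radial_euler_blocks Dq.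
  by rewrite !mxE.
have PE : drsubmx (X p) = drsubmx (X (fixpart (@lblock k l) p)).
  apply/matrixP => i j; rewrite !mxE.
  rewrite (@euler_ray_cst R (k + l) (@lblock k l) rho 0 (fun y => X y (rshift k i) (rshift k j)) p (sXe _ _) Dp) ?expr0 ?mul1r// => q Dq.
  rewrite -(derive_entry _ _ _ (dX Dq)) mul0r addr0.
  by have [_ _ /matrixP /(_ i j) + _ _] := radial_euler_blocks Dq; rewrite !mxE.
split=> //.
  by rewrite -[LHS]submxK X_ul// X_dl// B0 -PE.
by rewrite -[LHS]submxK a_ur// a_dr// A0 aC B0 trmx0 oppr0.
Qed.

Definition base_bivector (y : 'rV[R]_l) : 'M[R]_l := drsubmx (X (row_mx 0 y)).

Lemma norm_row_mx0 (y : 'rV[R]_l) : `|row_mx (0 : 'rV[R]_k) y| <= `|y|.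
Proof.
apply: mx_norm_leP => // i j; rewrite mxE; case: (fintype.split j) => [j'|j'].
  by rewrite mxE normr0.
exact: mx_entry_le.
Qed.

Lemma oball_row_mx0 (y : 'rV[R]_l) : oball l rho y -> D (row_mx 0 y).
Proof. by apply: le_lt_trans; exact: norm_row_mx0. Qed.

Lemma row_mx0_mul (y : 'rV[R]_l) : row_mx 0 y = y *m row_mx (0 : 'M[R]_(l, k)) 1%:M.
Proof. by rewrite mul_mx_row mulmx0 mulmx1. Qed.

Lemma differentiable_lmx m m' (M : 'M[R]_(m, m')) (x : 'rV[R]_m) :
  differentiable (fun y => y *m M) x.
Proof.
apply: (@differentiable_mulmx _ _ _ _ _ id (cst M)); last exact: differentiable_cst.
by have [] := is_diff_id x.
Qed.

Lemma derive_lmx m m' (M : 'M[R]_(m, m')) (x v : 'rV[R]_m) :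
  'D_v (fun y => y *m M) x = v *m M.
Proof.
have di : differentiable (id : 'rV[R]_m -> _) x by have [] := is_diff_id x.
rewrite (derive_mulmx v di (differentiable_cst M x)) derive_cst mulmx0 addr0.
by rewrite derive_id.
Qed.

Lemma smooth_lmx m m' (M : 'M[R]_(m, m')) (A : set 'rV[R]_m) : open A ->
  smooth_on A (fun y => y *m M).
Proof.
move=> oA j; apply: (@Ck_on_mulmx _ _ _ _ _ j A id (cst M)) => //; last exact: Ck_on_cst.
by apply/Ck_on_mxP => // i i'; exact: Ck_on_coord.
Qed.

Lemma smooth_base_bivector : smooth_on (oball l rho) base_bivector.
Proof.
move=> m; have ol := @open_oball R l rho.
apply/Ck_on_mxP => // i j.
have sXe : Ck_on m D (fun y => X y (rshift k i) (rshift k j)).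
  by have /(Ck_on_mxP _ _ oD) := sX m; exact.
have := Ck_on_comp (f := fun y => y *m row_mx (0 : 'M[R]_(l, k)) 1%:M) ol _ (smooth_lmx _ ol m) sXe.
have sub y : oball l rho y -> D (y *m row_mx (0 : 'M[R]_(l, k)) 1%:M).
  by rewrite -row_mx0_mul; exact: oball_row_mx0.
move=> /(_ sub); apply: Ck_on_congr => // y _.
by rewrite /base_bivector row_mx0_mul !mxE.
Qed.

Lemma derive_base_bivector (y v : 'rV[R]_l) : oball l rho y ->
  'D_v base_bivector y = drsubmx ('D_(row_mx 0 v) X (row_mx 0 y)).
Proof.
move=> Dy; have Dr := oball_row_mx0 Dy.
apply/matrixP => i j; rewrite (derive_entry v i j); last first.
  exact: Ck_diff (smooth_base_bivector 1%N) Dy.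
rewrite [RHS]mxE [RHS]mxE (derive_entry _ _ _ (dX Dr)).
pose M := row_mx (0 : 'M[R]_(l, k)) 1%:M.
have dXe : differentiable (fun q => X q (rshift k i) (rshift k j)) (y *m M).
  by rewrite -row_mx0_mul; move: (dX Dr) => /differentiable_mxP; exact.
rewrite (_ : (fun y => _) = (fun q => X q (rshift k i) (rshift k j)) \o (fun y => y *m M)); last first.
  by apply/funext => z; rewrite /base_bivector row_mx0_mul !mxE.
by rewrite (derive_comp v (differentiable_lmx M y) dXe) derive_lmx -!row_mx0_mul.
Qed.

(** On the rows with index beyond [k] the covectors are constant, so [tor] reduces to a bracket term
    and one derivative of [P]. Skewness of [P] turns these into the cyclic sum. *)
Lemma base_jacobi (y b1 b2 b3 : 'rV[R]_l) : oball l rho y ->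
  dot (b2 *m 'D_(b1 *m base_bivector y) base_bivector y) b3
  + dot (b3 *m 'D_(b2 *m base_bivector y) base_bivector y) b1
  + dot (b1 *m 'D_(b3 *m base_bivector y) base_bivector y) b2 = 0.
Proof.
move=> Dy; have Dr := oball_row_mx0 Dy.
have := tor0 (row_mx 0 b1) (row_mx 0 b2) (row_mx 0 b3) Dr.
have Xr (b : 'rV[R]_l) : row_mx 0 b *m X (row_mx 0 y) = row_mx 0 (b *m base_bivector y).
  have [XE _ _] := radial_normal_form Dr.
  rewrite XE fixpart_block row_mxKr mul_row_block.
  by rewrite !mul0mx mulmx0 !add0r.
have ar (b : 'rV[R]_l) z : D z -> row_mx 0 b *m a z = row_mx 0 b.
  move=> Dz; have [_ aE _] := radial_normal_form Dz.
  by rewrite aE mul_row_block !mulmx0 mulmx1 !add0r.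
have Da (b : 'rV[R]_l) v : 'D_v (fun z => row_mx 0 b *m a z) (row_mx 0 y) = 0.
  by rewrite (derive_congr v (g := cst (row_mx 0 b)) oD _ Dr) ?derive_cst// => z; exact: ar.
rewrite /tor !Da !Xr !ar// dot0l dot0r !addr0 subr0.
have DXr (b v : 'rV[R]_l) : 'D_(row_mx 0 v) (fun z => row_mx 0 b *m X z) (row_mx 0 y) =
    row_mx (row_mx 0 b *m lsubmx ('D_(row_mx 0 v) X (row_mx 0 y))) (b *m 'D_v base_bivector y).
  rewrite (derive_lmul _ _ (dX Dr)) derive_base_bivector//.
  rewrite -[in LHS](hsubmxK ('D_(row_mx 0 v) X (row_mx 0 y))) mul_mx_row; congr row_mx.
  rewrite -[rsubmx _]vsubmxK mul_row_col mul0mx add0r; congr (_ *m _).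
  by apply/matrixP => i j; rewrite !mxE.
rewrite (DXr b2 (b1 *m base_bivector y)) (DXr b1 (b2 *m base_bivector y)).
rewrite (DXr b1 (b3 *m base_bivector y)) => T.
have skD v u u' : dot (u *m 'D_v base_bivector y) u' = - dot (u' *m 'D_v base_bivector y) u.
  apply: skew_dot.
  have dB : differentiable base_bivector y := Ck_diff (smooth_base_bivector 1%N) Dy.
  rewrite -(derive_trmx v dB) -[RHS]scaleN1r -(deriveZ _ (diff_derivable dB)).
  apply: (derive_congr v (open_oball (r := rho)) _ Dy) => z Dz.
  have [_ _] := radial_normal_form (oball_row_mx0 Dz).
  by move=> h; apply: (etrans h); rewrite -scaleN1r.
exact: (jacobi_algebra T (skD (b2 *m base_bivector y) b3 b1)).
Qed.

End RadialNormalFrame.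

(** * Passing to smaller balls around the origin *)

Section Shrinking.
Context {R : realType}.

Lemma oball_sub n (r r' : R) : r <= r' -> oball n r `<=` oball n r'.
Proof. by move=> rr p /= pr; exact: lt_le_trans pr rr. Qed.

Lemma near0_oball n (P : 'rV[R]_n -> Prop) : (\forall p \near (0 : 'rV[R]_n), P p) ->
  exists2 r, 0 < r & forall p, oball n r p -> P p.
Proof.
move=> /nbhs_ballP[r /= r0 rP]; exists r => // p pr; apply: rP.
by rewrite -ball_normE /= sub0r normrN.
Qed.

Lemma shrink_oball n (rho : R) (P : 'rV[R]_n -> Prop) : 0 < rho ->
  (\forall p \near (0 : 'rV[R]_n), P p) ->
  exists r, [/\ 0 < r, r <= rho & forall p, oball n r p -> P p].
Proof.
move=> rho0 /near0_oball[r r0 rP]; exists (Num.min r rho); split.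
- by rewrite lt_min r0.
- by rewrite ge_min lexx orbT.
- by move=> p pr; apply: rP; apply: oball_sub pr; rewrite ge_min lexx.
Qed.

Lemma near_unitmx n (rho : R) m (F : 'rV[R]_n -> 'M[R]_m) : 0 < rho ->
  Ck_on 0 (oball n rho) F -> F 0 \in unitmx ->
  \forall p \near (0 : 'rV[R]_n), F p \in unitmx.
Proof.
move=> rho0 cF F0; have D0 : oball n rho 0 by rewrite /oball /= normr0.
have cd : {for 0, continuous (fun p => \det (F p))}.
  have : Ck_on 0 (oball n rho) (fun p => \det (F p)) := Ck_on_det (open_oball (r := rho)) cF.
  by apply; exact: mem_set.
have : \det (F 0) != 0 by rewrite -unitfE -unitmxE.
move=> d0; near=> p; rewrite unitmxE unitfE; near: p.
exact: (cvgr_neq0 _ cd d0).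
Unshelve. all: by end_near. Qed.

Lemma near_half_lipschitz n (rho : R) (F : 'rV[R]_n -> 'rV[R]_n) : 0 < rho ->
  smooth_on (oball n rho) F -> (forall j, 'D_(EE j) F 0 = EE j) ->
  exists r, [/\ 0 < r, r <= rho & forall p q, oball n r p -> oball n r q ->
    `|F p - F q - (p - q)| <= 2^-1 * `|p - q|].
Proof.
move=> rho0 sF DF; have oD := open_oball (n := n) (r := rho).
have D0 : oball n rho 0 by rewrite /oball /= normr0.
pose G i (p : 'rV[R]_n) : R := F p 0 i - p 0 i.
have sG i k : Ck_on k (oball n rho) (G i).
  apply: Ck_on_add => //; last by apply: Ck_on_opp => //; exact: Ck_on_coord.
  by have /(Ck_on_mxP _ _ oD) := sF k; exact.
(* [lipschitz_convex] loses a factor [n], and this bound on the partial derivatives of [F - id]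
   compensates for it; [n.+1] rather than [n] covers dimension 0. *)
pose C : R := (2 * n.+1%:R)^-1.
have C0 : 0 < C by rewrite invr_gt0 mulr_gt0// ltr0n.
have DG i j : 'D_(EE j) (G i) 0 = 0.
  have dF : differentiable F 0 := Ck_diff (sF 1%N) D0.
  have dFi : differentiable (fun p => F p 0 i) 0 by move: dF => /differentiable_mxP; exact.
  rewrite (deriveB_fun (F := fun p => F p 0 i) (G := fun p : 'rV[R]_n => p 0 i) (EE j) dFi).
    by rewrite -(derive_entry _ _ _ dF) DF derive_coordfun subrr.
  exact: differentiable_coord.
have nGij i j : \forall p \near (0 : 'rV[R]_n), `|'D_(EE j) (G i) p| < C.
  have cDG : {for 0, continuous ('D_(EE j) (G i))}.
    by have [_ /(_ (EE j))] := sG i 1%N; apply; exact: mem_set.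
  have := cDG; rewrite /prop_for /continuous_at DG => /cvgr0Pnorm_lt /(_ C C0).
  exact.
have nG : \forall p \near (0 : 'rV[R]_n), forall ij : 'I_n * 'I_n, `|'D_(EE ij.2) (G ij.1) p| < C.
  apply: (@filter_forall _ _ (fun (ij : 'I_n * 'I_n) p => `|'D_(EE ij.2) (G ij.1) p| < C) (nbhs (0 : 'rV[R]_n)) (nbhs_filter _)).
  by move=> ij; exact: nGij.
have [r [r0 rr rP]] := shrink_oball rho0 nG.
exists r; split=> // p q Dp Dq.
apply: mx_norm_leP => [|i j]; first by rewrite mulr_ge0.
rewrite ord1; have -> : (F p - F q - (p - q)) 0 j = G j p - G j q.
  by rewrite !mxE /G; ring.
apply: (le_trans (@lipschitz_convex R n _ (G j) C q p (convex_oball (r := r)) (ltW C0) _ _ Dq Dp)).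
- by move=> z /(oball_sub rr) Dz; exact: Ck_diff (sG j 1%N) Dz.
- by move=> z i' /rP /(_ (j, i')) /ltW.
- apply: ler_wpM2r => //.
  rewrite /C invfM mulrCA ler_piMr ?invr_ge0// ler_pdivrMr ?ltr0n// mul1r.
  by rewrite ler_nat.
Qed.

End Shrinking.

(** * Pulling back, gauging and normalising the frame *)

Section PulledBackFrame.
Context {R : realType} {n : nat}.
Variables (w : 'I_n -> bool) (rho r0 : R).
Notation V := 'rV[R]_n.
Notation D := (oball n rho).
Notation B := (oball n r0).
Notation sp := (scalepart w).
Let oD : open D := @open_oball R n rho.
Let oB : open B := @open_oball R n r0.
Variables (X a : V -> 'M[R]_n) (Phi : V -> V).
Hypotheses (rho_gt0 : 0 < rho) (sX : smooth_on B X) (sa : smooth_on B a).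
Hypothesis iso : forall p, B p -> X p *m (a p)^T + a p *m (X p)^T = 0.
Hypothesis tor0 : forall p (c1 c2 c3 : V), B p ->
  tor (fun y => c1 *m X y) (fun y => c1 *m a y) (fun y => c2 *m X y)
      (fun y => c2 *m a y) (fun y => c3 *m X y) (fun y => c3 *m a y) p = 0.
Hypotheses (sPhi : smooth_on D Phi) (PhiB : forall p, D p -> B (Phi p)).
Hypothesis radial : forall p, D p -> 'D_(sp p) Phi p = sp p *m X (Phi p).
Notation J := (jacobian Phi).
Hypothesis Junit : forall p, D p -> J p \in unitmx.

Definition pb_forms (p : V) : 'M[R]_n := a (Phi p) *m (J p)^T.
Definition pb_gauge : V -> 'M[R]_n := dprimitive w pb_forms.
Definition pb_vectors (p : V) : 'M[R]_n := X (Phi p) *m invmx (J p).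
Definition pb_covectors (p : V) : 'M[R]_n := pb_forms p - pb_vectors p *m pb_gauge p.
Notation A := pb_forms.
Notation om := pb_gauge.
Notation X' := pb_vectors.
Notation a' := pb_covectors.

Let sJ : smooth_on D J.
Proof. by move=> k; exact: Ck_on_jacobian (sPhi k.+1). Qed.

Lemma smooth_pb_forms : smooth_on D A.
Proof.
move=> k; apply: Ck_on_mulmx => //; last exact: Ck_on_trmx.
exact: (Ck_on_comp_mx oD oB PhiB (sPhi k) (sa k)).
Qed.

Lemma smooth_pb_gauge : smooth_on D om.
Proof. exact: (smooth_dprimitive w smooth_pb_forms). Qed.

Lemma smooth_pb_vectors : smooth_on D X'.
Proof.
move=> k; apply: Ck_on_mulmx => //; last exact: Ck_on_invmx.
exact: (Ck_on_comp_mx oD oB PhiB (sPhi k) (sX k)).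
Qed.

Lemma smooth_pb_covectors : smooth_on D a'.
Proof.
move=> k; apply: Ck_on_add => //; first exact: smooth_pb_forms.
apply: Ck_on_opp => //; apply: Ck_on_mulmx => //; first exact: smooth_pb_vectors.
exact: smooth_pb_gauge.
Qed.

Let spJ p : D p -> sp p *m J p = sp p *m X (Phi p).
Proof. by move=> Dp; rewrite jacobian_mul ?radial//; exact: Ck_diff (sPhi 1%N) Dp. Qed.

Lemma pb_vectorsK p : D p -> X' p *m J p = X (Phi p).
Proof. by move=> Dp; rewrite mulmxKV// Junit. Qed.

(** Since [sp p *m J p] is [sp p *m X (Phi p)], this is, up to the factor [1 / 2], the pairing with
    itself of a single combination of the isotropic rows. It supplies the hypothesis [isoA] of the
    radial homotopy. *)
Lemma pb_forms_radial p : D p -> dot (sp p *m A p) (sp p) = 0.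
Proof.
move=> Dp; rewrite mulmxA dot_mulmxT spJ//.
exact: isotropic_dot_diag (iso (PhiB Dp)).
Qed.

Lemma pb_iso p : D p -> X' p *m (a' p)^T + a' p *m (X' p)^T = 0.
Proof.
move=> Dp; have := iso (PhiB Dp); rewrite -(pb_vectorsK Dp) => I.
rewrite /pb_covectors linearB/= mulmxBr mulmxBl -[RHS]I /pb_forms !trmx_mul trmxK.
have -> : (om p)^T = - om p by exact: skew_dprimitive.
rewrite !mulNmx !mulmxN opprK !mulmxA.
by rewrite addrACA subrr addr0.
Qed.

Lemma pb_tor p (c1 c2 c3 : V) : D p ->
  tor (fun y => c1 *m X' y) (fun y => c1 *m a' y) (fun y => c2 *m X' y)
      (fun y => c2 *m a' y) (fun y => c3 *m X' y) (fun y => c3 *m a' y) p = 0.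
Proof.
move=> Dp.
have df (F : V -> 'M[R]_n) (c q : V) : smooth_on D F -> D q -> differentiable (fun y => c *m F y) q.
  move=> sF Dq; apply: (differentiable_mulmx (differentiable_cst c q)).
  exact: Ck_diff (sF 1%N) Dq.
have dg (F : V -> 'M[R]_n) (c q : V) : smooth_on B F -> B q -> differentiable (fun y => c *m F y) q.
  move=> sF Dq; apply: (differentiable_mulmx (differentiable_cst c q)).
  exact: Ck_diff (sF 1%N) Dq.
have dX c q := df X' c q smooth_pb_vectors; have dA c q := df A c q smooth_pb_forms.
have dXB c q := dg X c q sX; have daB c q := dg a c q sa.
rewrite (@tor_gauge R n D om _ (fun y => c1 *m A y) _ (fun y => c2 *m A y) _ (fun y => c3 *m A y) _ _ _ p oD Dp).
- rewrite (@tor_natural R n D Phi _ _ _ _ _ _ (fun y => c1 *m X y) (fun y => c1 *m a y)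
    (fun y => c2 *m X y) (fun y => c2 *m a y) (fun y => c3 *m X y) (fun y => c3 *m a y) p oD Dp (sPhi 2%N)).
  + exact: tor0 (PhiB Dp).
  + exact: dX.
  + exact: dA.
  + exact: dX.
  + exact: dA.
  + exact: dXB (PhiB Dp).
  + exact: daB (PhiB Dp).
  + exact: dXB (PhiB Dp).
  + exact: daB (PhiB Dp).
  + by move=> y Dy; rewrite -mulmxA pb_vectorsK.
  + by move=> y Dy; rewrite -mulmxA.
  + by move=> y Dy; rewrite -mulmxA pb_vectorsK.
  + by move=> y Dy; rewrite -mulmxA.
  + by rewrite -mulmxA pb_vectorsK.
  + by rewrite -mulmxA.
- by move=> y Dy; exact: Ck_diff (smooth_pb_gauge 1%N) Dy.
- by move=> y _; exact: skew_dprimitive.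
- by move=> u v z; apply: (closed_dprimitive w smooth_pb_forms u v z Dp).
- exact: dX.
- exact: dA.
- exact: dX.
- exact: dA.
- by move=> y _; rewrite mulmxBr (mulmxA _ (X' y)).
- by move=> y _; rewrite mulmxBr (mulmxA _ (X' y)).
- by rewrite mulmxBr (mulmxA _ (X' p)).
Qed.

Lemma pb_vectors_radial p : D p -> sp p *m X' p = sp p.
Proof. by move=> Dp; rewrite mulmxA -spJ// mulmxK// Junit. Qed.

Lemma pb_covectors_radial p : D p -> sp p *m a' p = 0.
Proof.
move=> Dp; rewrite mulmxBr (mulmxA _ (X' p)) pb_vectors_radial//.
rewrite (contract_dprimitive smooth_pb_forms pb_forms_radial Dp).
exact: subrr.
Qed.

Hypotheses (Phi0 : Phi 0 = 0) (J0 : J 0 = 1%:M).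
Hypothesis a0 : forall i j, w i -> a 0 i j = 0.

Lemma pb_forms0 : A 0 = a 0.
Proof. by rewrite /pb_forms Phi0 J0 trmx1 mulmx1. Qed.

Lemma pb_gauge0 : om 0 = 0.
Proof.
by apply: (dprimitive0 rho_gt0 smooth_pb_forms) => i j wi; rewrite pb_forms0 a0.
Qed.

Lemma pb_vectors0 : X' 0 = X 0.
Proof. by rewrite /pb_vectors Phi0 J0 invmx1 mulmx1. Qed.

Lemma pb_covectors0 : a' 0 = a 0.
Proof. by rewrite /pb_covectors pb_gauge0 mulmx0 subr0 pb_forms0. Qed.

Lemma pb_span p (v b : V) : D p ->
  (exists c, v *m J p = c *m X (Phi p) /\ b = c *m a (Phi p) *m (J p)^T) <->
  (exists c, v = c *m X' p /\ b = c *m a' p + v *m om p).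
Proof.
move=> Dp; have Jp := Junit Dp; split=> -[c [vE bE]]; exists c.
  have vc : v = c *m X' p by rewrite -[v](mulmxK Jp) vE mulmxA.
  split=> //; rewrite bE vc mulmxBr !mulmxA subrK.
  by [].
split; first by rewrite vE -mulmxA pb_vectorsK.
by rewrite bE vE mulmxBr !mulmxA subrK.
Qed.

End PulledBackFrame.

Section NormalisedFrame.
Context {R : realType} {k l : nat}.
Variable rho : R.
Notation V := 'rV[R]_(k + l).
Notation D := (oball (k + l) rho).
Notation sp := (scalepart (@lblock k l)).
Let oD : open D := @open_oball R (k + l) rho.
Variables X a : V -> 'M[R]_(k + l).
Hypotheses (sX : smooth_on D X) (sa : smooth_on D a).
Hypothesis iso : forall p, D p -> X p *m (a p)^T + a p *m (X p)^T = 0.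
Hypothesis tor0 : forall p (c1 c2 c3 : V), D p ->
  tor (fun y => c1 *m X y) (fun y => c1 *m a y) (fun y => c2 *m X y)
      (fun y => c2 *m a y) (fun y => c3 *m X y) (fun y => c3 *m a y) p = 0.
Hypothesis spX : forall p, D p -> sp p *m X p = sp p.
Hypothesis spa : forall p, D p -> sp p *m a p = 0.

(* Dividing the frame by this matrix turns the first block column of [X] and the
   last one of [a] into those of the identity. *)
Definition mixed_block (p : V) : 'M[R]_(k + l) := row_mx (lsubmx (X p)) (rsubmx (a p)).
Notation U := mixed_block.

Lemma smooth_mixed_block : smooth_on D U.
Proof.
move=> m; apply/Ck_on_mxP => // i j; rewrite /mixed_block.
have /(Ck_on_mxP _ _ oD) sXe := sX m; have /(Ck_on_mxP _ _ oD) sae := sa m.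
case: (fintype.splitP j) => j' jE.
  apply: (Ck_on_congr oD _ (sXe i (lshift l j'))) => y _.
  by rewrite (_ : j = lshift l j') ?row_mxEl ?mxE//; exact: val_inj.
apply: (Ck_on_congr oD _ (sae i (rshift k j'))) => y _.
by rewrite (_ : j = rshift k j') ?row_mxEr ?mxE//; exact: val_inj.
Qed.

Hypothesis Uunit : forall p, D p -> U p \in unitmx.

Definition normalised (F : V -> 'M[R]_(k + l)) (p : V) : 'M[R]_(k + l) := invmx (U p) *m F p.

Let sI : smooth_on D (fun p => invmx (U p)).
Proof. by move=> m; apply: Ck_on_invmx => //; exact: smooth_mixed_block. Qed.

Lemma smooth_normalised F : smooth_on D F -> smooth_on D (normalised F).
Proof. by move=> sF m; exact: Ck_on_mulmx. Qed.

Lemma normalised_blocks p : D p ->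
  [/\ ulsubmx (normalised X p) = 1%:M, dlsubmx (normalised X p) = 0,
      ursubmx (normalised a p) = 0 & drsubmx (normalised a p) = 1%:M].
Proof.
move=> Dp; have := mulVmx (Uunit Dp); rewrite {2}/mixed_block mul_mx_row.
rewrite mulmx_lsub mulmx_rsub scalar_mx_block block_mxEh => /eq_row_mx[XE aE].
rewrite -(hsubmxK (normalised X p)) -(hsubmxK (normalised a p)) XE aE.
rewrite -(vsubmxK (rsubmx (normalised X p))) -(vsubmxK (lsubmx (normalised a p))).
by rewrite -!block_mxEh block_mxKul block_mxKdl block_mxKur block_mxKdr.
Qed.

Lemma normalised_tor p (c1 c2 c3 : V) : D p ->
  tor (fun y => c1 *m normalised X y) (fun y => c1 *m normalised a y)
      (fun y => c2 *m normalised X y) (fun y => c2 *m normalised a y)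
      (fun y => c3 *m normalised X y) (fun y => c3 *m normalised a y) p = 0.
Proof.
move=> Dp.
have dI (c : V) : differentiable (fun y => c *m invmx (U y)) p.
  by apply: (differentiable_mulmx (differentiable_cst c p)); exact: Ck_diff (sI 1%N) Dp.
have dX : differentiable X p := Ck_diff (sX 1%N) Dp.
have da : differentiable a p := Ck_diff (sa 1%N) Dp.
rewrite (@tor_congr R (k + l) D _ _ _ _ _ _
  (fun y => (c1 *m invmx (U y)) *m X y) (fun y => (c1 *m invmx (U y)) *m a y)
  (fun y => (c2 *m invmx (U y)) *m X y) (fun y => (c2 *m invmx (U y)) *m a y)
  (fun y => (c3 *m invmx (U y)) *m X y) (fun y => (c3 *m invmx (U y)) *m a y) p oD Dp).
- rewrite (tor_linear (c1 := fun y => c1 *m invmx (U y)) (c2 := fun y => c2 *m invmx (U y))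
    (fun y => c3 *m invmx (U y)) dX da (dI c1) (dI c2) (iso Dp)).
  exact: tor0.
- by move=> y _; rewrite mulmxA.
- by move=> y _; rewrite mulmxA.
- by move=> y _; rewrite mulmxA.
- by move=> y _; rewrite mulmxA.
- by rewrite mulmxA.
- by rewrite mulmxA.
Qed.

Lemma normalised_iso p : D p ->
  normalised X p *m (normalised a p)^T + normalised a p *m (normalised X p)^T = 0.
Proof.
by move=> Dp; exact: isotropic_lmul (iso Dp).
Qed.

(** As the matrix fixes [sp p], so does its inverse, and the Euler section remains the combination
    of the normalised rows with the same coefficients. *)
Lemma mixed_block_radial p : D p -> sp p *m U p = sp p.
Proof.
move=> Dp; rewrite mul_mx_row mulmx_lsub mulmx_rsub spX// spa//.
by rewrite linear0 scalepart_block row_mxKl.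
Qed.

Lemma normalised_radial p : D p ->
  sp p *m normalised X p = sp p /\ sp p *m normalised a p = 0.
Proof.
move=> Dp; have spI : sp p *m invmx (U p) = sp p.
  by rewrite -{1}(mixed_block_radial Dp) mulmxK// Uunit.
by rewrite /normalised !mulmxA spI spX// spa.
Qed.

Lemma normalised_span p (v b : V) (W : 'M[R]_(k + l)) : D p ->
  (exists c, v = c *m X p /\ b = c *m a p + v *m W) <->
  (exists c, v = c *m normalised X p /\ b = c *m normalised a p + v *m W).
Proof.
move=> Dp; have Up := Uunit Dp; rewrite /normalised; split=> -[c [vE bE]].
  by exists (c *m U p); rewrite !mulmxA !mulmxK.
by exists (c *m invmx (U p)); rewrite -!mulmxA.
Qed.

Let X1 := normalised X.
Let a1 := normalised a.

Definition local_bivector : 'rV[R]_l -> 'M[R]_l := base_bivector X1.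

Let X1_ul p (Dp : D p) : ulsubmx (X1 p) = 1%:M.
Proof. by have [] := normalised_blocks Dp. Qed.
Let X1_dl p (Dp : D p) : dlsubmx (X1 p) = 0.
Proof. by have [] := normalised_blocks Dp. Qed.
Let a1_ur p (Dp : D p) : ursubmx (a1 p) = 0.
Proof. by have [] := normalised_blocks Dp. Qed.
Let a1_dr p (Dp : D p) : drsubmx (a1 p) = 1%:M.
Proof. by have [] := normalised_blocks Dp. Qed.
Let sX1 : smooth_on D X1. Proof. exact: smooth_normalised. Qed.
Let sa1 : smooth_on D a1. Proof. exact: smooth_normalised. Qed.
Let spX1 p (Dp : D p) : sp p *m X1 p = sp p.
Proof. by have [] := normalised_radial Dp. Qed.
Let spa1 p (Dp : D p) : sp p *m a1 p = 0.
Proof. by have [] := normalised_radial Dp. Qed.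

Lemma smooth_local_bivector : smooth_on (oball l rho) local_bivector.
Proof. exact: smooth_base_bivector. Qed.

Lemma skew_local_bivector y : oball l rho y -> (local_bivector y)^T = - local_bivector y.
Proof.
move=> Dy; have Dr : D (row_mx 0 y) by exact: oball_row_mx0.
by have [] := radial_normal_form sX1 sa1 X1_ul X1_dl a1_ur a1_dr normalised_iso
  normalised_tor spX1 spa1 Dr.
Qed.

Lemma jacobi_local_bivector (y b1 b2 b3 : 'rV[R]_l) : oball l rho y ->
  dot (b2 *m 'D_(b1 *m local_bivector y) local_bivector y) b3
  + dot (b3 *m 'D_(b2 *m local_bivector y) local_bivector y) b1
  + dot (b1 *m 'D_(b3 *m local_bivector y) local_bivector y) b2 = 0.
Proof.
exact: (base_jacobi sX1 sa1 X1_ul X1_dl a1_ur a1_dr normalised_iso normalised_tor spX1 spa1).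
Qed.

Lemma local_bivector_span p (v b : V) (W : 'M[R]_(k + l)) : D p ->
  (exists c, v = c *m X p /\ b = c *m a p + v *m W) <->
  (exists u d, v = row_mx u (d *m local_bivector (rsubmx p)) /\ b = row_mx 0 d + v *m W).
Proof.
move=> Dp; rewrite normalised_span//.
have [XE aE _] := radial_normal_form sX1 sa1 X1_ul X1_dl a1_ur a1_dr normalised_iso
  normalised_tor spX1 spa1 Dp.
rewrite fixpart_block -/(base_bivector X1 _) -/local_bivector /X1 in XE.
rewrite /a1 in aE; rewrite XE aE.
have cE (c : V) : c *m block_mx 1%:M 0 0 (local_bivector (rsubmx p)) =
    row_mx (lsubmx c) (rsubmx c *m local_bivector (rsubmx p)).
  by rewrite -{1}(hsubmxK c) mul_row_block !mulmx0 mulmx1 addr0 add0r.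
have dE (c : V) : c *m block_mx 0 0 0 1%:M = row_mx (0 : 'rV[R]_k) (rsubmx c).
  by rewrite -{1}(hsubmxK c) mul_row_block !mulmx0 mulmx1 !add0r.
split=> [[c [vE bE]]|[u [d [vE bE]]]].
  by exists (lsubmx c), (rsubmx c); rewrite -cE -dE.
by exists (row_mx u d); rewrite cE dE row_mxKl row_mxKr.
Qed.

End NormalisedFrame.

(** * The normal form on a ball of coordinates *)

Section LocalNormalForm.
Context {R : realType} {k l : nat}.
Variable r0 : R.
Notation V := 'rV[R]_(k + l).
Notation B := (oball (k + l) r0).
Notation w := (@lblock k l).
Notation sp := (scalepart w).
Variables (X a : V -> 'M[R]_(k + l)) (P0 : 'M[R]_l).
Hypotheses (r0_gt0 : 0 < r0) (sX : smooth_on B X) (sa : smooth_on B a).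
Hypothesis iso : forall p, B p -> X p *m (a p)^T + a p *m (X p)^T = 0.
Hypothesis tor0 : forall p (c1 c2 c3 : V), B p ->
  tor (fun y => c1 *m X y) (fun y => c1 *m a y) (fun y => c2 *m X y)
      (fun y => c2 *m a y) (fun y => c3 *m X y) (fun y => c3 *m a y) p = 0.
Hypothesis X0 : X 0 = block_mx 1%:M 0 0 P0.
Hypothesis a0 : a 0 = block_mx 0 0 0 1%:M.

Lemma adapted_coordinates : exists (rho : R) (Phi : V -> V),
  [/\ 0 < rho, smooth_on (oball (k + l) rho) Phi, Phi 0 = 0, jacobian Phi 0 = 1%:M &
  [/\ forall p, oball (k + l) rho p -> B (Phi p),
      forall p, oball (k + l) rho p -> jacobian Phi p \in unitmx,
      forall p, oball (k + l) rho p -> 'D_(sp p) Phi p = sp p *m X (Phi p) &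
      forall p q, oball (k + l) rho p -> oball (k + l) rho q ->
        `|Phi p - Phi q - (p - q)| <= 2^-1 * `|p - q|]].
Proof.
have [rho1 [Phi [rho1_gt0 sPhi PhiB radial [Phi_fix DPhi]]]] :=
  radial_flow w r0_gt0 sX.
have D0 : oball (k + l) rho1 0 by rewrite /oball /= normr0.
have dPhi : differentiable Phi 0 := Ck_diff (sPhi 1%N) D0.
(* The first [k] rows of [X 0] are coordinate vectors, so the differential at 0 is exactly the
   identity, as the half-Lipschitz estimate requires. *)
have DPhi1 j : 'D_(EE j) Phi 0 = EE j.
  rewrite DPhi; case: ifP => // jk; rewrite X0 rowE.
  have jE : j = lshift l (Ordinal jk) by exact: val_inj.
  by rewrite jE delta_mx_lshift mul_row_block !mulmx0 mulmx1 mul0mx !addr0.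
have J0 : jacobian Phi 0 = 1%:M.
  by apply/row_matrixP => j; rewrite !rowE jacobian_mul// DPhi1 mulmx1.
have cJ : Ck_on 0 (oball (k + l) rho1) (jacobian Phi).
  exact: Ck_on_jacobian (open_oball (r := rho1)) (sPhi 1%N).
have J0u : jacobian Phi 0 \in unitmx by rewrite J0 unitmx1.
have [rho2 [rho2_gt0 rho21 Junit]] := shrink_oball rho1_gt0 (near_unitmx rho1_gt0 cJ J0u).
have sPhi2 : smooth_on (oball (k + l) rho2) Phi.
  by move=> m; exact: Ck_on_sub (oball_sub rho21) (sPhi m).
have [rho [rho_gt0 rho2r lip]] := near_half_lipschitz rho2_gt0 sPhi2 DPhi1.
have sub1 : oball (k + l) rho `<=` oball (k + l) rho1 by apply: oball_sub; exact: le_trans rho21.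
have f0 : fixpart w (0 : V) = 0 by apply/rowP => j; rewrite !mxE if_same.
exists rho, Phi; split.
- exact: rho_gt0.
- by move=> m; exact: Ck_on_sub sub1 (sPhi m).
- by rewrite -[in LHS]f0 (Phi_fix 0 D0).
- exact: J0.
- split.
  + by move=> p /sub1; exact: PhiB.
  + by move=> p /(oball_sub rho2r); exact: Junit.
  + by move=> p /sub1; exact: radial.
  + exact: lip.
Qed.

Theorem local_normal_form : exists (rho : R) (Phi : V -> V) (om : V -> 'M[R]_(k + l))
    (P : 'rV[R]_l -> 'M[R]_l),
  [/\ [/\ 0 < rho, smooth_on (oball (k + l) rho) Phi & Phi 0 = 0],
  [/\ forall p, oball (k + l) rho p -> B (Phi p),
      forall p, oball (k + l) rho p -> jacobian Phi p \in unitmx &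
      forall p q, oball (k + l) rho p -> oball (k + l) rho q ->
        `|Phi p - Phi q - (p - q)| <= 2^-1 * `|p - q|],
  [/\ smooth_on (oball (k + l) rho) om, forall p, (om p)^T = - om p, om 0 = 0 &
      forall p (u v z : V), oball (k + l) rho p ->
        dot (u *m 'D_z om p) v + dot (v *m 'D_u om p) z + dot (z *m 'D_v om p) u = 0],
  [/\ smooth_on (oball l rho) P, forall y, oball l rho y -> (P y)^T = - P y &
      forall y (b1 b2 b3 : 'rV[R]_l), oball l rho y ->
        dot (b2 *m 'D_(b1 *m P y) P y) b3 + dot (b3 *m 'D_(b2 *m P y) P y) b1
        + dot (b1 *m 'D_(b3 *m P y) P y) b2 = 0] &
  forall p (v b : V), oball (k + l) rho p ->
    (exists c, v *m jacobian Phi p = c *m X (Phi p) /\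
               b = c *m a (Phi p) *m (jacobian Phi p)^T) <->
    (exists u d, v = row_mx u (d *m P (rsubmx p)) /\ b = row_mx 0 d + v *m om p)].
Proof.
have [rho1 [Phi [rho1_gt0 sPhi Phi0 J0 [PhiB Junit radial lip]]]] := adapted_coordinates.
have oD1 := open_oball (n := k + l) (r := rho1).
pose X1 := pb_vectors X Phi; pose a1 := pb_covectors w X a Phi; pose om := pb_gauge w a Phi.
have sX1 : smooth_on (oball (k + l) rho1) X1 := smooth_pb_vectors sX sPhi PhiB Junit.
have sa1 : smooth_on (oball (k + l) rho1) a1 := smooth_pb_covectors w sX sa sPhi PhiB Junit.
have a0w i j : w i -> a 0 i j = 0.
  rewrite a0 /lblock => ik; rewrite (_ : i = lshift l (Ordinal ik)); last exact: val_inj.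
  by rewrite block_mxEv col_mxEu row_mx0 mxE.
(* At the origin the Jacobian is the identity and the gauge form is 0, so the frame keeps its block
   shape there. *)
have U0 : mixed_block X1 a1 0 = 1%:M.
  rewrite /mixed_block /X1 /a1 pb_vectors0// (pb_covectors0 X rho1_gt0 sa sPhi PhiB Phi0 J0 a0w) X0 a0.
  by rewrite !block_mxEh row_mxKl row_mxKr -block_mxEh -scalar_mx_block.
have cU : Ck_on 0 (oball (k + l) rho1) (mixed_block X1 a1) := smooth_mixed_block sX1 sa1 0%N.
have U0u : mixed_block X1 a1 0 \in unitmx by rewrite U0 unitmx1.
have [rho [rho_gt0 rho1r Uunit]] := shrink_oball rho1_gt0 (near_unitmx rho1_gt0 cU U0u).
have sub1 : oball (k + l) rho `<=` oball (k + l) rho1 := oball_sub rho1r.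
have sX2 : smooth_on (oball (k + l) rho) X1 by move=> m; exact: Ck_on_sub sub1 (sX1 m).
have sa2 : smooth_on (oball (k + l) rho) a1 by move=> m; exact: Ck_on_sub sub1 (sa1 m).
have iso1 p (Dp : oball (k + l) rho p) := pb_iso w iso PhiB Junit (sub1 p Dp).
have tor1 p c1 c2 c3 (Dp : oball (k + l) rho p) :=
  pb_tor w sX sa tor0 sPhi PhiB Junit c1 c2 c3 (sub1 p Dp).
have spX1 p (Dp : oball (k + l) rho p) := pb_vectors_radial sPhi radial Junit (sub1 p Dp).
have spa1 p (Dp : oball (k + l) rho p) :=
  pb_covectors_radial sa iso sPhi PhiB radial Junit (sub1 p Dp).
have sub0 p : oball (k + l) rho p -> oball (k + l) rho1 p := sub1 p.
exists rho, Phi, om, (local_bivector X1 a1); split.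
- by split=> // m; exact: Ck_on_sub sub1 (sPhi m).
- split.
  + by move=> p /sub0; exact: PhiB.
  + by move=> p /sub0; exact: Junit.
  + by move=> p q /sub0 Dp /sub0 Dq; exact: lip.
- split.
  + by move=> m; exact: Ck_on_sub sub1 (smooth_pb_gauge w sa sPhi PhiB m).
  + by move=> p; exact: skew_dprimitive.
  + exact: (pb_gauge0 rho1_gt0 sa sPhi PhiB Phi0 J0 a0w).
  + move=> p u v z /sub0 Dp.
    exact: (closed_dprimitive w (smooth_pb_forms sa sPhi PhiB) u v z Dp).
- split.
  + exact: (smooth_local_bivector sX2 sa2 Uunit).
  + exact: (skew_local_bivector sX2 sa2 iso1 tor1 spX1 spa1 Uunit).
  + exact: (jacobi_local_bivector sX2 sa2 iso1 tor1 spX1 spa1 Uunit).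
- move=> p v b Dp; rewrite (pb_span w X a Junit v b (sub0 p Dp)).
  exact: (local_bivector_span sX2 sa2 iso1 tor1 spX1 spa1 Uunit v b (om p) Dp).
Qed.

End LocalNormalForm.

(** * Charts and manifolds *)

Section BallManifold.
Context {R : realType} {n : nat}.
Notation V := 'rV[R]_n.

Lemma second_countable_rowvec : @second_countable V.
Proof.
pose F (qj : 'rV[rat]_n * nat) : set V := ball (map_mx (@ratr R) qj.1 : V) (qj.2.+1%:R^-1).
exists (F @` setT).
  by apply: sub_countable (card_image_le F setT) _; exact: countableP.
split=> [_ [qj _ <-]|x U /nbhs_ballP[e /= e0 eU]].
  by apply: ball_open; rewrite invr_gt0 ltr0n.
have [j je] : exists j : nat, (j.+1%:R)^-1 < e / 2 :> R.
  by have [|j] := @ltr_add_invr R 0 (e / 2); [rewrite divr_gt0|rewrite add0r; exists j].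
have j0 : 0 < (j.+1%:R)^-1 :> R by rewrite invr_gt0 ltr0n.
have /choice[q qP] : forall i : 'I_n, exists q : rat, `|x 0 i - ratr q| < (j.+1%:R)^-1.
  move=> i; have /rat_in_itvoo[q] : x 0 i - (j.+1%:R)^-1 < x 0 i + (j.+1%:R)^-1.
    by rewrite ltrD2l gtrN.
  rewrite in_itv /= => /andP[q1 q2]; exists q.
  by rewrite ltr_distlC q1.
have qx : `|map_mx ratr (\row_i q i) - x| < (j.+1%:R)^-1.
  by rewrite distrC; apply: mx_norm_ltP => // i i'; rewrite ord1 !mxE.
exists (F (\row_i q i, j)); first split.
- by exists (\row_i q i, j).
- by rewrite /F /= -ball_normE.
- apply: subset_trans eU => z; rewrite /F /= -!ball_normE /= => qz.
  rewrite -(subrKA (map_mx ratr (\row_i q i))).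
  apply: (le_lt_trans (ler_normD _ _)); rewrite distrC in qx.
  by rewrite (splitr e) ltrD// (lt_trans _ je).
Qed.

Variable rho : R.
Hypothesis rho_gt0 : 0 < rho.

(** It is used as a chart, so being a homeomorphism onto the ball is enough: the smooth structure is
    the one transported from the ball, even though [squeeze] involves the sup norm. *)
Definition squeeze (t : V) : V := (rho / (1 + `|t|)) *: t.
Definition stretch (y : V) : V := (rho - `|y|)^-1 *: y.

Let t1_gt0 (t : V) : 0 < 1 + `|t|.
Proof. by rewrite ltr_pwDl. Qed.

Lemma norm_squeeze t : `|squeeze t| = rho - rho / (1 + `|t|).
Proof.
rewrite normrZ ger0_norm; last by rewrite divr_ge0// ltW.
have : 1 + `|t| != 0 by rewrite gt_eqF.
by move=> ?; field.
Qed.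

Lemma squeeze_oball t : oball n rho (squeeze t).
Proof. by rewrite /oball /= norm_squeeze ltrBlDr ltrDl divr_gt0. Qed.

Lemma squeezeK : cancel squeeze stretch.
Proof.
move=> t; rewrite /stretch norm_squeeze opprB addrC subrK.
rewrite scalerA mulVf ?scale1r// gt_eqF// divr_gt0//.
Qed.

Lemma stretchK y : oball n rho y -> squeeze (stretch y) = y.
Proof.
rewrite /oball /= => yr; have r0 : 0 < rho - `|y| by rewrite subr_gt0.
rewrite /squeeze scalerA normrZ ger0_norm ?invr_ge0 ?ltW//.
suff -> : rho / (1 + (rho - `|y|)^-1 * `|y|) * (rho - `|y|)^-1 = 1 by rewrite scale1r.
have d0 : rho - `|y| != 0 by rewrite gt_eqF.
have -> : 1 + (rho - `|y|)^-1 * `|y| = rho / (rho - `|y|) by field.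
have rho0 : rho != 0 by rewrite gt_eqF.
by rewrite invf_div mulrCA mulfV// mulr1 mulfV.
Qed.

Lemma squeeze_range : squeeze @` setT = oball n rho.
Proof.
apply/seteqP; split=> [_ [t _ <-]|y Dy]; first exact: squeeze_oball.
by exists (stretch y) => //; exact: stretchK.
Qed.

Lemma continuous_squeeze : continuous squeeze.
Proof.
move=> t; have ? : Filter (nbhs (t : V)) by exact: nbhs_filter.
have cn : `|x| @[x --> (t : V)] --> `|t| := @norm_continuous R V t.
have cd : 1 + `|x| @[x --> (t : V)] --> 1 + `|t|.
  by apply: cvgD => //; exact: cvg_cst.
have d0 : 1 + `|t| != 0 by rewrite gt_eqF.
have ck : rho / (1 + `|x|) @[x --> (t : V)] --> rho / (1 + `|t|).
  by apply: cvgM; [exact: cvg_cst|exact: (cvgV d0)].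
exact: (cvgZ ck (@cvg_id V (nbhs t))).
Qed.

Lemma continuous_stretch : {in oball n rho, continuous stretch}.
Proof.
move=> y /set_mem yr; have ? : Filter (nbhs (y : V)) by exact: nbhs_filter.
have cn : `|x| @[x --> (y : V)] --> `|y| := @norm_continuous R V y.
have cd : rho - `|x| @[x --> (y : V)] --> rho - `|y|.
  by apply: cvgB => //; exact: cvg_cst.
have d0 : rho - `|y| != 0 by rewrite gt_eqF// subr_gt0.
have ck : (rho - `|x|)^-1 @[x --> (y : V)] --> (rho - `|y|)^-1 by exact: (cvgV d0).
exact: (cvgZ ck (@cvg_id V (nbhs y))).
Qed.

(* The carrier is all of R^n, read through a homeomorphism onto the ball; the
   chart image is what matters. *)
Definition ball_chart : chart R V n := Chart setT squeeze stretch.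
Definition ball_manifold : charted R n := @Charted R n V [set ball_chart] (fun=> ball_chart).

Lemma smooth_ball_manifold : smooth_manifold ball_manifold.
Proof.
split.
- exact: norm_hausdorff.
- exact: second_countable_rowvec.
- move=> _ ->; split=> /=.
  + exact: openT.
  + by rewrite squeeze_range; exact: open_oball.
  + by move=> p _; exact: squeezeK.
  + by move=> p _; exact: continuous_squeeze.
  + by rewrite squeeze_range; exact: continuous_stretch.
- by [].
- move=> _ _ -> -> /=; rewrite setTI squeeze_range => j.
  have oD := open_oball (n := n) (r := rho).
  apply: (Ck_on_congr (f := id)) => //; first by move=> y /stretchK.
  by apply/Ck_on_mxP => // i i'; exact: Ck_on_coord.
Qed.

End BallManifold.

Lemma jacobian_comp (R : realType) n m q (f : 'rV[R]_n -> 'rV[R]_m)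
    (g : 'rV[R]_m -> 'rV[R]_q) x :
  differentiable f x -> differentiable g (f x) ->
  jacobian (g \o f) x = jacobian f x *m jacobian g (f x).
Proof.
move=> df dg; apply/row_matrixP => i; rewrite !rowE mulmxA.
rewrite (jacobian_mul _ (differentiable_comp df dg)) (jacobian_mul _ df).
rewrite (jacobian_mul _ dg).
exact: (derive_comp _ df dg).
Qed.

Lemma jacobian_congr (R : realType) n m (A : set 'rV[R]_n) (f g : 'rV[R]_n -> 'rV[R]_m) x :
  open A -> (forall y, A y -> f y = g y) -> A x -> differentiable g x ->
  jacobian f x = jacobian g x.
Proof.
move=> oA fg Ax dg; have df : differentiable f x.
  apply: near_eq_differentiable dg.
  by apply: (open_nearP oA Ax) => y /fg.
apply/row_matrixP => i; apply: (etrans (rowE i _)); apply: (etrans _ (esym (rowE i _))).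
exact: (etrans (jacobian_mul _ df) (etrans (derive_congr _ oA fg Ax) (esym (jacobian_mul _ dg)))).
Qed.

Lemma differentiable_idfun (R : realType) n (x : 'rV[R]_n) : differentiable id x.
Proof. by have [] := is_diff_id x. Qed.

Lemma jacobian_id (R : realType) n (x : 'rV[R]_n) : jacobian id x = 1%:M.
Proof.
apply/row_matrixP => i; rewrite !rowE jacobian_mul; last exact: differentiable_idfun.
by rewrite mulmx1 derive_id.
Qed.

Lemma open_preimage_in (T U : topologicalType) (A : set T) (f : T -> U) (B : set U) :
  open A -> {in A, continuous f} -> open B -> open (A `&` f @^-1` B).
Proof.
move=> oA cf oB; rewrite openE => x [Ax Bfx]; rewrite /interior.
apply: filterI; first exact: open_nbhs_nbhs.
by apply: (cf x (mem_set Ax)); exact: open_nbhs_nbhs.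
Qed.

Section ChartCalculus.
Context {R : realType} {n : nat} {M : charted R n}.
Hypothesis hM : smooth_manifold M.
Implicit Types (c d : chart R M n) (p : M).

Let chv c : atlas M c -> chart_valid c. Proof. by have [_ _ + _ _] := hM; exact. Qed.

Lemma chart_ofEK c p : atlas M c -> dom c p -> ofE c (toE c p) = p.
Proof. by move=> /chv[_ _ + _ _]; exact. Qed.

Lemma chart_imageP c (U : set M) x : atlas M c -> (toE c @` (dom c `&` U)) x ->
  [/\ dom c (ofE c x), U (ofE c x) & toE c (ofE c x) = x].
Proof. by move=> ac [p [cp Up] <-]; rewrite chart_ofEK. Qed.

Lemma open_chart_image c (U : set M) : atlas M c -> open U -> open (toE c @` (dom c `&` U)).
Proof.
move=> ac oU; have [od oi K _ co] := chv ac.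
rewrite (_ : _ @` _ = (toE c @` dom c) `&` ofE c @^-1` U).
  exact: open_preimage_in.
apply/seteqP; split=> [_ [p [cp Up] <-]|_ [[p cp <-]] /=].
  by split; [exists p|rewrite /= K].
by rewrite K// => Up; exists p.
Qed.

Lemma open_ofE_image c (A : set 'rV[R]_n) : atlas M c -> open A -> A `<=` toE c @` dom c ->
  open (ofE c @` A).
Proof.
move=> ac oA Ac; have [od oi K ct _] := chv ac.
rewrite (_ : _ @` _ = dom c `&` toE c @^-1` A); first exact: open_preimage_in.
apply/seteqP; split=> [_ [x Ax <-]|p [cp Ap]].
  have [p cp px] := Ac _ Ax; rewrite -px K//; split=> //=.
  by rewrite px.
by exists (toE c p) => //; rewrite K.
Qed.

Definition trans c d p : 'M[R]_n := jacobian (toE d \o ofE c) (toE c p).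

Lemma smooth_trans c d : atlas M c -> atlas M d ->
  smooth_on (toE c @` (dom c `&` dom d)) (toE d \o ofE c).
Proof. by have [_ _ _ _ +] := hM; exact. Qed.

Lemma open_overlap c d : atlas M c -> atlas M d -> open (toE c @` (dom c `&` dom d)).
Proof. by move=> ac /chv[od _ _ _ _]; exact: open_chart_image. Qed.

Lemma differentiable_trans c d p : atlas M c -> atlas M d -> dom c p -> dom d p ->
  differentiable (toE d \o ofE c) (toE c p).
Proof.
move=> ac ad cp dp; apply: Ck_diff (smooth_trans ac ad 1%N) _.
by exists p.
Qed.

Lemma trans_id c p : atlas M c -> dom c p -> trans c c p = 1%:M.
Proof.
move=> ac cp; rewrite /trans -(jacobian_id (toE c p)).
apply: (jacobian_congr (open_overlap ac ac)); last exact: differentiable_idfun.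
- by move=> y /(chart_imageP ac)[_ _].
- by exists p.
Qed.

Lemma trans_cocycle c d e p : atlas M c -> atlas M d -> atlas M e ->
  dom c p -> dom d p -> dom e p -> trans c d p *m trans d e p = trans c e p.
Proof.
move=> ac ad ae cp dp ep; have [od _ _ _ _] := chv ad.
have oe : open (dom e) by have [] := chv ae.
have Kp : toE d p = (toE d \o ofE c) (toE c p) by rewrite /= chart_ofEK.
have dcd := differentiable_trans ac ad cp dp.
have dde := differentiable_trans ad ae dp ep.
rewrite /trans Kp in dde *; rewrite -(jacobian_comp dcd dde); apply/esym.
apply: (jacobian_congr (open_chart_image ac (openI od oe))).
- by move=> y /(chart_imageP ac)[_ [dy _] _] /=; rewrite (chart_ofEK ad dy).
- by exists p.
- exact: differentiable_comp dcd dde.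
Qed.

Lemma trans_inv c d p : atlas M c -> atlas M d -> dom c p -> dom d p ->
  trans c d p *m trans d c p = 1%:M.
Proof. by move=> ac ad cp dp; rewrite trans_cocycle// trans_id. Qed.

Lemma atlas_chart_at p : atlas M (chart_at p).
Proof. by have [_ _ _ + _] := hM => /(_ p)[]. Qed.

Lemma dom_chart_at p : dom (chart_at p) p.
Proof. by have [_ _ _ + _] := hM => /(_ p)[]. Qed.

Lemma to_chartE c p : to_chart c p = trans (chart_at p) c p. Proof. by []. Qed.

Lemma of_chartE c p : of_chart c p = trans c (chart_at p) p. Proof. by []. Qed.

End ChartCalculus.

(** Completeness of matrix spaces, in the form required by [banach_fixed_point]. *)
HB.instance Definition _ (R : realType) (m n : nat) :=
  Complete.copy 'M[R]_(m, n) 'M[R]_(m, n).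

Section PerturbedIdentity.
Context {R : realType} {n : nat}.
Variables (rho : R) (F : 'rV[R]_n -> 'rV[R]_n).
Notation D := (oball n rho).
Hypothesis lip : forall p q, D p -> D q -> `|F p - F q - (p - q)| <= 2^-1 * `|p - q|.

Lemma perturbed_id_inj p q : D p -> D q -> F p = F q -> p = q.
Proof.
move=> Dp Dq Fpq; have := lip Dp Dq; rewrite Fpq subrr sub0r normrN => h.
apply/eqP; rewrite -subr_eq0 -normr_le0; lra.
Qed.

(* [F q = z] is solved by the contraction [q |-> q - (F q - z)]. *)
Lemma perturbed_id_open (A : set 'rV[R]_n) : open A -> A `<=` D -> open (F @` A).
Proof.
move=> oA AD; rewrite openE => _ [p Ap <-]; rewrite /interior.
have /nbhs_ballP[e0 /= e0_gt0 e0A] : nbhs p A by exact: open_nbhs_nbhs.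
pose e := e0 / 2; have e_gt0 : 0 < e by rewrite divr_gt0.
pose K : set 'rV[R]_n := [set q | `|q - p| <= e].
have KA : K `<=` A.
  move=> q /= qp; apply: e0A; rewrite -ball_normE /= distrC.
  by apply: le_lt_trans qp _; rewrite /e; lra.
have Kp : K p by rewrite /K /= subrr normr0 ltW.
(* Half the radius for the targets: [T] moves the centre by at most [e / 2], and the perturbation
   adds at most half of [e], so [K] is mapped into itself. *)
apply/nbhs_ballP; exists (e / 2) => /=; first by rewrite divr_gt0.
move=> z; rewrite -ball_normE /= => Fz.
pose T q := q - (F q - z).
have TK : set_fun K K T.
  move=> q Kq; rewrite /K /=.
  have -> : T q - p = - (F q - F p - (q - p)) - (F p - z).
    by rewrite /T !opprB addrACA; apply/rowP => j; rewrite !mxE; ring.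
  apply: (le_trans (ler_normB _ _)); rewrite normrN.
  have := lip (AD _ (KA _ Kq)) (AD _ Ap); have : `|q - p| <= e by []; lra.
have [q Kq qT] : exists2 q, K q & q = T q.
  have [f fE] : exists f : {fun K >-> K}, f =1 T.
    by exists (HB.pack_for {fun K >-> K} T (isFun.Build _ _ _ _ _ TK)).
  have ctr : is_contraction f.
    exists (2^-1)%:nng; split; first by rewrite /=; lra.
    move=> [q q'] [/= Kq Kq']; rewrite !fE.
    have -> : T q - T q' = - (F q - F q' - (q - q')).
      by rewrite /T; apply/rowP => j; rewrite !mxE; ring.
    by rewrite normrN; apply: lip; apply: AD; exact: KA.
  have clK : closed K.
    rewrite (_ : K = closed_ball p e); first exact: closed_ball_closed.
    rewrite closed_ballE//; apply/seteqP.
    by split=> q; rewrite /K /closed_ball_ /= distrC.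
  have [|q Kq qf] := banach_fixed_point ctr clK; first by exists p.
  by exists q => //; rewrite -fE.
exists q; first exact: KA.
by move: qT; rewrite /T => /eqP; rewrite eq_sym subr_eq addrC -subr_eq subrr eq_sym subr_eq0 => /eqP.
Qed.

End PerturbedIdentity.

(** * Adapted frames of a Dirac structure *)

Section AdaptedFrame.
Context {R : realType}.

(* Rows of [X], [a] being a frame of [L_m], the vectors [v] are those of
   [L_m `&` T_m M], and [k] is the dimension of that intersection. *)
Lemma kernel_coordinates n r (X a : 'M[R]_(r, n)) : exists (k : nat) (G : 'M[R]_n),
  [/\ (k <= n)%N, G \in unitmx & forall v : 'rV[R]_n,
    (exists c, v = c *m X /\ c *m a = 0) <->
    (forall j : 'I_n, (k <= j)%N -> (v *m G) 0 j = 0)].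
Proof.
pose Dl := kermx a *m X; pose E := row_ebase Dl.
have Eu : E \in unitmx by exact: row_ebase_unit.
exists (\rank Dl), (invmx E); split; [exact: rank_leq_col|by rewrite unitmx_inv|].
have DlE : Dl *m invmx E = col_ebase Dl *m pid_mx (\rank Dl).
  by rewrite -{1}[Dl]mulmx_ebase mulmxK.
have kD (v : 'rV[R]_n) : (exists c, v = c *m X /\ c *m a = 0) <-> (v <= Dl)%MS.
  split=> [[c [-> /eqP ca]]|/submxP[d ->]].
    by move: ca; rewrite -sub_kermx => /submxP[d ->]; rewrite -mulmxA submxMl.
  exists (d *m kermx a); split; first by rewrite /Dl mulmxA.
  by rewrite -mulmxA mulmx_ker mulmx0.
move=> v; rewrite kD; split=> [/submxP[d ->] j kj|vj].
  rewrite -mulmxA DlE !mulmxA mxE big1// => i _.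
  rewrite [X in _ * X]mxE; case: eqP => [ij|]; last by rewrite /= mulr0.
  by rewrite ij ltnNge kj /= mulr0.
rewrite -[v](mulmxKV Eu) -[X in (_ <= X)%MS](mulmxKV Eu) submxMr// DlE.
have -> : v *m invmx E = v *m invmx E *m (pid_mx (\rank Dl) : 'M[R]_(n, r)) *m pid_mx (\rank Dl).
  rewrite -mulmxA pid_mx_id ?rank_leq_row//.
  apply/rowP => j; rewrite [RHS]mxE (bigD1 j)//= big1 => [|i ij]; last first.
    by rewrite [X in _ * X]mxE val_eqE (negPf ij) mulr0.
  rewrite [X in _ * X]mxE eqxx /= addr0.
  by case: ltnP => jk; rewrite ?mulr1// vj// mulr0.
have [N NE] : exists N : 'M[R]_r, N *m col_ebase Dl = 1%:M.
  by exists (invmx (col_ebase Dl)); rewrite mulVmx// col_ebase_unit.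
apply/submxP; exists (v *m invmx E *m pid_mx (\rank Dl) *m N).
by rewrite -[RHS]mulmxA [N *m _]mulmxA NE mul1mx.
Qed.

(* If [row_mx (lsubmx X) (rsubmx a)] had a nonzero covector [z] in its cokernel, the
   swapped pair built from [z] would be orthogonal to [L_m], hence in it. *)
Lemma adapted_frame k l r (X a : 'M[R]_(r, k + l)) :
  X *m a^T + a *m X^T = 0 ->
  (forall v : 'rV[R]_(k + l), (exists c, v = c *m X /\ c *m a = 0) <-> rsubmx v = 0) ->
  (forall v b : 'rV[R]_(k + l), dot v b = 0 -> v *m a^T + b *m X^T = 0 ->
     exists c, v = c *m X /\ b = c *m a) ->
  exists (C : 'M[R]_(k + l, r)) (P0 : 'M[R]_l),
    C *m X = block_mx 1%:M 0 0 P0 /\ C *m a = block_mx 0 0 0 1%:M.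
Proof.
move=> iso ker max.
(* The first [k] coordinate vectors, paired with the zero covector, are combinations of the rows;
   isotropy makes every covector of the frame vanish on them. *)
have a_left : lsubmx a = 0.
  apply/row_matrixP => i; rewrite row0; apply/rowP => j; rewrite !mxE.
  have [_ /(_ _)[|c [cX ca]]] := ker (row_mx (EE j) 0); first by rewrite row_mxKr.
  have := isotropic_dot c (EE i) iso; rewrite -cX ca dot0l addr0.
  rewrite -[EE i *m a]hsubmxK dot_row dot0l addr0 dotC.
  rewrite -mulmx_lsub -rowE /dot trmx_delta -colE !mxE.
  by [].
pose U := row_mx (lsubmx X) (rsubmx a).
have /row_fullP[C CU] : row_full U.
  rewrite -cokermx_eq0; apply/eqP/trmx_inj/row_matrixP => i.
  rewrite trmx0 row0; set z := row i _.
  have Uz : U *m z^T = 0.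
    by rewrite /z rowE trmx_mul trmxK mulmxA mulmx_coker mul0mx.
  pose v : 'rV[R]_(k + l) := row_mx 0 (rsubmx z).
  pose b : 'rV[R]_(k + l) := row_mx (lsubmx z) 0.
  have [||c [vc bc]] := max v b.
  - by rewrite dot_row dot0l dot0r addr0.
  - apply: trmx_inj; rewrite trmx0 linearD/= !trmx_mul !trmxK -[RHS]Uz.
    rewrite -[in LHS](hsubmxK a) -[in LHS](hsubmxK X) -[in RHS](hsubmxK z) !tr_row_mx.
    by rewrite !mul_row_col !trmx0 !mulmx0 add0r addr0 addrC.
  have z1 : lsubmx z = 0.
    by rewrite -(row_mxKl (lsubmx z) (0 : 'rV[R]_l)) -/b bc -mulmx_lsub a_left mulmx0.
  have z2 : rsubmx z = 0.
    rewrite -(row_mxKr (0 : 'rV[R]_k) (rsubmx z)) -/v; apply/ker; exists c.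
    by rewrite -vc -bc /b z1 row_mx0.
  by rewrite -[z]hsubmxK z1 z2 row_mx0.
have aE : C *m a = block_mx 0 0 0 1%:M.
  move: CU; rewrite mul_mx_row scalar_mx_block block_mxEh => /eq_row_mx[_ aE].
  by rewrite -[a]hsubmxK a_left mul_mx_row mulmx0 aE block_mxEh col_mx0.
have XE : lsubmx (C *m X) = col_mx 1%:M 0.
  by move: CU; rewrite mul_mx_row scalar_mx_block block_mxEh -mulmx_lsub => /eq_row_mx[].
exists C, (drsubmx (C *m X)); split=> //.
have iso' := isotropic_lmul C C iso.
have XB : C *m X = block_mx 1%:M (ursubmx (C *m X)) 0 (drsubmx (C *m X)).
  rewrite -{1}[C *m X]hsubmxK XE -{1}[rsubmx (C *m X)]vsubmxK -block_mxEh.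
  by congr block_mx; apply/matrixP => i j; rewrite !mxE.
(* The upper right block of the isotropy relation for the new rows is exactly the block of [C *m X]
   that still has to vanish. *)
rewrite {1}XB; congr block_mx; move: iso'; rewrite XB aE !tr_block_mx !mulmx_block.
rewrite !(trmx0, trmx1, mulmx0, mul0mx, mulmx1, mul1mx, addr0, add0r) add_block_mx.
by rewrite block_mxKur !addr0 -[X in _ = X -> _]block_mx0 => /eq_block_mx[].
Qed.

End AdaptedFrame.

Section Spans.
Context {R : realType} {n : nat}.

Lemma span_frame r (e : 'I_r -> TT R n) (w : TT R n) :
  w \in <<[seq e i | i : 'I_r]>>%VS <->
  exists c : 'rV[R]_r, w.1 = c *m (\matrix_i (e i).1) /\ w.2 = c *m (\matrix_i (e i).2).
Proof.
have fE (c : 'rV[R]_r) : (\sum_i c 0 i *: e i) =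
    (c *m (\matrix_i (e i).1), c *m (\matrix_i (e i).2)) :> TT R n.
  rewrite [LHS]surjective_pairing; congr pair.
    rewrite (big_morph fst (id1 := 0) (op1 := +%R))//; apply/rowP => j.
    by rewrite summxE mxE; apply: eq_bigr => i _; rewrite !mxE.
  rewrite (big_morph snd (id1 := 0) (op1 := +%R))//; apply/rowP => j.
  by rewrite summxE mxE; apply: eq_bigr => i _; rewrite !mxE.
have -> : <<[seq e i | i : 'I_r]>>%VS = (\sum_i <[e i]>)%VS.
  by rewrite span_def big_image.
split=> [/memv_sumP[vs vse ->]|[c [w1 w2]]].
  have /choice[c cE] : forall i, exists c, vs i = c *: e i.
    by move=> i; have /vlineP[c] := vse i isT; exists c.
  exists (\row_i c i); rewrite (eq_bigr (fun i => (\row_i c i) 0 i *: e i)).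
    by rewrite fE.
  by move=> i _; rewrite mxE cE.
rewrite [w]surjective_pairing w1 w2 -fE; apply: memv_sumr => i _.
exact/memvZ/memv_line.
Qed.

Lemma pairingE (w z : TT R n) : pairing w z = 2^-1 * (dot w.1 z.2 + dot z.1 w.2).
Proof. by []. Qed.

Lemma pairingC (w z : TT R n) : pairing w z = pairing z w.
Proof. by rewrite !pairingE addrC. Qed.

Lemma pairingDl (w w' z : TT R n) : pairing (w + w') z = pairing w z + pairing w' z.
Proof. by rewrite !pairingE dotDl dotDr; ring. Qed.

Lemma pairingZl (t : R) (w z : TT R n) : pairing (t *: w) z = t * pairing w z.
Proof. by rewrite !pairingE /dot/= -scalemxAl linearZ/= -scalemxAr !mxE; ring. Qed.

(** Adding the line of [w] keeps the subspace isotropic, so by maximality it adds nothing. *)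
Lemma max_isotropic_mem (W : {vspace 'rV[R]_n * 'rV[R]_n}) (A : set (TT R n)) (w : TT R n) :
  A = [set` W] -> max_isotropic A -> pairing w w = 0 ->
  (forall z, A z -> pairing w z = 0) -> A w.
Proof.
move=> AE [isoA maxA] ww wA.
have sub : A `<=` [set` (W + <[w]>)%VS].
  by move=> z; rewrite AE /= => zW; exact: (subvP (addvSl W <[w]>)).
rewrite (maxA _ _ sub) /=; first by apply: (subvP (addvSr W <[w]>)); exact: memv_line.
move=> x y /= /memv_addP[x1 x1W [_ /vlineP[s ->] ->]] /memv_addP[y1 y1W [_ /vlineP[t ->] ->]].
have Ax1 : A x1 by rewrite AE. have Ay1 : A y1 by rewrite AE.
rewrite pairingDl pairingZl !(pairingC _ (y1 + _)) !pairingDl !pairingZl.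
by rewrite (isoA _ _ Ay1 Ax1) (wA _ Ax1) (pairingC y1) (wA _ Ay1) ww !(mulr0, addr0).
Qed.

End Spans.

Lemma tor_algebra (R : realType) n (J H : 'M[R]_n) (D D' : 'rV[R]_n -> 'rV[R]_n)
    (x2 x3 a2 a3 d e12 e21 : 'rV[R]_n) :
  (forall v, v *m J = D v) -> (forall v, v *m H = D' v) ->
  dot d a3 + dot e12 x3 + dot a2 (D x3) - dot e21 x3 + dot x2 (D' x3) =
  dot d a3 + dot x3 (e12 + a2 *m J^T - (e21 - x2 *m H^T)).
Proof.
move=> DJ DH; rewrite dotBr dotBr dotDr -DJ -DH !(dotC x3) !dot_mulmxT.
ring.
Qed.

(** * Involutivity in charts *)

Section DiracFrame.
Context {R : realType} {n : nat} {M : charted R n}.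
Hypothesis hM : smooth_manifold M.
Variable L : M -> set (TT R n).
Hypothesis hL : dirac_structure L.
Variables (r : nat) (U : set M) (e : 'I_r -> M -> TT R n).
Hypotheses (oU : open U) (se : forall i, smooth_section U (e i)).
Hypothesis Le : forall q, U q -> L q = [set` <<[seq e i q | i : 'I_r]>>%VS].

Definition frame_v (q : M) : 'M[R]_(r, n) := \matrix_i (e i q).1.
Definition frame_c (q : M) : 'M[R]_(r, n) := \matrix_i (e i q).2.

Lemma frame_span q (w : TT R n) : U q ->
  L q w <-> exists c, w.1 = c *m frame_v q /\ w.2 = c *m frame_c q.
Proof. by move=> Uq; rewrite Le// -span_frame. Qed.

Lemma frame_iso q : U q ->
  frame_v q *m (frame_c q)^T + frame_c q *m (frame_v q)^T = 0.
Proof.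
move=> Uq; have [_ maxL _] := hL; have [isoL _] := maxL q.
have Lc (c : 'rV[R]_r) : L q (c *m frame_v q, c *m frame_c q).
  by apply/(frame_span _ Uq); exists c.
apply: dot_matrix0 => c d; rewrite mulmxDr dotDl !mulmxA !dot_mulmxT.
have := isoL _ _ (Lc c) (Lc d); rewrite pairingE /= => /eqP.
rewrite mulf_eq0 invr_eq0 pnatr_eq0 /= => /eqP.
by rewrite (dotC (d *m _)).
Qed.

Definition loc_frame_v (d : chart R M n) (x : 'rV[R]_n) : 'M[R]_(r, n) :=
  frame_v (ofE d x) *m to_chart d (ofE d x).
Definition loc_frame_c (d : chart R M n) (x : 'rV[R]_n) : 'M[R]_(r, n) :=
  frame_c (ofE d x) *m (of_chart d (ofE d x))^T.

Let od d : atlas M d -> open (toE d @` (dom d `&` U)).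
Proof. by move=> ad; exact: open_chart_image. Qed.

Lemma smooth_loc_frame d : atlas M d ->
  smooth_on (toE d @` (dom d `&` U)) (loc_frame_v d) /\
  smooth_on (toE d @` (dom d `&` U)) (loc_frame_c d).
Proof.
move=> ad; split=> j; apply/(Ck_on_mxP _ _ (od ad)) => i i';
  have [sv sc] := se i ad.
  have /(Ck_on_mxP _ _ (od ad)) /(_ 0 i') := sv j.
  apply: (Ck_on_congr (od ad)) => x _; rewrite /loc_vector /loc_frame_v !mxE.
  by apply: eq_bigr => h _; rewrite !mxE.
have /(Ck_on_mxP _ _ (od ad)) /(_ 0 i') := sc j.
apply: (Ck_on_congr (od ad)) => x _; rewrite /loc_covector /loc_frame_c !mxE.
by apply: eq_bigr => h _; rewrite !mxE.
Qed.

Definition comb (c : 'rV[R]_r) (q : M) : TT R n := (c *m frame_v q, c *m frame_c q).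

Lemma loc_vector_comb d c :
  loc_vector d (fun q => (comb c q).1) = (fun x => c *m loc_frame_v d x).
Proof. by apply/funext => x; rewrite /loc_vector /comb/= -mulmxA. Qed.

Lemma loc_covector_comb d c :
  loc_covector d (fun q => (comb c q).2) = (fun x => c *m loc_frame_c d x).
Proof. by apply/funext => x; rewrite /loc_covector /comb/= -mulmxA. Qed.

Lemma smooth_comb c : smooth_section U (comb c).
Proof.
move=> d ad; have [sv sc] := smooth_loc_frame ad.
rewrite loc_vector_comb loc_covector_comb.
by split=> j; apply: (Ck_on_mulmx (od ad)) => //; exact: Ck_on_cst.
Qed.

Lemma loc_frame_diff d (c : 'rV[R]_r) x : atlas M d -> (toE d @` (dom d `&` U)) x ->
  differentiable (fun y => c *m loc_frame_v d y) x /\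
  differentiable (fun y => c *m loc_frame_c d y) x.
Proof.
move=> ad dx; have [sv sc] := smooth_loc_frame ad.
split; apply: (differentiable_mulmx (differentiable_cst c x)).
  exact: Ck_diff (sv 1%N) dx.
exact: Ck_diff (sc 1%N) dx.
Qed.

(** By involutivity the Dorfman bracket of two combinations lies in [L], so isotropy kills its
    pairing with a third. [dorfman] is computed in [chart_at q], so this only speaks about [q] in
    its own chart. *)
Lemma tor_chart_at q (c1 c2 c3 : 'rV[R]_r) : U q ->
  let d := chart_at q in
  tor (fun y => c1 *m loc_frame_v d y) (fun y => c1 *m loc_frame_c d y)
      (fun y => c2 *m loc_frame_v d y) (fun y => c2 *m loc_frame_c d y)
      (fun y => c3 *m loc_frame_v d y) (fun y => c3 *m loc_frame_c d y) (toE d q) = 0.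
Proof.
move=> Uq d; have ad : atlas M d := atlas_chart_at hM q.
have dq : dom d q := dom_chart_at hM q.
have [_ maxL invL] := hL; have [isoL _] := maxL q.
have Lc c p : U p -> L p (comb c p).
  by move=> Up; apply/(frame_span _ Up); exists c.
have Ld := invL U (comb c1) (comb c2) oU (smooth_comb c1) (smooth_comb c2) (Lc c1) (Lc c2) q Uq.
have := isoL _ _ Ld (Lc c3 q Uq); rewrite pairingE => /eqP.
rewrite mulf_eq0 invr_eq0 pnatr_eq0 orFb => /eqP; rewrite /dorfman -/d.
rewrite !loc_vector_comb !loc_covector_comb [(comb c3 q).1]/= [(comb c3 q).2]/=.
have K : ofE d (toE d q) = q := chart_ofEK hM ad dq.
have v3 : c3 *m frame_v q = c3 *m loc_frame_v d (toE d q).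
  by rewrite /loc_frame_v K to_chartE trans_id// mulmx1.
have b3 : c3 *m frame_c q = c3 *m loc_frame_c d (toE d q).
  by rewrite /loc_frame_c K of_chartE trans_id// trmx1 mulmx1.
rewrite v3 b3 => <-.
have Ux : (toE d @` (dom d `&` U)) (toE d q) by exists q.
have [dv1 dc1] := loc_frame_diff c1 ad Ux.
have [dv2 dc2] := loc_frame_diff c2 ad Ux.
rewrite /tor /lie_bracket /lie_covector /contract_d.
cbn [fst snd].
exact: (tor_algebra (D := fun v => 'D_v (fun y => c1 *m loc_frame_v d y) (toE d q))
  (D' := fun v => 'D_v (fun y => c1 *m loc_frame_c d y) (toE d q)) _ _ _ _ _ _ _
  (fun v => jacobian_mul v dv1) (fun v => jacobian_mul v dc1)).
Qed.

End DiracFrame.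

Lemma vector_change (R : realType) r n (F : 'M[R]_(r, n)) (G T T1 T2 : 'M[R]_n) :
  G \in unitmx -> T *m T1 = T2 -> F *m T *m G *m (invmx G *m T1) = F *m T2.
Proof. by move=> Gu <-; rewrite !mulmxA mulmxK. Qed.

Lemma covector_change (R : realType) r n (F : 'M[R]_(r, n)) (G T T1 T2 : 'M[R]_n) :
  T1 *m T2 = T -> F *m T^T *m (invmx G)^T = F *m T2^T *m (invmx G *m T1)^T.
Proof. by move=> <-; rewrite !trmx_mul !mulmxA. Qed.

Lemma iso_change (R : realType) r n (X X' a a' : 'M[R]_(r, n)) (K : 'M[R]_n) :
  X *m K = X' -> a = a' *m K^T ->
  X *m a^T + a *m X^T = X' *m a'^T + a' *m X'^T.
Proof. by move=> <- ->; rewrite !trmx_mul trmxK !mulmxA. Qed.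

Section LinearCoordinates.
Context {R : realType} {n : nat} {M : charted R n}.
Hypothesis hM : smooth_manifold M.
Variables (m : M) (G : 'M[R]_n).
Hypothesis Gu : G \in unitmx.
Notation c0 := (chart_at m).
Notation x0 := (toE c0 m).
Let ac0 : atlas M c0 := atlas_chart_at hM m.

Definition aff (z : 'rV[R]_n) : 'rV[R]_n := x0 + z *m invmx G.
Definition zpt (z : 'rV[R]_n) : M := ofE c0 (aff z).
Definition zdom (U : set M) : set 'rV[R]_n := aff @^-1` (toE c0 @` (dom c0 `&` U)).
(** The differential of [zpt], with the target read in the chart that defines its tangent space.
    That chart may jump with [z], so smoothness is only claimed for the frame expressed in the fixed
    coordinates [z]. *)
Definition dzpt (z : 'rV[R]_n) : 'M[R]_n := invmx G *m trans c0 (chart_at (zpt z)) (zpt z).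

Lemma Ck_aff k A : open A -> Ck_on k A aff.
Proof.
move=> oA; apply: Ck_on_add => //; first exact: Ck_on_cst.
exact: smooth_lmx.
Qed.

Lemma differentiable_aff z : differentiable aff z.
Proof. exact: Ck_diff (Ck_aff 1 openT) I. Qed.

Lemma jacobian_aff z : jacobian aff z = invmx G.
Proof.
apply/row_matrixP => i; apply: (etrans (rowE i _)); apply: (etrans _ (esym (rowE i _))).
apply: (etrans (jacobian_mul _ (differentiable_aff z))).
rewrite (deriveD_fun (F := cst x0) (G := fun z => z *m invmx G) _ (differentiable_cst _ _)).
  by rewrite derive_cst add0r derive_lmx.
exact: differentiable_lmx.
Qed.

Lemma continuous_aff : continuous aff.
Proof. by move=> z; exact: differentiable_continuous (differentiable_aff z). Qed.

Lemma zpt0 : zpt 0 = m.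
Proof. rewrite /zpt /aff mul0mx addr0.
exact: (chart_ofEK hM ac0 (dom_chart_at hM m)). Qed.

Lemma open_zdom U : open U -> open (zdom U).
Proof.
move=> oU; apply: open_comp; first by move=> z _; exact: continuous_aff.
exact: open_chart_image.
Qed.

Lemma zdom0 (U : set M) : U m -> zdom U 0.
Proof.
by move=> Um; exists m; [split=> //; exact: dom_chart_at|rewrite /aff mul0mx addr0].
Qed.

Lemma zdomP U z : zdom U z -> [/\ dom c0 (zpt z), U (zpt z) & toE c0 (zpt z) = aff z].
Proof. exact: chart_imageP. Qed.

Lemma dzpt_unit U z : zdom U z -> dzpt z \in unitmx.
Proof.
move=> /zdomP[cz _ _]; rewrite unitmx_mul unitmx_inv Gu /=.
apply: (mulmx1_unit (trans_inv hM ac0 (atlas_chart_at hM _) cz (dom_chart_at hM _))).1.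
Qed.

Lemma dzpt0 : dzpt 0 = invmx G.
Proof. by rewrite /dzpt zpt0 trans_id ?mulmx1//; exact: dom_chart_at. Qed.

Section CoordinateFrame.
Variable L : M -> set (TT R n).
Hypothesis hL : dirac_structure L.
Variables (r : nat) (U : set M) (e : 'I_r -> M -> TT R n).
Hypotheses (oU : open U) (se : forall i, smooth_section U (e i)).
Hypothesis Le : forall q, U q -> L q = [set` <<[seq e i q | i : 'I_r]>>%VS].

Definition zframe_v (z : 'rV[R]_n) : 'M[R]_(r, n) := loc_frame_v e c0 (aff z) *m G.
Definition zframe_c (z : 'rV[R]_n) : 'M[R]_(r, n) := loc_frame_c e c0 (aff z) *m (invmx G)^T.
Let oz : open (zdom U) := open_zdom oU.

Lemma smooth_zframe : smooth_on (zdom U) zframe_v /\ smooth_on (zdom U) zframe_c.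
Proof.
have [sv sc] := smooth_loc_frame hM oU se ac0.
have oc := open_chart_image hM ac0 oU.
split=> j; (apply: (Ck_on_mulmx oz); last exact: Ck_on_cst).
  exact: (Ck_on_comp_mx (f := aff) oz oc _ (Ck_aff j oz) (sv j)).
exact: (Ck_on_comp_mx (f := aff) oz oc _ (Ck_aff j oz) (sc j)).
Qed.

Lemma zframe_vE z : zdom U z -> zframe_v z *m dzpt z = frame_v e (zpt z).
Proof.
move=> /zdomP[cz _ _]; rewrite /dzpt mulmxA mulmxK// /loc_frame_v -/(zpt z) -mulmxA.
by rewrite to_chartE trans_inv ?mulmx1//; [exact: atlas_chart_at|exact: dom_chart_at].
Qed.

Lemma zframe_cE z : zframe_c z = frame_c e (zpt z) *m (dzpt z)^T.
Proof. by rewrite /dzpt trmx_mul mulmxA. Qed.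

Lemma zframe_iso z : zdom U z ->
  zframe_v z *m (zframe_c z)^T + zframe_c z *m (zframe_v z)^T = 0.
Proof.
move=> Uz; have [_ Uq _] := zdomP Uz.
rewrite -[RHS](frame_iso hL Le Uq).
exact: iso_change (zframe_vE Uz) (zframe_cE z).
Qed.

(** At each [z] the coordinates are changed by [kap] to the chart attached to [zpt z], where
    [tor_chart_at] holds; naturality of [tor] brings the identity back. *)
Lemma zframe_tor z (c1 c2 c3 : 'rV[R]_r) : zdom U z ->
  tor (fun y => c1 *m zframe_v y) (fun y => c1 *m zframe_c y)
      (fun y => c2 *m zframe_v y) (fun y => c2 *m zframe_c y)
      (fun y => c3 *m zframe_v y) (fun y => c3 *m zframe_c y) z = 0.
Proof.
move=> Uz; have [cz Uq zE] := zdomP Uz.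
pose q := zpt z; pose d := chart_at q.
have ad : atlas M d := atlas_chart_at hM q.
have dq : dom d q := dom_chart_at hM q.
have od : open (dom d) by have [_ _ + _ _] := hM => /(_ d ad)[].
pose A := zdom (U `&` dom d).
have oA : open A by apply: open_zdom; exact: openI.
have Az : A z by exists (zpt z).
have AU y : A y -> zdom U y by case=> p [cp [Up dp] py]; exists p.
pose kap := (toE d \o ofE c0) \o aff.
have Ad y : A y -> (toE c0 @` (dom c0 `&` dom d)) (aff y).
  by case=> p [cp [Up dp] py]; exists p.
have kapz : kap z = toE d q by [].
have sk : Ck_on 2 A kap.
  exact: (Ck_on_comp_mx (f := aff) oA (open_overlap hM ac0 ad) Ad (Ck_aff 2 oA) (smooth_trans hM ac0 ad 2)).
have Jk y : A y -> jacobian kap y = invmx G *m trans c0 d (zpt y).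
  move=> Ay; have [cy [_ dy] yE] := zdomP Ay.
  have dt : differentiable (toE d \o ofE c0) (aff y).
    by rewrite -yE; exact: differentiable_trans.
  rewrite /kap (jacobian_comp (differentiable_aff y) dt) jacobian_aff /trans yE.
  by [].
have kv y : A y -> zframe_v y *m jacobian kap y = loc_frame_v e d (kap y).
  move=> Ay; have [cy [_ dy] yE] := zdomP Ay; rewrite (Jk y Ay) /zframe_v /loc_frame_v.
  have -> : ofE d (kap y) = zpt y by rewrite /kap /= (chart_ofEK hM ad dy).
  apply: vector_change => //; exact: (trans_cocycle hM (atlas_chart_at hM (zpt y)) ac0 ad (dom_chart_at hM _) cy dy).
have kc y : A y -> zframe_c y = loc_frame_c e d (kap y) *m (jacobian kap y)^T.
  move=> Ay; have [cy [_ dy] yE] := zdomP Ay; rewrite (Jk y Ay) /zframe_c /loc_frame_c.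
  have -> : ofE d (kap y) = zpt y by rewrite /kap /= (chart_ofEK hM ad dy).
  apply: covector_change; exact: (trans_cocycle hM ac0 ad (atlas_chart_at hM (zpt y)) cy dy (dom_chart_at hM _)).
have [sv sc] := smooth_zframe.
have dF (F : 'rV[R]_n -> 'M[R]_(r, n)) (c : 'rV[R]_r) : smooth_on (zdom U) F ->
    differentiable (fun y => c *m F y) z.
  move=> sF; apply: (differentiable_mulmx (differentiable_cst c z)).
  exact: Ck_diff (sF 1%N) Uz.
have Ux : (toE d @` (dom d `&` U)) (kap z) by rewrite kapz; exists q.
have dY c := loc_frame_diff hM oU se c ad Ux.
rewrite (@tor_natural R n A kap _ _ _ _ _ _
  (fun y => c1 *m loc_frame_v e d y) (fun y => c1 *m loc_frame_c e d y)
  (fun y => c2 *m loc_frame_v e d y) (fun y => c2 *m loc_frame_c e d y)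
  (fun y => c3 *m loc_frame_v e d y) (fun y => c3 *m loc_frame_c e d y) z oA Az sk).
- by rewrite kapz; exact: (tor_chart_at hM hL oU se Le c1 c2 c3 Uq).
- exact: dF sv.
- exact: dF sc.
- exact: dF sv.
- exact: dF sc.
- exact: (dY c1).1.
- exact: (dY c1).2.
- exact: (dY c2).1.
- exact: (dY c2).2.
- by move=> y Ay; rewrite -mulmxA kv.
- by move=> y Ay; rewrite -mulmxA -kc.
- by move=> y Ay; rewrite -mulmxA kv.
- by move=> y Ay; rewrite -mulmxA -kc.
- by rewrite -mulmxA kv.
- by rewrite -mulmxA -kc.
Qed.

Lemma zframe_span z (v b : 'rV[R]_n) : zdom U z ->
  L (zpt z) (v *m dzpt z, b) <->
  exists c, v = c *m zframe_v z /\ b *m (dzpt z)^T = c *m zframe_c z.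
Proof.
move=> Uz; have [_ Uq _] := zdomP Uz; have du := dzpt_unit Uz.
have dtu : (dzpt z)^T \in unitmx by rewrite unitmx_tr.
rewrite (frame_span Le _ Uq) zframe_cE -(zframe_vE Uz).
split=> -[c /= [vE bE]]; exists c.
  by rewrite bE mulmxA; split=> //; apply: (can_inj (mulmxK du)); rewrite vE mulmxA.
rewrite vE mulmxA; split=> //.
by apply: (can_inj (mulmxK dtu)); rewrite bE mulmxA.
Qed.

End CoordinateFrame.
End LinearCoordinates.

(** * The splitting neighbourhood *)

Section ProductChart.
Context {R : realType} {k l : nat}.
Variable rho : R.
Hypothesis rho_gt0 : 0 < rho.
Notation D := (oball (k + l) rho).
Notation S := (@ball_manifold R k rho).
Notation N := (@ball_manifold R l rho).

(** The sup norm makes a ball in the sum the product of the balls in the factors, so the product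
    chart has exactly [D] as its image. *)
Lemma oball_blockP (p : 'rV[R]_(k + l)) :
  D p <-> oball k rho (lsubmx p) /\ oball l rho (rsubmx p).
Proof.
split=> [Dp|[Dl Dr]].
  by split; apply: mx_norm_ltP => // i j; rewrite mxE; apply: le_lt_trans Dp; exact: mx_entry_le.
apply: mx_norm_ltP => // i j; rewrite -[p]hsubmxK mxE; case: fintype.splitP => j' _.
  by apply: le_lt_trans Dl; exact: mx_entry_le.
by apply: le_lt_trans Dr; exact: mx_entry_le.
Qed.

Definition pchart : chart R (S * N)%type (k + l) :=
  prod_chart (@ball_chart R k rho) (@ball_chart R l rho).

Lemma atlas_pchart c : atlas (prod_charted S N) c -> c = pchart.
Proof. by case=> c1 [c2 [-> -> ->]]. Qed.

Lemma pchart_oball x : D (toE pchart x).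
Proof. by apply/oball_blockP; rewrite row_mxKl row_mxKr; split; exact: squeeze_oball. Qed.

Lemma pchartK x : ofE pchart (toE pchart x) = x.
Proof. by case: x => s y; rewrite /= row_mxKl row_mxKr !squeezeK. Qed.

Lemma pchart_ofEK p : D p -> toE pchart (ofE pchart p) = p.
Proof.
move=> /oball_blockP[Dl Dr]; rewrite /= !stretchK//.
exact: hsubmxK.
Qed.

Lemma pchart_image (U : set (S * N)) :
  toE pchart @` (dom pchart `&` U) = D `&` ofE pchart @^-1` U.
Proof.
apply/seteqP; split=> [_ [x [_ Ux] <-]|p [Dp Up]].
  split; first exact: pchart_oball.
  by rewrite /preimage; change (U (ofE pchart (toE pchart x))); rewrite pchartK.
by exists (ofE pchart p); [split|exact: pchart_ofEK].
Qed.

Lemma continuous_lmx m m' (A : 'M[R]_(m, m')) : continuous (fun u : 'rV[R]_m => u *m A).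
Proof. by move=> u; exact: differentiable_continuous (differentiable_lmx A u). Qed.

Lemma continuous_pchart : continuous (toE pchart : S * N -> 'rV[R]_(k + l)).
Proof.
have -> : (toE pchart : S * N -> 'rV[R]_(k + l)) =
    (fun x => squeeze rho x.1 *m row_mx 1%:M 0 + squeeze rho x.2 *m row_mx 0 1%:M).
  apply/funext => x; rewrite !mul_mx_row !mulmx1 !mulmx0 /=.
  by rewrite add_row_mx addr0 add0r.
have cs m (A : 'M[R]_(m, k + l)) : continuous (fun u : 'rV[R]_m => squeeze rho u *m A).
  move=> u; exact: (@continuous_comp 'rV[R]_m 'rV[R]_m 'rV[R]_(k + l) (squeeze rho)
    (fun v => v *m A) u (@continuous_squeeze R m rho u) (@continuous_lmx m (k + l) A (squeeze rho u))).
move=> x; have ? : Filter (nbhs x) by exact: nbhs_filter.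
apply: cvgD.
  exact: (@continuous_comp (S * N)%type 'rV[R]_k 'rV[R]_(k + l) fst (fun u => squeeze rho u *m row_mx 1%:M 0) x cvg_fst (cs _ _ _)).
exact: (@continuous_comp (S * N)%type 'rV[R]_l 'rV[R]_(k + l) snd (fun u => squeeze rho u *m row_mx 0 1%:M) x cvg_snd (cs _ _ _)).
Qed.

Lemma continuous_pchart_ofE : {in D, continuous (ofE pchart : 'rV[R]_(k + l) -> S * N)}.
Proof.
move=> p /set_mem /oball_blockP[Dl Dr].
have ? : Filter (nbhs p) by exact: nbhs_filter.
have cl : lsubmx q @[q --> p] --> lsubmx p.
  have lE (q : 'rV[R]_(k + l)) : lsubmx q = q *m lsubmx 1%:M by rewrite mulmx_lsub mulmx1.
  by under eq_fun do rewrite lE; rewrite lE; exact: continuous_lmx.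
have cr : rsubmx q @[q --> p] --> rsubmx p.
  have rE (q : 'rV[R]_(k + l)) : rsubmx q = q *m rsubmx 1%:M by rewrite mulmx_rsub mulmx1.
  by under eq_fun do rewrite rE; rewrite rE; exact: continuous_lmx.
have csl := @continuous_comp 'rV[R]_(k + l) 'rV[R]_k 'rV[R]_k (fun q => lsubmx q)
  (stretch rho) p cl (continuous_stretch (mem_set Dl)).
have csr := @continuous_comp 'rV[R]_(k + l) 'rV[R]_l 'rV[R]_l (fun q => rsubmx q)
  (stretch rho) p cr (continuous_stretch (mem_set Dr)).
exact: (cvg_pair csl csr).
Qed.

Lemma open_pchart_image (U : set (S * N)) : open U -> open (toE pchart @` U).
Proof.
move=> oU; rewrite -[U](setTI) (_ : setT = dom pchart).
  rewrite pchart_image; apply: open_preimage_in => //; first exact: open_oball.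
  exact: continuous_pchart_ofE.
by apply/seteqP; split.
Qed.

End ProductChart.

Section Embedding.
Context {R : realType} {k l : nat} {M : charted R (k + l)}.
Hypothesis hM : smooth_manifold M.
Variables (m : M) (G : 'M[R]_(k + l)) (rho : R) (Phi : 'rV[R]_(k + l) -> 'rV[R]_(k + l)).
Hypotheses (Gu : G \in unitmx) (rho_gt0 : 0 < rho).
Notation D := (oball (k + l) rho).
Notation S := (@ball_manifold R k rho).
Notation N := (@ball_manifold R l rho).
Notation c0 := (chart_at m).
Notation pc := (@pchart R k l rho).
Hypothesis sPhi : smooth_on D Phi.
Hypothesis PhiB : forall p, D p -> zdom m G setT (Phi p).
Hypothesis Junit : forall p, D p -> jacobian Phi p \in unitmx.
Hypothesis lip : forall p q, D p -> D q -> `|Phi p - Phi q - (p - q)| <= 2^-1 * `|p - q|.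

Let oD : open D := @open_oball R (k + l) rho.
Let ac0 : atlas M c0 := atlas_chart_at hM m.
Let cPhi : {in D, continuous Phi} := Ck_on_cont (sPhi 0%N).

Definition emb (x : prod_charted S N) : M := zpt m G (Phi (toE pc x)).

Let emb_toE x : toE c0 (emb x) = aff m G (Phi (toE pc x)).
Proof. by have [_ _] := zdomP hM (PhiB (pchart_oball rho_gt0 x)). Qed.

(** [lip] holds for all pairs of points of the ball, so injectivity is global and not just local. *)
Lemma emb_inj : injective emb.
Proof.
move=> x y exy; have : aff m G (Phi (toE pc x)) = aff m G (Phi (toE pc y)).
  by rewrite -!emb_toE exy.
move=> /addrI /(can_inj (mulmxKV Gu)) Pxy.
have pxy := perturbed_id_inj lip (pchart_oball rho_gt0 x) (pchart_oball rho_gt0 y) Pxy.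
by rewrite -(pchartK rho_gt0 x) pxy pchartK.
Qed.

Let zdom_overlap (V : set M) p : D p ->
  zdom m G V (Phi p) <-> V (zpt m G (Phi p)).
Proof.
move=> Dp; have [cp _ pE] := zdomP hM (PhiB Dp).
split=> [/(zdomP hM)[]//|Vp].
by exists (zpt m G (Phi p)).
Qed.

Lemma emb_continuous : continuous emb.
Proof.
move=> x; pose p := toE pc x; have Dp : D p := pchart_oball rho_gt0 x.
have [cp _ pE] := zdomP hM (PhiB Dp).
apply: (@continuous_comp _ _ _ (toE pc) (fun p => zpt m G (Phi p))).
  exact: continuous_pchart.
apply: (@continuous_comp _ _ _ Phi (zpt m G)); first exact: (cPhi (mem_set Dp)).
apply: (@continuous_comp _ _ _ (aff m G) (ofE c0)); first exact: continuous_aff.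
have [_ _ + _ _] := hM => /(_ c0 ac0)[_ _ _ _]; apply.
by rewrite -pE; apply/mem_set; exists (zpt m G (Phi p)).
Qed.

Lemma emb_chart_image (V : set M) :
  toE pc @` (dom pc `&` emb @^-1` V) = D `&` Phi @^-1` zdom m G V.
Proof.
rewrite pchart_image//; apply/seteqP; split=> p [Dp]; rewrite /= -/(ofE pc p) => Vp.
  by split=> //; apply/(zdom_overlap _ Dp); move: Vp; rewrite /emb pchart_ofEK.
by split=> //; rewrite /emb pchart_ofEK//; apply/(zdom_overlap _ Dp).
Qed.

Lemma emb_locE (d : chart R M (k + l)) p : D p ->
  (toE d \o emb \o ofE pc) p = ((toE d \o ofE c0) \o aff m G \o Phi) p.
Proof. by move=> Dp; rewrite /emb /comp pchart_ofEK. Qed.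

Lemma emb_smooth_map : smooth_map emb.
Proof.
split; first exact: emb_continuous.
move=> c d /atlas_pchart -> ad j; rewrite emb_chart_image.
have od : open (dom d) by have [_ _ + _ _] := hM => /(_ d ad)[].
set A := _ `&` _; have oA : open A.
  by apply: open_preimage_in => //; exact: open_zdom.
have sub : A `<=` D by move=> p [].
have ov p : A p -> (toE c0 @` (dom c0 `&` dom d)) (aff m G (Phi p)) by case.
apply: (Ck_on_congr oA (f := (toE d \o ofE c0) \o (aff m G \o Phi))).
  by move=> p /sub Dp; rewrite emb_locE.
have saff : Ck_on j A (aff m G \o Phi).
  exact: (Ck_on_comp_mx (f := Phi) oA openT _ (Ck_on_sub sub (sPhi j)) (Ck_aff m G j openT)).
exact: (Ck_on_comp_mx (f := aff m G \o Phi) oA (open_overlap hM ac0 ad) ov saff (smooth_trans hM ac0 ad j)).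
Qed.

(** Each factor of [emb] is open: the product chart, [Phi] as a perturbation of the identity, the
    affine change of coordinates, and the inverse chart at [m]. *)
Lemma emb_open (V : set (S * N)) : open V -> open (emb @` V).
Proof.
move=> oV; pose A := toE pc @` V.
have oA : open A := open_pchart_image rho_gt0 oV.
have AD : A `<=` D by move=> _ [x _ <-]; exact: pchart_oball.
have oPA : open (Phi @` A) := perturbed_id_open lip oA AD.
have oaff : open (aff m G @` (Phi @` A)).
  rewrite (_ : _ @` _ = (fun x => x *m G - toE c0 m *m G) @^-1` (Phi @` A)).
    apply: open_comp => // x _; have ? : Filter (nbhs x) by exact: nbhs_filter.
    by apply: cvgB; [exact: continuous_lmx|exact: cvg_cst].
  apply/seteqP; split=> [_ [z Az <-]|x Ax].
    by rewrite /preimage /mkset -mulmxBl /aff addrC addKr mulmxKV.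
  exists ((x - toE c0 m) *m G); first by rewrite mulmxBl.
  by rewrite /aff mulmxK// addrC subrK.
rewrite (_ : emb @` V = ofE c0 @` (aff m G @` (Phi @` A))).
  apply: open_ofE_image => // _ [_ [p Ap <-] <-].
  have [cp _ pE] := zdomP hM (PhiB (AD _ Ap)).
  by exists (zpt m G (Phi p)).
apply/seteqP; split=> [_ [x Vx <-]|_ [_ [_ [_ [x Vx <-] <-] <-] <-]].
  exists (aff m G (Phi (toE pc x))) => //.
  by exists (Phi (toE pc x)) => //; exists (toE pc x) => //; exists x.
by exists x.
Qed.

Lemma emb_tangent x : let p := toE pc x in
  tangent_map emb x = jacobian Phi p *m dzpt m G (Phi p).
Proof.
move=> p; have Dp : D p := pchart_oball rho_gt0 x.
have [cp _ pE] := zdomP hM (PhiB Dp).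
pose d := chart_at (emb x); have ad : atlas M d := atlas_chart_at hM _.
have dp : dom d (zpt m G (Phi p)) := dom_chart_at hM (emb x).
have dPhi : differentiable Phi p := Ck_diff (sPhi 1%N) Dp.
have dt : differentiable (toE d \o ofE c0) (aff m G (Phi p)).
  by rewrite -pE; exact: differentiable_trans.
have da : differentiable (aff m G) (Phi p) := differentiable_aff m G _.
have dta : differentiable ((toE d \o ofE c0) \o aff m G) (Phi p) := differentiable_comp da dt.
rewrite /tangent_map -/d.
change (jacobian (toE d \o emb \o ofE pc) p = jacobian Phi p *m dzpt m G (Phi p)).
rewrite (jacobian_congr oD (g := ((toE d \o ofE c0) \o aff m G) \o Phi) _ Dp).
- rewrite (jacobian_comp dPhi dta) (jacobian_comp da dt) jacobian_aff.
  by rewrite /dzpt /trans pE.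
- by move=> q Dq; exact: emb_locE.
- exact: differentiable_comp dPhi dta.
Qed.

Lemma emb_tangent_unit x : tangent_map emb x \in unitmx.
Proof.
rewrite emb_tangent unitmx_mul Junit ?(dzpt_unit hM Gu (PhiB _))//; exact: pchart_oball.
Qed.

Lemma emb_open_embedding : open_embedding emb.
Proof.
split.
- exact: emb_smooth_map.
- exact: emb_inj.
- exact: emb_open.
- by move=> x; rewrite row_free_unit row_full_unit emb_tangent_unit.
Qed.

End Embedding.

Lemma addmx3_00 (R : realType) (A B C : 'M[R]_1) : (A + B + C) 0 0 = A 0 0 + B 0 0 + C 0 0.
Proof. by rewrite !mxE. Qed.

Lemma jacobian_retraction (R : realType) n (T : Type) (c : chart R T n) (A : set 'rV[R]_n) x :
  open A -> (forall y, A y -> toE c (ofE c y) = y) -> A x ->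
  jacobian (toE c \o ofE c) x = 1%:M.
Proof.
move=> oA cK Ax; rewrite -(jacobian_id x).
exact: (jacobian_congr oA cK Ax (differentiable_idfun x)).
Qed.

(** * Tensors on the model product of balls *)

Section ModelTensors.
Context {R : realType} {k l : nat}.
Variable rho : R.
Hypothesis rho_gt0 : 0 < rho.
Notation S := (@ball_manifold R k rho).
Notation N := (@ball_manifold R l rho).
Notation D := (oball (k + l) rho).
Notation pc := (@pchart R k l rho).
Let oD : open D := @open_oball R (k + l) rho.
Let oB : open (oball l rho) := @open_oball R l rho.

Section Bivector.
Variable P : 'rV[R]_l -> 'M[R]_l.
Hypotheses (sP : smooth_on (oball l rho) P).
Hypothesis skP : forall y, oball l rho y -> (P y)^T = - P y.
Hypothesis jacP : forall y (b1 b2 b3 : 'rV[R]_l), oball l rho y ->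
  dot (b2 *m 'D_(b1 *m P y) P y) b3 + dot (b3 *m 'D_(b2 *m P y) P y) b1
  + dot (b1 *m 'D_(b3 *m P y) P y) b2 = 0.

Definition ball_bivector (q : N) : 'M[R]_l := P (squeeze rho q).

Lemma loc_ball_bivector y : oball l rho y ->
  loc_bivector (M := N) (@ball_chart R l rho) ball_bivector y = P y.
Proof.
move=> Dy; rewrite /loc_bivector /to_chart.
rewrite (jacobian_retraction (c := @ball_chart R l rho) oB); first last.
- by rewrite /=; exact: squeeze_oball.
- by move=> z Dz; exact: stretchK.
by rewrite trmx1 mul1mx mulmx1 /ball_bivector /= stretchK.
Qed.

Lemma poisson_ball_bivector : poisson ball_bivector.
Proof.
split; first split.
- by move=> q; apply: skP; exact: squeeze_oball.
- move=> _ -> j; rewrite /= squeeze_range//.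
  by apply: (Ck_on_congr oB _ (sP j)) => y Dy; rewrite loc_ball_bivector.
- move=> q a b g; pose y : 'rV[R]_l := squeeze rho q.
  have Dy : oball l rho y := squeeze_oball rho_gt0 q.
  rewrite -[RHS](jacP a b g Dy) /schouten_square /= -/y loc_ball_bivector//.
  have DE v : 'D_v (loc_bivector (M := N) (@ball_chart R l rho) ball_bivector) y = 'D_v P y.
    exact: (derive_congr v oB loc_ball_bivector Dy).
  by rewrite !DE addmx3_00.
Qed.

End Bivector.

Section TwoForm.
Variable om : 'rV[R]_(k + l) -> 'M[R]_(k + l).
Hypothesis som : smooth_on D om.
Hypothesis skom : forall p, (om p)^T = - om p.
Hypothesis clom : forall p (u v z : 'rV[R]_(k + l)), D p ->
  dot (u *m 'D_z om p) v + dot (v *m 'D_u om p) z + dot (z *m 'D_v om p) u = 0.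

Definition ball_form2 (x : prod_charted S N) : 'M[R]_(k + l) := om (toE pc x).

Lemma loc_ball_form2 p : D p -> loc_form2 (M := prod_charted S N) pc ball_form2 p = om p.
Proof.
move=> Dp; rewrite /loc_form2 /of_chart.
change (jacobian (toE pc \o ofE pc) (toE pc (ofE pc p)) *m om (toE pc (ofE pc p))
  *m (jacobian (toE pc \o ofE pc) (toE pc (ofE pc p)))^T = om p).
rewrite pchart_ofEK// (jacobian_retraction oD _ Dp); last exact: pchart_ofEK.
by rewrite trmx1 mul1mx mulmx1.
Qed.

Lemma closed_ball_form2 : closed_form2 ball_form2.
Proof.
split; first split.
- by move=> x; exact: skom.
- move=> c /atlas_pchart -> j.
  have -> : toE pc @` dom pc = D.
    rewrite -[dom pc]setIT pchart_image// preimage_setT setIT.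
    by [].
  by apply: (Ck_on_congr oD _ (som j)) => p Dp; rewrite loc_ball_form2.
- move=> x u v z; pose p := toE pc x; have Dp : D p := pchart_oball rho_gt0 x.
  rewrite -[RHS](clom u v z Dp) /ext_deriv2.
  change ((u *m 'D_z (loc_form2 (M := prod_charted S N) pc ball_form2) p *m v^T
    + v *m 'D_u (loc_form2 (M := prod_charted S N) pc ball_form2) p *m z^T
    + z *m 'D_v (loc_form2 (M := prod_charted S N) pc ball_form2) p *m u^T) 0 0 =
    dot (u *m 'D_z om p) v + dot (v *m 'D_u om p) z + dot (z *m 'D_v om p) u).
  have DE w : 'D_w (loc_form2 (M := prod_charted S N) pc ball_form2) p = 'D_w om p.
    exact: (derive_congr w oD loc_ball_form2 Dp).
  by rewrite !DE addmx3_00.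
Qed.

End TwoForm.

End ModelTensors.

(** An invertible mixed block makes the span of the rows equal to its own orthogonal, without
    counting dimensions. A combination is subtracted to clear half of the coordinates; orthogonality
    says that the mixed block kills the other half. *)
Lemma mixed_block_span (R : realType) k l (X a : 'M[R]_(k + l)) (v b : 'rV[R]_(k + l)) :
  row_mx (lsubmx X) (rsubmx a) \in unitmx -> X *m a^T + a *m X^T = 0 ->
  X *m b^T + a *m v^T = 0 -> exists c, v = c *m X /\ b = c *m a.
Proof.
set U := row_mx _ _ => Uu iso vb.
pose c := row_mx (lsubmx v) (rsubmx b) *m invmx U; exists c.
have cU : c *m U = row_mx (lsubmx v) (rsubmx b) by rewrite /c mulmxKV.
have [vl br] : c *m lsubmx X = lsubmx v /\ c *m rsubmx a = rsubmx b.
  by move: cU; rewrite mul_mx_row => /eq_row_mx.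
pose v' := v - c *m X; pose b' := b - c *m a.
have v'l : lsubmx v' = 0 by rewrite /v' linearB /= -mulmx_lsub vl subrr.
have b'r : rsubmx b' = 0 by rewrite /b' linearB /= -mulmx_rsub br subrr.
have vb' : X *m b'^T + a *m v'^T = 0.
  have -> : b'^T = b^T - a^T *m c^T by rewrite [LHS]linearB /= trmx_mul.
  have -> : v'^T = v^T - X^T *m c^T by rewrite [LHS]linearB /= trmx_mul.
  rewrite !mulmxBr addrACA vb add0r -opprD.
  by rewrite !mulmxA -mulmxDl iso mul0mx oppr0.
have : U *m col_mx (lsubmx b')^T (rsubmx v')^T = 0.
  rewrite mul_row_col -[RHS]vb' -[in RHS](hsubmxK X) -[in RHS](hsubmxK a).
  rewrite -[in RHS](hsubmxK v') -[in RHS](hsubmxK b') v'l b'r !tr_row_mx !mul_row_col.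
  by rewrite !trmx0 !mulmx0 addr0 add0r.
move/(congr1 (mulmx (invmx U))); rewrite mulKmx// mulmx0 -col_mx0 => /eq_col_mx[b'l v'r].
have v'0 : v' = 0 by rewrite -[v']hsubmxK v'l -[rsubmx v']trmxK v'r trmx0 row_mx0.
have b'0 : b' = 0 by rewrite -[b']hsubmxK b'r -[lsubmx b']trmxK b'l trmx0 row_mx0.
by split; apply/eqP; rewrite -subr_eq0; apply/eqP.
Qed.

(** * The splitting at a point of the manifold *)

Section Splitting.
Context {R : realType} {k l : nat} {M : charted R (k + l)}.
Hypothesis hM : smooth_manifold M.
Variable L : M -> set (TT R (k + l)).
Hypothesis hL : dirac_structure L.
Variables (m : M) (r : nat) (U : set M) (e : 'I_r -> M -> TT R (k + l)).
Hypotheses (oU : open U) (Um : U m) (se : forall i, smooth_section U (e i)).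
Hypothesis Le : forall q, U q -> L q = [set` <<[seq e i q | i : 'I_r]>>%VS].
Variable G : 'M[R]_(k + l).
Hypothesis Gu : G \in unitmx.
Hypothesis kerG : forall v : 'rV[R]_(k + l),
  (exists c, v = c *m frame_v e m /\ c *m frame_c e m = 0) <->
  (forall j : 'I_(k + l), (k <= j)%N -> (v *m G) 0 j = 0).

Notation zv := (zframe_v m G e).
Notation zc := (zframe_c m G e).
Notation zU := (zdom m G U).

Let z0 : zU 0 := zdom0 hM G Um.

Lemma zframe0 : zv 0 = frame_v e m *m G /\ zc 0 = frame_c e m *m (invmx G)^T.
Proof.
have := zframe_vE hM Gu e z0; rewrite zframe_cE (dzpt0 hM) (zpt0 hM) => <-.
by rewrite mulmxKV.
Qed.

Lemma adapted_frame_at : exists (C : 'M[R]_(k + l, r)) (P0 : 'M[R]_l),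
  C *m zv 0 = block_mx 1%:M 0 0 P0 /\ C *m zc 0 = block_mx 0 0 0 1%:M.
Proof.
have [v0 c0] := zframe0; have Gtu : (invmx G)^T \in unitmx by rewrite unitmx_tr unitmx_inv.
apply: adapted_frame.
- exact: (zframe_iso hM Gu hL Le z0).
- move=> v; have := kerG (v *m invmx G); rewrite mulmxKV// => kv.
  rewrite v0 c0; split=> [[c [vE cE]]|rv].
    apply/rowP => j; rewrite !mxE; apply: kv.1; last by rewrite /= leq_addr.
    exists c; split; first by rewrite vE mulmxA mulmxK.
    by apply: (can_inj (mulmxK Gtu)); rewrite -mulmxA cE mul0mx.
  have [|c [vE cE]] := kv.2.
    move=> j kj; rewrite -[v]hsubmxK rv mxE; case: fintype.splitP => j' jE; last by rewrite mxE.
    by move: kj; rewrite jE leqNgt ltn_ord.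
  exists c; split; last by rewrite mulmxA cE mul0mx.
  by rewrite mulmxA -vE mulmxKV.
(* The pair is carried back to the tangent space at [m], as [v *m invmx G] and [b *m G^T], where
   maximality of [L m] applies. *)
- move=> v b vb0 vb; have := zframe_span hM Gu Le v (b *m G^T) z0.
  rewrite (dzpt0 hM) (zpt0 hM) -[b *m G^T *m _]mulmxA -trmx_mul mulVmx// trmx1 mulmx1.
  move=> <-; have [_ maxL _] := hL; apply: (max_isotropic_mem (Le Um) (maxL m)).
    by rewrite pairingE /= -!dot_mulmx mulmxKV// vb0 addr0 mulr0.
  move=> z /(frame_span Le _ Um)[c [z1 z2]]; rewrite pairingE /= z1 z2.
  have := congr1 (fun w => dot w c) vb; rewrite dot0l v0 c0 => h.
  apply/eqP; rewrite mulf_eq0; apply/orP; right; apply/eqP; rewrite -[RHS]h.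
  rewrite dotDl !dot_mulmxT; congr (_ + _).
    by rewrite mulmxA -dot_mulmx.
  by rewrite dotC mulmxA dot_mulmxT.
Qed.

Theorem splitting : exists (S : charted R k) (N : charted R l) (s : S) (q : N)
    (phi : prod_charted S N -> M)
    (Pi : N -> 'M[R]_l) (omega : prod_charted S N -> 'M[R]_(k + l)),
    smooth_manifold S /\ smooth_manifold N /\
    open_embedding phi /\ phi (s, q) = m /\
    poisson Pi /\
    closed_form2 omega /\ omega (s, q) = 0 /\
    forall x : prod_charted S N,
      pullback_dirac phi L x
      = gauge omega (prod_dirac (@tangent_dirac R k S) (graph_bivector Pi)) x.
Proof.
have [C [P0 [X0 a0]]] := adapted_frame_at.
pose X z := C *m zv z; pose a z := C *m zc z.
have oz : open zU by exact: open_zdom.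
have [sv sc] : smooth_on zU zv /\ smooth_on zU zc by exact: smooth_zframe.
have sXz : smooth_on zU X by move=> j; apply: (Ck_on_mulmx oz) => //; exact: Ck_on_cst.
have saz : smooth_on zU a by move=> j; apply: (Ck_on_mulmx oz) => //; exact: Ck_on_cst.
have isoz z : zU z -> X z *m (a z)^T + a z *m (X z)^T = 0.
  by move=> Uz; exact: isotropic_lmul (zframe_iso hM Gu hL Le Uz).
have torz z (c1 c2 c3 : 'rV[R]_(k + l)) : zU z ->
  tor (fun y => c1 *m X y) (fun y => c1 *m a y) (fun y => c2 *m X y)
      (fun y => c2 *m a y) (fun y => c3 *m X y) (fun y => c3 *m a y) z = 0.
  move=> Uz; rewrite -(zframe_tor hM Gu hL oU se Le (c1 *m C) (c2 *m C) (c3 *m C) Uz).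
  by apply: (tor_congr oz Uz) => [y _|y _|y _|y _||]; rewrite mulmxA.
have [r1 r1_gt0 r1U] := near0_oball (open_nearP oz z0 (fun y Uy => Uy)).
have sX1 : smooth_on (oball (k + l) r1) X by move=> j; exact: Ck_on_sub r1U (sXz j).
have sa1 : smooth_on (oball (k + l) r1) a by move=> j; exact: Ck_on_sub r1U (saz j).
(* The ball is shrunk once more to keep this block invertible, so that the adapted rows span [L] at
   all points reached by [Phi]. *)
have Y0 : mixed_block X a 0 = 1%:M.
  rewrite /mixed_block /X /a X0 a0 !block_mxEh row_mxKl row_mxKr.
  by rewrite -block_mxEh -scalar_mx_block.
have Y0u : mixed_block X a 0 \in unitmx by rewrite Y0 unitmx1.
have [r0 [r0_gt0 r01 Yu]] :=
  shrink_oball r1_gt0 (near_unitmx r1_gt0 (smooth_mixed_block sX1 sa1 0%N) Y0u).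
have r0U z : oball (k + l) r0 z -> zU z by move=> /(oball_sub r01); exact: r1U.
have sX : smooth_on (oball (k + l) r0) X by move=> j; exact: Ck_on_sub r0U (sXz j).
have sa : smooth_on (oball (k + l) r0) a by move=> j; exact: Ck_on_sub r0U (saz j).
have [rho [Phi [om [P [[rho_gt0 sPhi Phi0] [PhiB Junit lip] [som skom om0 clom] [sP skP jacP] span]]]]] :=
  local_normal_form r0_gt0 sX sa (fun z Dz => isoz z (r0U z Dz))
    (fun z c1 c2 c3 Dz => torz z c1 c2 c3 (r0U z Dz)) X0 a0.
have PhiT p : oball (k + l) rho p -> zdom m G setT (Phi p).
  move=> /PhiB /r0U [q [cq _] qE]; by exists q.
pose S := @ball_manifold R k rho; pose N := @ball_manifold R l rho.
pose pc := @pchart R k l rho.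
pose phi : prod_charted S N -> M := @emb R k l M m G rho Phi.
have sq0 n : squeeze rho (0 : 'rV[R]_n) = 0 by rewrite /squeeze scaler0.
have pc0 : toE pc (0, 0) = 0 by rewrite /= !sq0 row_mx0.
exists S, N, (0 : 'rV[R]_k), (0 : 'rV[R]_l), phi, (@ball_bivector R l rho P), (@ball_form2 R k l rho om).
split; first exact: smooth_ball_manifold.
split; first exact: smooth_ball_manifold.
split; first exact: (emb_open_embedding hM Gu rho_gt0 sPhi PhiT Junit lip).
split.
  by rewrite /phi /emb pc0 Phi0 (zpt0 hM).
split; first exact: (poisson_ball_bivector rho_gt0 sP skP jacP).
split; first exact: (closed_ball_form2 rho_gt0 som skom clom).
split.
  by rewrite /ball_form2 pc0 om0.
move=> x; pose p := toE pc x.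
have Dp : oball (k + l) rho p := pchart_oball rho_gt0 x.
have Up := r0U _ (PhiB p Dp).
pose K := dzpt m G (Phi p); have Ku : K \in unitmx := dzpt_unit hM Gu Up.
pose J := jacobian Phi p; have Ju : J \in unitmx := Junit p Dp.
have tE : tangent_map phi x = J *m K := emb_tangent hM rho_gt0 sPhi PhiT x.
have phiE : phi x = zpt m G (Phi p) by [].
(* The [k + l] adapted rows lie in the span of the [r] original ones by construction;
   [mixed_block_span] gives the converse. *)
have frame v b : L (phi x) (v *m K, b) <->
    exists c, v = c *m X (Phi p) /\ b *m K^T = c *m a (Phi p).
  rewrite phiE (zframe_span hM Gu Le v b Up); split=> [[c [vE bE]]|[c [-> ->]]].
    apply: mixed_block_span (Yu _ (PhiB p Dp)) (isoz _ Up) _.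
    by rewrite vE bE; exact: isotropic_lmul (zframe_iso hM Gu hL Le Up).
  by exists (c *m C); rewrite !mulmxA.
have mem w : pullback_dirac phi L x w <->
    exists u d, w.1 = row_mx u (d *m P (rsubmx p)) /\ w.2 = row_mx 0 d + w.1 *m om p.
  rewrite -(span p w.1 w.2 Dp) -/J /pullback_dirac tE; split.
    move=> [v [b [+ ->]]] /=; rewrite (mulmxA v) => /frame[c [vE bE]].
    by exists c; rewrite (trmx_mul J K) (mulmxA b) bE.
  move=> [c [vE bE]]; have Ktu : K^T \in unitmx by rewrite unitmx_tr.
  exists w.1, (c *m a (Phi p) *m invmx K^T); rewrite (mulmxA _ J); split.
    by apply/frame; exists c; rewrite mulmxKV.
  by rewrite (trmx_mul J K) (mulmxA _ K^T) mulmxKV// -bE -surjective_pairing.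
apply/seteqP; split=> [w /mem[u [d [w1 w2]]]|_ [_ [y [z [y2 [d _ <-] ->]]] <-]].
  exists (row_mx u (d *m P (rsubmx p)), row_mx 0 d).
    exists (u, 0), (d *m P (rsubmx p), d); split=> //.
    by exists d => //; rewrite /ball_bivector /p /= row_mxKr.
  by rewrite /= -w1 -w2 -surjective_pairing.
apply/mem; exists y.1, d; rewrite y2 /=; split=> //.
by rewrite /ball_bivector /p /= row_mxKr.
Qed.

End Splitting.

Theorem theorem3p2 (R : realType) (n : nat) (M : charted R n)
    (hM : smooth_manifold M) (L : M -> set (TT R n)) (hL : dirac_structure L) (m : M) :
  exists (k l : nat) (S : charted R k) (N : charted R l) (s : S) (q : N)
    (phi : prod_charted S N -> M)
    (Pi : N -> 'M[R]_l) (omega : prod_charted S N -> 'M[R]_(k + l)),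
    smooth_manifold S /\ smooth_manifold N /\
    open_embedding phi /\ phi (s, q) = m /\
    poisson Pi /\
    closed_form2 omega /\ omega (s, q) = 0 /\
    forall x : prod_charted S N,
      pullback_dirac phi L x
      = gauge omega (prod_dirac (@tangent_dirac R k S) (graph_bivector Pi)) x.
Proof.
have [[r /(_ m)[U [e [oU Um se Le]]]] _ _] := hL.
have Le' q : U q -> L q = [set` <<[seq e i q | i : 'I_r]>>%VS] by move=> /Le[].
have [k [G [kn Gu kerG]]] := kernel_coordinates (frame_v e m) (frame_c e m).
have nE : n = (k + (n - k))%N by rewrite subnKC.
(* After the substitution the dimension is literally [k + l], and block decompositions need no
   casts. *)
move: (n - k)%N nE => l nE; subst n.
exists k, l; exact: (splitting hM hL oU Um se Le' Gu kerG).
Qed.
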